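(* Let the setting described in the context hold, and let $C_{\mathrm{DRO}}$ denote the optimal value of (DRO). Let (Primal) denote the minimization problem $$\begin{aligned}\min_{\boldsymbol x,\,f_1,\dots,f_d}\ & \langle \mathbf c_1,\boldsymbol x\rangle+\sum_{i=1}^d\int_{\Omega_i}\sup_{z\in\mathbb R}\{z\omega-f_i(z)\}\,\mu_i(\mathrm d\omega)\\ \text{s.t. } & \mathbf L_{\mathrm{in}}\boldsymbol x\le \mathbf q_{\mathrm{in}},\quad \mathbf L_{\mathrm{eq}}\boldsymbol x=\mathbf q_{\mathrm{eq}},\\ & \langle \mathbf Q\boldsymbol x+\mathbf b,\boldsymbol\lambda\rangle+\sum_{i=1}^d f_i(\langle\mathbf p_i,\boldsymbol\lambda\rangle)\le 0\quad\forall\boldsymbol\lambda\in\mathcal S_2^*,\\ & \boldsymbol x\in\mathbb R_+^{k_1},\quad f_i\in\mathcal C_{\mathrm{cvx}}(\mathbb R)\ \ \forall 1\le i\le d,\end{aligned}$$ and let (Dual) denote the maximization problem $$\begin{aligned}\max_{\tau,\,\boldsymbol\xi_{\mathrm{in}},\,\boldsymbol\xi_{\mathrm{eq}}}\ & \int_{\mathcal S_2^*}\langle\mathbf b,\boldsymbol\lambda\rangle\,\tau(\mathrm d\boldsymbol\lambda)-\Big(\sum_{i=1}^d \mathrm{OT}_{\mu_i}(\langle\mathbf p_i,\cdot\rangle\sharp\tau)\Big)+\langle\mathbf q_{\mathrm{in}},\boldsymbol\xi_{\mathrm{in}}\rangle+\langle\mathbf q_{\mathrm{eq}},\boldsymbol\xi_{\mathrm{eq}}\rangle\\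 \text{s.t. } & \mathbf c_1+\int_{\mathcal S_2^*}\mathbf Q^{\mathsf T}\boldsymbol\lambda\,\tau(\mathrm d\boldsymbol\lambda)\ge \mathbf L_{\mathrm{in}}^{\mathsf T}\boldsymbol\xi_{\mathrm{in}}+\mathbf L_{\mathrm{eq}}^{\mathsf T}\boldsymbol\xi_{\mathrm{eq}},\\ & \tau\in\mathcal P_1(\mathcal S_2^* ),\quad \boldsymbol\xi_{\mathrm{in}}\in\mathbb R_-^{n_{\mathrm{in}}},\quad\boldsymbol\xi_{\mathrm{eq}}\in\mathbb R^{n_{\mathrm{eq}}}.\end{aligned}$$ Then: (i) $C_{\mathrm{DRO}}<\infty$, and the optimal values of (Primal) and (Dual) are both equal to $C_{\mathrm{DRO}}$. (ii) $C_{\mathrm{DRO}}>-\infty$ if and only if there exist $\boldsymbol\lambda\in\mathcal S_2^*$, $\boldsymbol\xi_{\mathrm{in}}\in\mathbb R_-^{n_{\mathrm{in}}}$, $\boldsymbol\xi_{\mathrm{eq}}\in\mathbb R^{n_{\mathrm{eq}}}$ satisfying $\mathbf c_1+\mathbf Q^{\mathsf T}\boldsymbol\lambda\ge\mathbf L_{\mathrm{in}}^{\mathsf T}\boldsymbol\xi_{\mathrm{in}}+\mathbf L_{\mathrm{eq}}^{\mathsf T}\boldsymbol\xi_{\mathrm{eq}}$. In particular, $(\delta_{\boldsymbol\lambda},\boldsymbol\xi_{\mathrm{in}},\boldsymbol\xi_{\mathrm{eq}})$ is feasible for (Dual) in this case. Suppose in addition that $C_{\mathrm{DRO}}>-\infty$.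 Then: (iii) (Primal) has an optimizer. (iv) Let $(\bar{\boldsymbol x},\bar f_1,\dots,\bar f_d)$ be an arbitrary optimizer of (Primal) and let $\bar f_i^*(\omega):=\sup_{z\in\mathbb R}\{z\omega-\bar f_i(z)\}$ for $\omega\in\Omega_i$, $i=1,\dots,d$. Then $\bar{\boldsymbol x}$ is an optimizer of (DRO). Moreover, for any $\mu\in\Gamma(\mu_1,\dots,\mu_d)$, one has $\mu\in\arg\max_{\mu'\in\Gamma(\mu_1,\dots,\mu_d)}\big\{\int_{\boldsymbol\Omega}C_2(\bar{\boldsymbol x},\boldsymbol\omega)\,\mu'(\mathrm d\boldsymbol\omega)\big\}$ if and only if $\sum_{i=1}^d\bar f_i^*(\omega_i)=C_2(\bar{\boldsymbol x},\boldsymbol\omega)$ for $\mu$-almost every $\boldsymbol\omega=(\omega_1,\dots,\omega_d)^{\mathsf T}\in\boldsymbol\Omega$. (v) For any $\varepsilon>0$ and any $\varepsilon$-optimizer $(\boldsymbol x_\varepsilon,f_{1,\varepsilon},\dots,f_{d,\varepsilon})$ of (Primal), $\boldsymbol x_\varepsilon$ is an $\varepsilon$-optimizer of (DRO). (vi) (Dual) has an optimizer $(\bar\tau,\bar{\boldsymbol\xi}_{\mathrm{in}},\bar{\boldsymbol\xi}_{\mathrm{eq}})$ which satisfies $\mathrm{supp}(\bar\tau)\subseteq\mathcal V_{\mathrm{extr}}$. (vii) Let $(\bar\tau,\bar{\boldsymbol\xi}_{\mathrm{in}},\bar{\boldsymbol\xi}_{\mathrm{eq}})$ be an arbitrary optimizer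 of (Dual). Then there exists $\bar\pi\in\mathcal P(\boldsymbol\Omega\times\mathcal S_2^* )$ with marginal $\mu_i$ on $\Omega_i$ for $i=1,\dots,d$ and marginal $\bar\tau$ on $\mathcal S_2^*$ such that, for any optimizer $\bar{\boldsymbol x}$ of (DRO), it holds that $\boldsymbol\lambda\in\arg\max_{\boldsymbol\lambda'\in\mathcal S_2^*}\{\langle\mathbf Q\bar{\boldsymbol x}+\mathbf P\boldsymbol\omega+\mathbf b,\boldsymbol\lambda'\rangle\}$ for $\bar\pi$-almost every $(\boldsymbol\omega,\boldsymbol\lambda)\in\boldsymbol\Omega\times\mathcal S_2^*$, and the marginal $\bar\mu$ of $\bar\pi$ on $\boldsymbol\Omega$ satisfies $\bar\mu\in\arg\max_{\mu\in\Gamma(\mu_1,\dots,\mu_d)}\big\{\int_{\boldsymbol\Omega}C_2(\bar{\boldsymbol x},\boldsymbol\omega)\,\mu(\mathrm d\boldsymbol\omega)\big\}$. (viii) Let $(\boldsymbol x,f_1,\dots,f_d)$ be feasible for (Primal) and let $(\tau,\boldsymbol\xi_{\mathrm{in}},\boldsymbol\xi_{\mathrm{eq}})$ be feasible for (Dual). Then $(\boldsymbol x,f_1,\dots,f_d)$ and $(\tau,\boldsymbol\xi_{\mathrm{in}},\boldsymbol\xi_{\mathrm{eq}})$ are optimizers of (Primal) and (Dual), respectively, if and only if all of the following hold: (a) $\langle\mathbf L_{\mathrm{in}}\boldsymbol x-\mathbf q_{\mathrm{in}},\boldsymbol\xi_{\mathrm{in}}\rangle=0$; (b) $\big\langle\mathbf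 c_1+\int_{\mathcal S_2^*}\mathbf Q^{\mathsf T}\boldsymbol\lambda\,\tau(\mathrm d\boldsymbol\lambda)-\mathbf L_{\mathrm{in}}^{\mathsf T}\boldsymbol\xi_{\mathrm{in}}-\mathbf L_{\mathrm{eq}}^{\mathsf T}\boldsymbol\xi_{\mathrm{eq}},\boldsymbol x\big\rangle=0$; (c) $\langle\mathbf Q\boldsymbol x+\mathbf b,\boldsymbol\lambda\rangle+\sum_{i=1}^d f_i(\langle\mathbf p_i,\boldsymbol\lambda\rangle)=0$ for $\tau$-almost every $\boldsymbol\lambda$; (d) $-\int_{\Omega_i}\sup_{z\in\mathbb R}\{z\omega-f_i(z)\}\,\mu_i(\mathrm d\omega)-\int_{\mathbb R}f_i\,\mathrm d(\langle\mathbf p_i,\cdot\rangle\sharp\tau)=\mathrm{OT}_{\mu_i}(\langle\mathbf p_i,\cdot\rangle\sharp\tau)$ for $i=1,\dots,d$.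
   Context: Notation. $\mathbb N_0=\mathbb N\cup\{0\}$, $\mathbb R_+=[0,\infty)$, $\mathbb R_-=(-\infty,0]$; vector inequalities are componentwise; $\langle\cdot,\cdot\rangle$ is the Euclidean inner product. For closed $\mathcal Y\subseteq\mathbb R^n$, $\mathcal P(\mathcal Y)$ is the set of Borel probability measures on $\mathcal Y$ and $\mathcal P_1(\mathcal Y)$ the subset of those with finite first moment; $\mathrm{supp}$ denotes the support, $\delta_{\boldsymbol y}$ the Dirac measure, $g\sharp\mu$ the pushforward of $\mu$ by $g$. $\mathcal C_{\mathrm{cvx}}(\mathbb R)$ is the set of continuous convex functions $\mathbb R\to\mathbb R$. A polyhedral convex set is a finite intersection of closed half-spaces; for such $P$, $\mathrm{extr}(P)$ is its set of extreme points, $\mathrm{recc}(P)$ its recession cone, and $\mathrm{line}(P)=\mathrm{recc}(P)\cap(-\mathrm{recc}(P))$ its lineality space. The optimal value of an infeasible minimization (maximization) problem is $+\infty$ ($-\infty$). An optimizer is a feasible point attaining the optimal value; an $\varepsilon$-optimizer is a feasible point whose objective is within $\varepsilon$ of the optimal value. Setting. Let $d\ge 2$ be an integer, $\Omega_i=[\underline\omega_i,\overline\omega_i]$ with $-\infty<\underline\omega_i\le\overline\omega_i<\infty$, $\mu_i\in\mathcal P(\Omega_i)$ ($i=1,\dots,d$), and $\boldsymbol\Omega=\Omega_1\times\cdots\times\Omega_d$. $\Gamma(\mu_1,\dots,\mu_d)$ is the set of $\gamma\in\mathcal P(\boldsymbol\Omega)$ whose marginal on $\Omega_i$ is $\mu_i$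 for every $i$. Let $k_1\in\mathbb N$, $\mathbf c_1\in\mathbb R^{k_1}$, $n_{\mathrm{in}},n_{\mathrm{eq}}\in\mathbb N_0$, $\mathbf L_{\mathrm{in}}\in\mathbb R^{n_{\mathrm{in}}\times k_1}$, $\mathbf q_{\mathrm{in}}\in\mathbb R^{n_{\mathrm{in}}}$, $\mathbf L_{\mathrm{eq}}\in\mathbb R^{n_{\mathrm{eq}}\times k_1}$, $\mathbf q_{\mathrm{eq}}\in\mathbb R^{n_{\mathrm{eq}}}$, and assume that $\mathcal S_1:=\{\boldsymbol x\in\mathbb R_+^{k_1}:\mathbf L_{\mathrm{in}}\boldsymbol x\le\mathbf q_{\mathrm{in}},\ \mathbf L_{\mathrm{eq}}\boldsymbol x=\mathbf q_{\mathrm{eq}}\}$ is non-empty. Let $k_2^*\in\mathbb N$, $\mathbf Q\in\mathbb R^{k_2^*\times k_1}$, $\mathbf P\in\mathbb R^{k_2^*\times d}$ with $i$-th column $\mathbf p_i\in\mathbb R^{k_2^*}$, $\mathbf b\in\mathbb R^{k_2^*}$. Let $m_{\mathrm{in}},m_{\mathrm{eq}}\in\mathbb N_0$ with $m_{\mathrm{in}}+m_{\mathrm{eq}}=k_2^*$, $k_2\in\mathbb N$, $\mathbf A_{\mathrm{in}}\in\mathbb R^{m_{\mathrm{in}}\times k_2}$, $\mathbf A_{\mathrm{eq}}\in\mathbb R^{m_{\mathrm{eq}}\times k_2}$, $\mathbf c_2\in\mathbb R^{k_2}$, and assume that $\mathcal S_2^*:=\{(\boldsymbol\lambda_{\mathrm{in}}^{\mathsf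 T},\boldsymbol\lambda_{\mathrm{eq}}^{\mathsf T})^{\mathsf T}:\boldsymbol\lambda_{\mathrm{in}}\in\mathbb R_-^{m_{\mathrm{in}}},\ \boldsymbol\lambda_{\mathrm{eq}}\in\mathbb R^{m_{\mathrm{eq}}},\ \mathbf A_{\mathrm{in}}^{\mathsf T}\boldsymbol\lambda_{\mathrm{in}}+\mathbf A_{\mathrm{eq}}^{\mathsf T}\boldsymbol\lambda_{\mathrm{eq}}\le\mathbf c_2\}\subset\mathbb R^{k_2^*}$ is non-empty. The optimal second-stage cost is $C_2(\boldsymbol x,\boldsymbol\omega):=\max_{\boldsymbol\lambda\in\mathcal S_2^*}\langle\mathbf Q\boldsymbol x+\mathbf P\boldsymbol\omega+\mathbf b,\boldsymbol\lambda\rangle$ for $\boldsymbol x\in\mathcal S_1$, $\boldsymbol\omega\in\boldsymbol\Omega$, and it is assumed that $\sup_{\boldsymbol x\in\mathcal S_1,\boldsymbol\omega\in\boldsymbol\Omega}C_2(\boldsymbol x,\boldsymbol\omega)<\infty$. Let $\mathcal V_{\mathrm{extr}}:=\mathrm{extr}(\mathcal S_2^*\cap\mathrm{line}(\mathcal S_2^* )^\perp)$, a finite subset of $\mathcal S_2^*$. Problem (DRO): minimize over $\boldsymbol x\in\mathcal S_1$ the function $\langle\mathbf c_1,\boldsymbol x\rangle+\sup_{\mu\in\Gamma(\mu_1,\dots,\mu_d)}\int_{\boldsymbol\Omega}C_2(\boldsymbol x,\boldsymbol\omega)\,\mu(\mathrm d\boldsymbol\omega)$; its optimal value is $C_{\mathrm{DRO}}$.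 For $\nu\in\mathcal P_1(\mathbb R)$, $\mathrm{OT}_{\mu_i}(\nu):=\inf_{\gamma\in\Gamma(\mu_i,\nu)}\int_{\Omega_i\times\mathbb R}-z\omega\,\gamma(\mathrm d\omega,\mathrm dz)$, where $\Gamma(\mu_i,\nu)$ is the set of couplings of $\mu_i$ and $\nu$. $\langle\mathbf p_i,\cdot\rangle$ denotes the map $\boldsymbol\lambda\mapsto\langle\mathbf p_i,\boldsymbol\lambda\rangle$. *)

(* Defs.v *)
From HB Require Import structures.
From mathcomp Require Import all_boot all_order all_algebra.
From mathcomp Require Import all_classical all_reals all_analysis.
From mathcomp Require Import measurable_realfun.

Set Implicit Arguments.
Unset Strict Implicit.
Unset Printing Implicit Defensive.

Import Order.TTheory GRing.Theory Num.Theory.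
Import numFieldNormedType.Exports.

Local Open Scope classical_set_scope.
Local Open Scope ring_scope.

Section Optimization.
Variables (R : realType) (T : Type).
Implicit Types (A : set T) (F : T -> \bar R) (a : T).
Local Open Scope ereal_scope.

(* `ereal_inf set0 = +oo` and `ereal_sup set0 = -oo`: the optimal value of an
   infeasible problem. *)
Definition min_value A F := ereal_inf [set F a | a in A].
Definition max_value A F := ereal_sup [set F a | a in A].

Definition minimizer A F a := A a /\ F a = min_value A F.
Definition maximizer A F a := A a /\ F a = max_value A F.
Definition eps_minimizer (eps : R) A F a :=
  A a /\ F a <= min_value A F + eps%:E.

End Optimization.

(* 'cV[R]_n with its Borel sigma-algebra. *)
Notation borelV R n := (g_sigma_algebraType (@open 'cV[R]_n)).

Section Euclidean.
Variable R : realType.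

Definition dotp n (u v : 'cV[R]_n) : R := \sum_i u i 0 * v i 0.

Definition vle n (u v : 'cV[R]_n) : Prop := forall i, u i 0 <= v i 0.

Definition coord n (i : 'I_n) (u : 'cV[R]_n) : R := u i 0.

Section Sets.
Variable n : nat.
Implicit Types P : set 'cV[R]_n.

Definition recc P : set 'cV[R]_n :=
  [set y | forall x t, P x -> 0 <= t -> P (x + t *: y)].

Definition lineality P : set 'cV[R]_n := [set y | recc P y /\ recc P (- y)].

Definition orthogonal_compl P : set 'cV[R]_n :=
  [set y | forall x, P x -> dotp y x = 0].

Definition extr P : set 'cV[R]_n :=
  [set x | P x /\ forall y z t, P y -> P z -> 0 < t < 1 ->
    x = t *: y + (1 - t) *: z -> y = x /\ z = x].

End Sets.

Lemma continuous_measurableV n (f : 'cV[R]_n -> R) :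
  continuous f -> measurable_fun [set: borelV R n] (f : borelV R n -> R).
Proof.
move=> /continuousP cf.
apply: (measurability _ (RGenOpens.measurableE R)) => _ [_ [a [b ->] <-]].
by rewrite setTI; apply: sub_sigma_algebra; apply: cf; exact: interval_open.
Qed.

Lemma measurable_coord n (i : 'I_n) :
  measurable_fun [set: borelV R n] (coord i : borelV R n -> R).
Proof. by apply: continuous_measurableV; exact: coord_continuous. Qed.

Lemma measurable_dotp n (p : 'cV[R]_n) :
  measurable_fun [set: borelV R n] (dotp p : borelV R n -> R).
Proof.
apply: measurable_sum => i.
by apply: measurable_funM => //; exact: measurable_coord.
Qed.

Definition dotp_mfun n (p : 'cV[R]_n) : {mfun borelV R n >-> R} :=
  mfun_Sub (mem_set (measurable_dotp p)).

End Euclidean.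

Definition fst_mfun d1 d2 (T1 : measurableType d1) (T2 : measurableType d2) :
  {mfun (T1 * T2)%type >-> T1} := mfun_Sub (mem_set measurable_fst).

Section Measures.
Variable R : realType.
Local Open Scope ereal_scope.

(* P(Y), represented by the probability measures of the ambient space that
   give mass 1 to Y. *)
Definition prob_on d (T : measurableType d) (Y : set T) :
  set (probability T R) := [set mu | mu Y = 1].

(* `|y| is the sup norm; any norm gives the same set. *)
Definition prob1_on n (Y : set (borelV R n)) :
  set (probability (borelV R n) R) :=
  [set mu | prob_on Y mu /\ \int[mu]_(y in Y) (`|y : 'cV[R]_n|)%:E < +oo].

Definition diracV n (y : borelV R n) : probability (borelV R n) R := dirac y.

(* Equality as measures: the set functions may differ outside the
   sigma-algebra. *)
Definition same_measure d (T : measurableType d) (m1 m2 : set T -> \bar R) :=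
  forall A, measurable A -> m1 A = m2 A.

Definition supp n (mu : probability (borelV R n) R) : set 'cV[R]_n :=
  [set x | forall U : set 'cV[R]_n, open U -> U x -> 0 < mu U].

Definition couplings (Om : set R) (mu nu : probability R R) :
  set (probability (R * R)%type R) :=
  [set g | [/\ prob_on (Om `*` setT) g,
    same_measure (pushforward g fst) mu & same_measure (pushforward g snd) nu]].

Definition OT (Om : set R) (mu nu : probability R R) : \bar R :=
  min_value (couplings Om mu nu)
    (fun g => \int[g]_(wz in Om `*` setT) (- (wz.2 * wz.1))%:E).

(* Never -oo, so that finite sums of values of `conjugate` are free of the
   indeterminate form +oo - oo. *)
Definition conjugate (f : R -> R) (w : R) : \bar R :=
  ereal_sup [set (z * w - f z)%:E | z in [set: R]].

Definition Ccvx : set (R -> R) :=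
  [set f | continuous f /\ convex_function [set: R^o] f].

End Measures.

(* k_2^* = m_in + m_eq, and vectors indexed by it are `col_mx`-blocks; p_i is
   `col i P`. *)
Record dro_data (R : realType) (d k1 n_in n_eq m_in m_eq k2 : nat) := DroData {
  lo : 'I_d -> R;
  hi : 'I_d -> R;
  mu : 'I_d -> probability R R;
  c1 : 'cV[R]_k1;
  L_in : 'M[R]_(n_in, k1);
  q_in : 'cV[R]_n_in;
  L_eq : 'M[R]_(n_eq, k1);
  q_eq : 'cV[R]_n_eq;
  Q : 'M[R]_(m_in + m_eq, k1);
  P : 'M[R]_(m_in + m_eq, d);
  b : 'cV[R]_(m_in + m_eq);
  A_in : 'M[R]_(m_in, k2);
  A_eq : 'M[R]_(m_eq, k2);
  c2 : 'cV[R]_k2 }.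

Section Problem.
Variables (R : realType) (d k1 n_in n_eq m_in m_eq k2 : nat).
Variable D : dro_data R d k1 n_in n_eq m_in m_eq k2.
Local Open Scope ereal_scope.

Definition Omega_ (i : 'I_d) : set R := `[lo D i, hi D i]%classic.

Definition Omega : set 'cV[R]_d := [set w | forall i, Omega_ i (w i 0%R)].

Definition S1 : set 'cV[R]_k1 :=
  [set x | [/\ vle 0 x, vle (L_in D *m x) (q_in D) & L_eq D *m x = q_eq D]].

Definition S2 : set 'cV[R]_(m_in + m_eq) :=
  [set l | vle (usubmx l) 0 /\
    vle ((A_in D)^T *m usubmx l + (A_eq D)^T *m dsubmx l)%R (c2 D)].

Definition C2_obj (x : 'cV[R]_k1) (w : 'cV[R]_d) (l : 'cV[R]_(m_in + m_eq)) :
  \bar R := (dotp (Q D *m x + P D *m w + b D)%R l)%:E.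

Definition C2 (x : 'cV[R]_k1) (w : 'cV[R]_d) : \bar R :=
  max_value S2 (C2_obj x w).

Definition V_extr : set 'cV[R]_(m_in + m_eq) :=
  extr (S2 `&` orthogonal_compl (lineality S2)).

Definition Gamma : set (probability (borelV R d) R) :=
  [set g | prob_on (Omega : set (borelV R d)) g /\
    forall i,
      same_measure (pushforward g (coord i : borelV R d -> R)) (mu D i)].

Definition worst_case_obj (x : 'cV[R]_k1) (g : probability (borelV R d) R) :
  \bar R := \int[g]_(w in Omega) C2 x w.

Definition dro_obj (x : 'cV[R]_k1) : \bar R :=
  (dotp (c1 D) x)%:E + max_value Gamma (worst_case_obj x).

Definition C_DRO : \bar R := min_value S1 dro_obj.

Definition primal_var : Type := ('cV[R]_k1 * ('I_d -> R -> R))%type.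

Definition primal_obj (v : primal_var) : \bar R :=
  (dotp (c1 D) v.1)%:E +
  \sum_(i < d) \int[mu D i]_(w in Omega_ i) conjugate (v.2 i) w.

Definition primal_constr (x : 'cV[R]_k1) (f : 'I_d -> R -> R)
    (l : 'cV[R]_(m_in + m_eq)) : R :=
  (dotp (Q D *m x + b D) l + \sum_(i < d) f i (dotp (col i (P D)) l))%R.

Definition primal_feasible : set primal_var :=
  [set v | [/\ vle (L_in D *m v.1) (q_in D), L_eq D *m v.1 = q_eq D,
    forall l, S2 l -> (primal_constr v.1 v.2 l <= 0)%R,
    vle 0 v.1 & forall i, Ccvx (v.2 i)]].

Definition dual_var : Type :=
  (probability (borelV R (m_in + m_eq)) R * 'cV[R]_n_in * 'cV[R]_n_eq)%type.

Definition push (tau : probability (borelV R (m_in + m_eq)) R) (i : 'I_d) :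
  probability R R :=
  distribution tau (dotp_mfun (col i (P D))).

Definition QT_mean (tau : probability (borelV R (m_in + m_eq)) R) :
  'cV[R]_k1 := (\col_j \int[tau]_(l in S2) ((Q D)^T *m l) j 0)%R.

Definition dual_obj (v : dual_var) : \bar R :=
  let: (tau, xi_in, xi_eq) := v in
  \int[tau]_(l in S2) (dotp (b D) l)%:E
  - (\sum_(i < d) OT (Omega_ i) (mu D i) (push tau i))
  + (dotp (q_in D) xi_in)%:E + (dotp (q_eq D) xi_eq)%:E.

Definition dual_feasible : set dual_var :=
  [set v | let: (tau, xi_in, xi_eq) := v in
    [/\ vle ((L_in D)^T *m xi_in + (L_eq D)^T *m xi_eq)%R
          (c1 D + QT_mean tau)%R,
      prob1_on S2 tau & vle xi_in 0]].

Definition joint_type := (borelV R d * borelV R (m_in + m_eq))%type.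

Definition Omega_S2 : set joint_type := Omega `*` S2.

(* Only the one-dimensional marginals of the first component are prescribed. *)
Definition joint_couplings (tau : probability (borelV R (m_in + m_eq)) R) :
  set (probability joint_type R) :=
  [set pi | [/\ prob_on Omega_S2 pi,
    forall i, same_measure
      (pushforward pi (fun wl : joint_type => coord i wl.1 : R)) (mu D i) &
    same_measure (pushforward pi snd) tau]].

Definition marginal_Omega (pi : probability joint_type R) :
  probability (borelV R d) R := distribution pi (fst_mfun _ _).

End Problem.

(* Main.v *)
Require Import Defs.
From HB Require Import structures.
From mathcomp Require Import all_boot all_order all_algebra.
From mathcomp Require Import all_classical all_reals all_analysis.
From mathcomp Require Import measurable_realfun ring lra finmap.
Require Import Defs.

Set Implicit Arguments.
Unset Strict Implicit.
Unset Printing Implicit Defensive.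

Import Order.TTheory GRing.Theory Num.Theory.
Import numFieldNormedType.Exports.

(** Write f* for the convex conjugate and S2 for the set of second-stage dual
    solutions.  The second-stage cost is bounded, so the linear functional that
    it maximizes over S2 is maximal at one of finitely many points v_1, ..., v_N,
    the extreme points of the part of S2 orthogonal to its lineality space:
    C_2(x, w) = max_k <Q x + P w + b, v_k> ([C2_vertices]).

    Both weak inequalities are elementary.  If (x, f) is feasible for the primal,
    Young's inequality z w <= f_i(z) + f_i*(w) gives
    C_2(x, w) <= sum_i f_i*(w_i), and integrating against a coupling bounds the
    robust cost of x by the primal value ([dro_le_primal]).  For a dual feasible
    tau, one needs a joint law of (w, l) with l of law tau in which every w_i
    is optimally coupled to <p_i, l>.  A monotone coupling in dimension one is
    explicit: w_i is the quantile function of mu_i at the distributional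
    transform of <p_i, l>, and atoms of the law of <p_i, l> are broken by an
    independent uniform variable.  The same uniform variable serves all i, so
    that the joint law ([glued]) is a plain pushforward of tau times the uniform
    law, and no disintegration is needed.  Testing the worst case at its
    marginal bounds the dual value by the robust cost ([dual_le_dro_obj]).
    Moreover an antiderivative of the quantile function composed with the
    distribution function of <p_i, l> touches Young's inequality along this
    coupling, so the coupling and the potential are both optimal for the
    one-dimensional transport problem ([OT_contact]).

    The gap is closed by a reduction to finitely many unknowns.  Let psi_(i, k)
    stand for the value of f_i at <p_i, v_k>, and let h(x, psi) be
    <c1, x> + sum_i int max_k (<p_i, v_k> w - psi_(i, k)) dmu_i(w)
    + max_k (<Q x + b, v_k> + sum_i psi_(i, k)).  Every (x, psi) gives a
    primal feasible point of value at most h(x, psi) ([extension_feasible],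
    [extension_obj]).  Conversely, let m be a lower bound of the convex function
    h.  A minimax theorem replaces the last maximum by an average with weights t_k
    ([lower_bound_weights]).  With tau = sum_k t_k delta_(v_k) and psi the values
    of the optimal transport potentials, the lower bound becomes an affine one in x
    alone, and linear programming duality on S1 supplies xi_in and xi_eq: the
    dual has a point of value at least m, supported on the v_k
    ([dual_of_lower_bound]).

    If h is unbounded below, all values are -oo.  Otherwise h attains its
    minimum ([reduced_obj_attained]): truncation confines psi to a compact box
    without increasing h, for fixed psi the minimization in x is a linear program,
    and the minimal value is Lipschitz in psi.  Applied to m = min h, the two
    constructions yield a primal point and a dual point with the same value, hence
    equality of the values, both attainment claims and the claim on the support
    ([strong_duality_or_unbounded]).

    The other claims read off equality cases.  The mean of a dual feasible tau
    lies in S2, which gives finiteness from a single point of S2.  Equality in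
    the integrated Young inequality is almost sure equality in the pointwise one.
    For an optimal tau the whole chain of inequalities through the glued law is
    tight.  Finally, the difference between a primal and a dual value is a sum of
    nonnegative terms, whose vanishing is complementary slackness
    ([complementary_slackness]). *)

Local Open Scope classical_set_scope.
Local Open Scope ring_scope.

(** * Linear inequalities and polyhedra *)

Section Scalar.
Variables (R : realFieldType) (W : lmodType R).
Implicit Types (f : W -> R).

Lemma linfD f x y : scalar f -> f (x + y) = f x + f y.
Proof. by move=> lf; rewrite -[x]scale1r lf mul1r scale1r. Qed.

Lemma linf0 f : scalar f -> f 0 = 0.
Proof. by move=> lf; apply: (@addrI _ (f 0)); rewrite -linfD// !addr0. Qed.

Lemma linfZ f k x : scalar f -> f (k *: x) = k * f x.
Proof. by move=> lf; rewrite -[k *: x]addr0 lf linf0// addr0. Qed.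

Lemma linfN f x : scalar f -> f (- x) = - f x.
Proof. by move=> lf; rewrite -scaleN1r linfZ// mulN1r. Qed.

Lemma linfB f x y : scalar f -> f (x - y) = f x - f y.
Proof. by move=> lf; rewrite linfD// linfN. Qed.

(** Induction on the number of functionals, valid in any vector space.  If the
    first inequality is not redundant, some x0 satisfies all the others but has
    [0 < c x0]; then [a0 x0] is positive, and projecting along x0 onto the kernel of
    a0 reduces to the remaining functionals. *)
Lemma farkas_ord n (a : 'I_n -> W -> R) (c : W -> R) :
  (forall i, scalar (a i)) -> scalar c ->
  (forall x, (forall i, a i x <= 0) -> c x <= 0) ->
  exists l : 'I_n -> R, (forall i, 0 <= l i) /\ forall x, c x = \sum_i l i * a i x.
Proof.
elim: n a c => [|n IH] a c sa sc H.
  exists (fun=> 0); split=> // x; rewrite big_ord0; apply/eqP; rewrite eq_le H/=; last by case.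
  by rewrite -oppr_le0 -(linfN _ sc) H//; case.
pose a0 := a ord0; pose a' i := a (lift ord0 i).
have [[x0 Hx0]|nx] := pselect (exists x, (forall i, a' i x <= 0) /\ 0 < c x); last first.
  have [i|//|x Hx|l [l0 lE]] := IH a' c; first exact: sa.
    by rewrite leNgt; apply/negP => cx; apply: nx; exists x.
  exists (fun i => oapp l 0 (unlift ord0 i)); split=> [i|x].
    by case: unliftP => //= j _; apply: l0.
  rewrite big_ord_recl unlift_none /= mul0r add0r lE.
  by apply: eq_bigr => i _; rewrite liftK.
have [ax cx] := Hx0.
have a0x : 0 < a0 x0.
  rewrite ltNge; apply/negP => a0x.
  suff : c x0 <= 0 by rewrite leNgt cx.
  by apply: H => i; have [j ->|->] := unliftP ord0 i; [exact: ax | exact: a0x].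
pose k := (a0 x0)^-1.
have kK : a0 x0 * k = 1 by rewrite mulfV// gt_eqF.
have k0 : 0 < k by rewrite invr_gt0.
have [i|u v w|x Hx|l [l0 lE]] := IH (fun i x => a' i x - a' i x0 * k * a0 x)
   (fun x => c x - c x0 * k * a0 x).
- move=> u v w; rewrite /a' /a0 !sa; ring.
- rewrite /a0 sc sa; ring.
- pose y := x - (k * a0 x) *: x0.
  have : c y <= 0.
    apply: H => i; have [j ->|->] := unliftP ord0 i; rewrite /y linfB ?linfZ//.
      have := Hx j; rewrite /a'; lra.
    by rewrite -/(a0 x) -/(a0 x0) mulrAC [k * _]mulrC kK mul1r subrr.
  by rewrite /y linfB// linfZ//; lra.
(* the multiplier of a0 is forced by evaluating the identity at x0 *)
exists (fun i => oapp l (k * (c x0 - \sum_i l i * a' i x0)) (unlift ord0 i)); split.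
  move=> i; case: unliftP => /= [j _|_]; first exact: l0.
  rewrite mulr_ge0 ?(ltW k0)// subr_ge0 (le_trans _ (ltW cx))// sumr_le0// => j _.
  by rewrite mulr_ge0_le0.
move=> x; rewrite big_ord_recl unlift_none /=.
rewrite [X in _ = _ + X](eq_bigr (fun i => l i * a' i x)); last first.
  by move=> i _; rewrite liftK.
have := lE x => /eqP; rewrite subr_eq => /eqP ->.
rewrite [X in X + _](eq_bigr (fun i => l i * a' i x - l i * (a' i x0 * k * a0 x))).
  2: by move=> i _; rewrite mulrBr.
rewrite sumrB.
have -> : \sum_(i < n) l i * (a' i x0 * k * a0 x) = k * a0 x * \sum_i l i * a' i x0.
  rewrite mulr_sumr; apply: eq_bigr => i _; ring.
rewrite -/a0 /a'; ring.
Qed.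

Lemma farkas (I : finType) (a : I -> W -> R) (c : W -> R) :
  (forall i, scalar (a i)) -> scalar c ->
  (forall x, (forall i, a i x <= 0) -> c x <= 0) ->
  exists l : I -> R, (forall i, 0 <= l i) /\ forall x, c x = \sum_i l i * a i x.
Proof.
move=> sa sc H; have [i|//|x Hx|l [l0 lE]] := @farkas_ord #|I| (fun i => a (enum_val i)) c.
- exact: sa.
- by apply: H => i; rewrite -[i]enum_rankK; exact: Hx.
exists (fun i => l (enum_rank i)); split=> // x; rewrite lE.
rewrite [RHS](reindex _ (onW_bij _ (@enum_val_bij I)))/=.
by apply: eq_bigr => i _; rewrite enum_valK.
Qed.

Section Polyhedron.
Variables (I : finType) (a : I -> W -> R) (beta : I -> R).
Hypothesis sa : forall i, scalar (a i).

Definition polyhedron : set W := [set y | forall i, a i y <= beta i].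

Definition tight y : {set I} := [set i | a i y == beta i].

(** Stated through directions rather than ranks: the tight constraints span
    all the constraints.  For a polyhedron without lines these are the vertices. *)
Definition basic_point y := polyhedron y /\
  forall e, (forall i, i \in tight y -> a i e = 0) -> forall i, a i e = 0.

(** As long as the tight constraints do not determine all the others, there is a
    direction along which they stay tight and [c] does not decrease; following it until
    it leaves the polyhedron makes one more constraint tight. *)
Lemma basic_point_above (c : W -> R) M y : scalar c ->
  (forall z, polyhedron z -> c z <= M) -> polyhedron y ->
  exists2 z, basic_point z & c y <= c z.
Proof.
move=> sc cM; have [n] := ubnP (#|I| - #|tight y|).
elim: n y => // n IH y nle Py.
have [bas|nb] := pselect (forall e, (forall i, i \in tight y -> a i e = 0) ->
  forall i, a i e = 0).
  by exists y.
have [e [te [c0 [j0 j0P]]]] : exists e, (forall i, i \in tight y -> a i e = 0) /\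
    0 <= c e /\ exists j, 0 < a j e.
  have {nb}[e [te [j aj]]] : exists e, (forall i, i \in tight y -> a i e = 0) /\
      exists j, a j e != 0.
    apply: contra_notP nb => nb e te i; apply/eqP/negPn/negP => ai.
    by apply: nb; exists e; split=> //; exists i.
  have teN : forall i, i \in tight y -> a i (- e) = 0.
    by move=> i /te aie; rewrite linfN// aie oppr0.
  (* the bound M on c forbids a ray of increase *)
  have pos e' : (forall i, i \in tight y -> a i e' = 0) -> 0 < c e' ->
      exists j, 0 < a j e'.
    move=> te' ce'; apply: contrapT => nj.
    have : c (y + ((`|M| + `|c y| + 1) / c e') *: e') <= M.
      apply: cM => i; rewrite linfD// linfZ// -[leRHS]addr0 lerD// mulr_ge0_le0//.
        by rewrite divr_ge0 ?addr_ge0// ltW.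
      by rewrite leNgt; apply/negP => ?; apply: nj; exists i.
    rewrite linfD// linfZ// mulfVK ?gt_eqF//.
    have := ler_norm M; have := lerNnormlW (lexx `|c y|); lra.
  have [ce|ce|ce] := ltgtP (c e) 0.
  - exists (- e); split=> //; rewrite linfN// ; split; first by rewrite oppr_ge0 ltW.
    by apply: pos => //; rewrite linfN// oppr_gt0.
  - by exists e; split=> //; split; [exact: ltW|exact: pos].
  - have [aj0|aj0|aj0] := ltgtP (a j e) 0; last by rewrite aj0 eqxx in aj.
    + exists (- e); split=> //; rewrite linfN// ce oppr0; split=> //.
      by exists j; rewrite linfN// oppr_gt0.
    + by exists e; rewrite ce; split=> //; split=> //; exists j.
(* ratio test: r i is the step at which constraint i becomes tight *)
pose r i := (beta i - a i y) / a i e.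
pose j := [arg min_(i < j0 | 0 < a i e) r i]%O.
have [aj rj] : 0 < a j e /\ forall i, 0 < a i e -> r j <= r i.
  by rewrite /j; case: arg_minP => // i.
have r0 : 0 <= r j by rewrite divr_ge0 ?(ltW aj)// subr_ge0.
have Pz : polyhedron (y + r j *: e).
  move=> i; rewrite linfD// linfZ//.
  have [ai|ai] := leP (a i e) 0.
    by rewrite -[leRHS]addr0 lerD// mulr_ge0_le0.
  by rewrite -lerBrDl -ler_pdivlMr// rj.
have [|z bz cz] := IH _ _ Pz.
  move: nle; rewrite ltnS => nle; apply: leq_trans nle; apply: ltn_sub2l.
    rewrite -cardsT proper_card// properE finset.subsetT/=; apply/subsetPn; exists j; rewrite ?inE//.
    by apply/eqP => ajy; move: aj; rewrite te ?ltxx// inE ajy.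
  apply: proper_card; apply/properP; split.
    apply/fintype.subsetP => i it; rewrite inE linfD// linfZ// te// mulr0 addr0.
    by move: it; rewrite inE.
  exists j.
    rewrite inE linfD// linfZ//.
    have -> : r j * a j e = beta j - a j y by rewrite /r divfK ?gt_eqF.
    by rewrite subrKC.
  by apply/negP => jt; move: aj; rewrite te// ltxx.
exists z => //; apply: le_trans cz; rewrite linfD// linfZ//.
by rewrite lerDl mulr_ge0.
Qed.

(** Hence, modulo the lineality space, there are at most as many basic points as
    sets of constraints. *)
Lemma basic_point_same_tight y z : basic_point y -> tight y = tight z ->
  forall i, a i (y - z) = 0.
Proof.
move=> [_ by_] tyz; apply: by_ => i it.
rewrite linfB//; move: (it); rewrite tyz; move: it.
by rewrite !inE => /eqP -> /eqP ->; rewrite subrr.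
Qed.

Lemma scalar_bounded_lineality (c : W -> R) M y e : scalar c ->
  (forall z, polyhedron z -> c z <= M) -> polyhedron y ->
  (forall i, a i e = 0) -> c e = 0.
Proof.
move=> sc cM Py ae; apply: contrapT => /eqP ce.
have : c (y + ((`|M| + `|c y| + 1) / c e) *: e) <= M.
  by apply: cM => i; rewrite linfD// linfZ// ae mulr0 addr0.
rewrite linfD// linfZ// mulfVK//.
have := ler_norm M; have := lerNnormlW (lexx `|c y|); lra.
Qed.

(** The optimum is the best of one basic point per set of tight constraints. *)
Lemma linear_program_attained (c : W -> R) M : scalar c ->
  (forall z, polyhedron z -> c z <= M) -> polyhedron !=set0 ->
  exists2 y, polyhedron y & forall z, polyhedron z -> c z <= c y.
Proof.
move=> sc cM [y0 Py0]; have [z0 bz0 _] := basic_point_above sc cM Py0.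
pose r J := xget z0 [set z | basic_point z /\ tight z = J].
have br J : basic_point (r J).
  by rewrite /r; case: xgetP => [z _ [//]|//].
pose J := [arg max_(J > tight z0 | true) c (r J)]%O.
exists (r J); first exact: (br J).1.
move=> y Py; have [z bz /le_trans] := basic_point_above sc cM Py; apply.
have tr : tight (r (tight z)) = tight z.
  by rewrite /r; case: xgetP => [z' _ [] //|/(_ z)]; case.
have : c (r (tight z) - z) = 0.
  by apply: (scalar_bounded_lineality sc cM Py0); apply: basic_point_same_tight.
rewrite linfB// => /eqP; rewrite subr_eq0 => /eqP <-.
by rewrite /J; case: arg_maxP => // i _; apply.
Qed.

End Polyhedron.
End Scalar.

(** * A minimax theorem over the simplex *)

Lemma continuous_sum (R : realType) (T : topologicalType) (I : Type) (r : seq I)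
    (P : pred I) (f : I -> T -> R) :
  (forall i, continuous (f i)) -> continuous (fun x => \sum_(i <- r | P i) f i x).
Proof.
move=> cf; elim: r => [|i r IH].
  by under eq_fun do rewrite big_nil; exact: cst_continuous.
under eq_fun do rewrite big_cons; case: (P i) => // x.
by apply: cvgD; [exact: cf|exact: IH].
Qed.

Lemma closed_preimage_continuous (S T : topologicalType) (f : S -> T) (A : set T) :
  continuous f -> closed A -> closed (f @^-1` A).
Proof. by move=> /continuous_closedP; apply. Qed.

Lemma lipschitz_continuous (R : realType) (V : normedModType R) (f : V -> R) (k : R) :
  0 <= k -> (forall y z, f z <= f y + k * `|z - y|) -> continuous f.
Proof.
move=> k0 fk x.
have k1 : 0 < k + 1 by rewrite (le_lt_trans k0)// ltrDl.
apply/cvgrPdist_lt => e e0; near=> y.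
apply: (@le_lt_trans _ _ (k * `|x - y|)).
  rewrite ler_norml; have := fk x y; have := fk y x; rewrite (distrC y x) => ? ?.
  by apply/andP; split; lra.
apply: (@le_lt_trans _ _ ((k + 1) * `|x - y|)); first by rewrite ler_wpM2r// lerDl.
rewrite -ltr_pdivlMl //; near: y.
have c0 : 0 < (k + 1)^-1 * e by rewrite mulr_gt0// invr_gt0.
by apply/nbhs_ballP; exists ((k + 1)^-1 * e) => // z; rewrite -ball_normE.
Unshelve. all: by end_near. Qed.

Lemma mx_entry_norm_le (R : realType) m n (u : 'M[R]_(m, n)) i j : `|u i j| <= `|u|.
Proof.
have -> : `|u| = mx_norm u by [].
by rewrite mx_normrE; apply/bigmax_geP; right => /=; exists (i, j).
Qed.

(** The set [C] plays the role of the image of a convex set under a vector of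
    convex functions, whence convexity up to domination. *)
Section Minimax.
Variables (R : realType) (N : nat) (C : set ('I_N -> R)).
Hypothesis convC : forall y z (t : R), C y -> C z -> 0 <= t <= 1 ->
  exists2 w, C w & forall i, w i <= t * y i + (1 - t) * z i.

Lemma convex_cone_dominated k (y : 'I_k -> 'I_N -> R) (s : 'I_k -> R) :
  (forall j, C (y j)) -> (forall j, 0 <= s j) -> 0 < \sum_j s j ->
  exists2 w, C w & forall i, (\sum_j s j) * w i <= \sum_j s j * y j i.
Proof.
elim: k y s => [|k IH] y s Cy s0; first by rewrite big_ord0 ltxx.
rewrite big_ord_recl => sgt0.
set S := \sum_(_ < k) _ in sgt0 *.
have S0 : 0 <= S by apply: sumr_ge0 => j _; exact: s0.
have [S1|S1] := leP S 0.
  have SE : S = 0 by apply/eqP; rewrite eq_le S1.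
  exists (y ord0) => // i; rewrite big_ord_recl SE addr0 lerDl sumr_ge0// => j _.
  have /eqP : S = 0 by []; rewrite psumr_eq0// => /allP/(_ j).
  by rewrite mem_index_enum => /(_ isT)/eqP ->; rewrite mul0r.
have [w Cw wP] := IH _ _ (fun j => Cy (lift ord0 j)) (fun j => s0 (lift ord0 j)) S1.
have [|w' Cw' w'P] := @convC (y ord0) w (s ord0 / (s ord0 + S)) (Cy _) Cw.
  by rewrite divr_ge0 ?(ltW sgt0)//= ler_pdivrMr// mul1r lerDl.
exists w' => // i; rewrite big_ord_recl.
apply: (@le_trans _ _ (s ord0 * y ord0 i + S * w i)); last by rewrite lerD2l.
rewrite -ler_pdivlMl// (le_trans (w'P i))// le_eqVlt; apply/orP; left; apply/eqP.
by field; rewrite gt_eqF.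
Qed.

Definition simplex : set 'rV[R]_N :=
  [set t | (forall i, 0 <= t 0 i) /\ \sum_i t 0 i = 1].

Lemma compact_simplex : compact simplex.
Proof.
apply: (@subclosed_compact _ _ [set v : 'rV[R]_N | forall i, `[0, 1]%classic (v ord0 i)]).
- have -> : simplex = \bigcap_i [set t : 'rV[R]_N | 0 <= t 0 i]
      `&` [set t | \sum_i t 0 i = 1].
    by apply/seteqP; split=> t /= [t0 t1]; split=> // i; [move=> _|]; apply: t0.
  apply: closedI.
    apply: closed_bigI => i _; apply: (@closed_preimage_continuous _ _ (fun t : 'rV[R]_N => t 0 i) [set x : R | 0 <= x]).
      exact: coord_continuous.
    exact: closed_ge.
  apply: (@closed_preimage_continuous _ _ (fun t : 'rV[R]_N => \sum_i t 0 i) [set x : R | x = 1]) => [|].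
    by apply: continuous_sum => i; exact: coord_continuous.
  exact: closed_eq.
- have := @rV_compact R N (fun=> `[0, 1]%classic); apply=> i.
  exact: segment_compact.
- move=> t /= [t0 t1] i; rewrite in_itv/= t0/= -t1 (bigD1 i)//= lerDl.
  by apply: sumr_ge0.
Qed.

(** Farkas' lemma applied to the functional [t] of (s, t): if all s_j are
    nonnegative and [\sum_j s j * y j i + t <= 0] for all i, then [t <= 0], for
    otherwise a convex combination of the y_j would dominate a point of [C] all of
    whose coordinates are negative.  The multipliers of the coordinates are the
    weights. *)
Lemma finite_minimax k (y : 'I_k -> 'I_N -> R) : (0 < N)%N ->
  (forall y, C y -> exists i, 0 <= y i) ->
  (forall j, C (y j)) ->
  exists t : 'I_N -> R, [/\ forall i, 0 <= t i, \sum_i t i = 1 &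
    forall j, 0 <= \sum_i t i * y j i].
Proof.
move=> N0 C0 Cy.
pose W := ('rV[R]_k * R^o)%type.
pose a (i : 'I_k + 'I_N) (p : W) : R :=
  match i with inl j => - p.1 0 j
             | inr i => \sum_j p.1 0 j * y j i + p.2 end.
have [[j|i] u v w|//|[s t] /= H|l [l0 lE]] := @farkas R W _ a (fun p => p.2 : R).
- by rewrite /a /= !mxE; ring.
- rewrite /a /= mulrDr mulr_sumr addrACA -big_split/=; congr (_ + _).
  by apply: eq_bigr => j _; rewrite !mxE; ring.
- have s0 j : 0 <= s 0 j by rewrite -oppr_le0; exact: (H (inl j)).
  rewrite leNgt; apply/negP => t0.
  have Si i : \sum_j s 0 j * y j i < 0.
    by have := H (inr i); rewrite /a/=; lra.
  have [|S0] := ltP 0 (\sum_j s 0 j).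
    move=> S0; have [w Cw wP] := convex_cone_dominated Cy s0 S0.
    have [i wi] := C0 _ Cw; have := Si i; rewrite ltNge (le_trans _ (wP i))//.
    by rewrite mulr_ge0// ltW.
  have := Si (Ordinal N0); rewrite big1 ?ltxx// => j _.
  suff /eqP -> : s 0 j == 0 by rewrite mul0r.
  rewrite eq_le s0 andbT (le_trans _ S0)// (bigD1 j)//= lerDl sumr_ge0//.
exists (fun i => l (inr i)); split=> // [|j].
  have := lE (0, 1); rewrite big_sumType/= big1 ?add0r/=; last first.
    by move=> j _; rewrite mxE oppr0 mulr0.
  move=> ->; apply: eq_bigr => i _; rewrite big1 ?add0r ?mulr1// => j _.
  by rewrite mxE mul0r.
have := lE (delta_mx 0 j, 0); rewrite big_sumType/= (bigD1 j)//= big1 ?addr0/=; last first.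
  by move=> i /negPf ij; rewrite mxE/= ij ?andbF oppr0 mulr0.
rewrite mxE !eqxx/= mulrN mulr1 => /eqP; rewrite eq_sym addrC subr_eq0 => /eqP lj.
rewrite (le_trans (l0 (inl j)))// -lj le_eqVlt; apply/orP; left; apply/eqP.
apply: eq_bigr => i _; rewrite addr0; congr (_ * _).
rewrite (bigD1 j)//= big1 ?addr0.
  by rewrite mxE !eqxx mul1r.
by move=> i' /negPf ij; rewrite mxE/= ij ?andbF mul0r.
Qed.

(** The weights that suit one point of [C] form a closed subset of the compact
    simplex, and finitely many of these sets meet by the finite case. *)
Lemma minimax : (0 < N)%N ->
  (forall y, C y -> exists i, 0 <= y i) ->
  exists t : 'I_N -> R, [/\ forall i, 0 <= t i, \sum_i t i = 1 &
    forall y, C y -> 0 <= \sum_i t i * y i].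
Proof.
move=> N0 C0.
pose f (y : 'I_N -> R) := simplex `&` [set t : 'rV[R]_N | 0 <= \sum_i t 0 i * y i].
have := compact_simplex; rewrite compact_In0 => /(_ _ C f)[||t Ct].
- exists (fun y => [set t : 'rV[R]_N | 0 <= \sum_i t 0 i * y i]) => // y Cy.
  apply: (@closed_preimage_continuous _ _ (fun t : 'rV[R]_N => \sum_i t 0 i * y i) [set x : R | 0 <= x]); last exact: closed_ge.
  apply: continuous_sum => i x; apply: continuousM; [exact: coord_continuous|exact: cst_continuous].
- move=> D' D'C.
  have [|t [t0 t1 tP]] := @finite_minimax #|` D'| (fun j => nth (fun=> 0) D' j) N0 C0.
    by move=> j; apply/set_mem; apply: D'C; exact: mem_nth.
  exists (\row_i t i) => y yD'; split.
    split=> [i|]; first by rewrite mxE.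
    by rewrite -[RHS]t1; apply: eq_bigr => i _; rewrite mxE.
  have iD : (index y D' < #|` D'|)%N by rewrite index_mem.
  have := tP (Ordinal iD); rewrite /= nth_index//; congr (_ <= _).
  by apply: eq_bigr => i _; rewrite mxE.
have [[y0 Cy0]|Ce] := pselect (C !=set0).
  exists (t 0); have [[t0 t1] _] := Ct _ Cy0; split=> // y Cy.
  by have [_] := Ct _ Cy.
exists (fun i => (i == Ordinal N0)%:R); split=> [//||y Cy].
- by rewrite (bigD1 (Ordinal N0))//= big1 ?addr0// => i /negPf ->.
- by case: Ce; exists y.
Qed.

End Minimax.

(** * Euclidean space *)

Section Orthogonal.
Variables (R : realType) (n : nat).
Implicit Types (u v w y : 'cV[R]_n).

Lemma scalar_dotp u : scalar (dotp u : 'cV[R]_n -> R).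
Proof.
move=> k v w; rewrite /dotp mulr_sumr -big_split/=; apply: eq_bigr => i _.
by rewrite !mxE; ring.
Qed.

Lemma dotpC u v : dotp u v = dotp v u.
Proof. by apply: eq_bigr => i _; rewrite mulrC. Qed.

Lemma scalar_dotpl u : scalar (fun v : 'cV[R]_n => dotp v u).
Proof. by move=> k v w; rewrite !(dotpC _ u) scalar_dotp. Qed.

Lemma dotpDl u v w : dotp (u + v) w = dotp u w + dotp v w.
Proof. exact: (linfD _ _ (@scalar_dotpl w)). Qed.

Lemma dotpDr u v w : dotp w (u + v) = dotp w u + dotp w v.
Proof. exact: (linfD _ _ (@scalar_dotp w)). Qed.

Lemma dotpBr u v w : dotp w (u - v) = dotp w u - dotp w v.
Proof. exact: (linfB _ _ (@scalar_dotp w)). Qed.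

Lemma dotpBl u v w : dotp (u - v) w = dotp u w - dotp v w.
Proof. exact: (linfB _ _ (@scalar_dotpl w)). Qed.

Lemma dotpZr (k : R) v w : dotp w (k *: v) = k * dotp w v.
Proof. exact: (linfZ _ _ (@scalar_dotp w)). Qed.

Lemma dotpZl (k : R) v w : dotp (k *: v) w = k * dotp v w.
Proof. exact: (linfZ _ _ (@scalar_dotpl w)). Qed.

Lemma dotp_eq0 u : dotp u u = 0 -> u = 0.
Proof.
move=> /eqP; rewrite psumr_eq0 => [/allP u0|i _]; last by rewrite -expr2 sqr_ge0.
apply/matrixP => i j; rewrite ord1 mxE; apply/eqP.
by have := u0 i; rewrite mem_index_enum mulf_eq0 orbb; apply.
Qed.

(** Orthogonal projection onto the common kernel of finitely many functionals,
    built by Gram-Schmidt: [q] below is the projection of [a ord0] onto the common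
    kernel of the other vectors. *)
Lemma orthogonal_decomp m (a : 'I_m -> 'cV[R]_n) y :
  exists y0, (forall i, dotp (a i) y0 = 0) /\
    forall e, (forall i, dotp (a i) e = 0) -> dotp (y - y0) e = 0.
Proof.
elim: m a y => [|m IH] a y.
  by exists y; split=> [[]//|e _]; rewrite subrr (linf0 (@scalar_dotpl e)).
pose a' i := a (lift ord0 i).
have [q [qa qp]] := IH a' (a ord0).
have [y0 [y0a y0p]] := IH a' y.
have pe e : (forall i, dotp (a' i) e = 0) -> dotp (a ord0) e = dotp q e.
  by move=> /qp; rewrite (linfB _ _ (@scalar_dotpl e)) => /eqP; rewrite subr_eq0 => /eqP.
have [q0|q0] := eqVneq (dotp q q) 0.
  exists y0; split=> [i|e ae]; last by apply: y0p => i; apply: ae.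
  have [j ->|->] := unliftP ord0 i; first exact: y0a.
  by rewrite pe// (dotp_eq0 q0) (linf0 (@scalar_dotpl y0)).
exists (y0 - (dotp y0 q / dotp q q) *: q); split=> [i|e ae].
  have qy : dotp q (y0 - (dotp y0 q / dotp q q) *: q) = 0.
    by rewrite dotpBr dotpZr (dotpC q y0) divfK// subrr.
  have [j ->|->] := unliftP ord0 i.
    by rewrite dotpBr dotpZr -/(a' j) qa y0a mulr0 subr0.
  by rewrite pe// => j; rewrite dotpBr dotpZr qa y0a mulr0 subr0.
have ae' i : dotp (a' i) e = 0 by exact: ae.
by rewrite opprB addrCA dotpDl y0p// dotpZl -(pe e)// ae mulr0 addr0.
Qed.

End Orthogonal.

(** * Measure and integration *)

Section BorelVectors.
Variables (R : realType) (n : nat).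

Lemma closed_measurableV (F : set 'cV[R]_n) :
  closed F -> measurable (F : set (borelV R n)).
Proof.
move=> cF; rewrite -[F]setCK; apply: measurableC.
by apply: sub_sigma_algebra; exact: closed_openC.
Qed.

(** Every open set is a countable union of cubes with rational centers, so a map
    into the Borel space of vectors is measurable as soon as its coordinates are. *)
Lemma measurable_to_borelV d (T : measurableType d) (f : T -> borelV R n) :
  (forall i, measurable_fun setT (fun t => coord i (f t))) -> measurable_fun setT f.
Proof.
move=> mf; apply: (@measurability _ _ T (borelV R n) setT f (@open 'cV[R]_n) (erefl _)) => // _ [U oU <-]; rewrite setTI.
pose c (p : 'cV[rat]_n) : 'cV[R]_n := map_mx ratr p.
pose B (p : 'cV[rat]_n * nat) := [set t | forall i, `|coord i (f t) - c p.1 i 0| < p.2.+1%:R^-1].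
pose good (p : 'cV[rat]_n * nat) := forall x : 'cV[R]_n,
  (forall i, `|x i 0 - c p.1 i 0| < p.2.+1%:R^-1) -> U x.
have -> : f @^-1` U = \bigcup_p (if pselect (good p) then B p else set0).
  apply/seteqP; split=> [t Ut|t [p _]]; last first.
    by case: pselect => //= gp Bt; exact: gp.
  have /nbhs_ballP [e /= e0 eU] : nbhs (f t : 'cV[R]_n) U by exact: open_nbhs_nbhs.
  have [k ke] : exists k : nat, k.+1%:R^-1 + k.+1%:R^-1 < e.
    exists (Num.truncn (2 / e)).
    suff : (Num.truncn (2 / e)).+1%:R^-1 < e / 2.
      by rewrite [e in _ -> _ < e]splitr => ke; exact: ltrD.
    by rewrite -[ltRHS]invf_div ltf_pV2 ?posrE ?divr_gt0// truncnS_gt.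
  have q i : {q : rat | `|coord i (f t) - ratr q| < k.+1%:R^-1}.
    apply: cid; have [|q] := @rat_in_itvoo R (coord i (f t) - k.+1%:R^-1) (coord i (f t) + k.+1%:R^-1).
      have : (0 : R) < k.+1%:R^-1 by rewrite invr_gt0.
      by move: (_^-1) => r ?; lra.
    by rewrite in_itv/= => /andP[q1 q2]; exists q; rewrite ltr_norml; move: q1 q2; move: (_^-1) (ratr q) => r q' q1 q2; apply/andP; split; lra.
  exists (\col_i sval (q i), k) => //; case: pselect => [gp|ng].
    by move=> i /=; rewrite /c !mxE; exact: (svalP (q i)).
  apply: ng => x xB; apply: eU; split=> // i j; rewrite ord1.
  have := xB i; rewrite /= /c !mxE; have := svalP (q i); rewrite /coord => ? ?.
  rewrite /ball/= (lt_trans _ ke)// -(subrK (ratr (sval (q i))) (f t i 0)) -addrA.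
  by rewrite (le_lt_trans (ler_normD _ _))// ltrD// distrC.
apply: countable_bigcupT_measurable => // p; case: pselect => /= [_|_]; last exact: measurable0.
have -> : B p = \bigcap_i [set t | `|coord i (f t) - c p.1 i 0| < p.2.+1%:R^-1].
  by apply/seteqP; split=> t /= Bt i; [move=> _|]; apply: Bt.
apply: fin_bigcap_measurable => // i _.
have := (@measurable_fun_ltr _ _ _ setT (fun t => `|coord i (f t) - c p.1 i 0|) (cst p.2.+1%:R^-1)).
move=> /(_ _ _ measurableT [set true]); rewrite setTI; apply=> //.
by apply: measurableT_comp => //; apply: measurable_funB => //; exact: mf.
Qed.

End BorelVectors.

(** The domain [D] of full mass stands for the closed set that carries the
    measure; pointwise hypotheses are only available on it. *)
Section ProbabilityTools.
Local Open Scope ereal_scope.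
Context d (T : measurableType d) (R : realType) (P : probability T R).
Implicit Types (f g : T -> \bar R) (D : set T).

Lemma prob1_ae D : measurable D -> P D = 1 -> {ae P, forall t, D t}.
Proof.
move=> mD PD; exists (~` D); split => //; first exact: measurableC.
by rewrite probability_setC// PD subee.
Qed.

Lemma prob1_integral D f : measurable D -> P D = 1 -> measurable_fun setT f ->
  \int[P]_(t in D) f t = \int[P]_t f t.
Proof.
move=> mD PD mf; rewrite integral_mkcond; apply: ae_eq_integral => //.
  by apply/(measurable_restrictT f mD); exact: measurable_funS mf.
by apply: filterS (prob1_ae mD PD) => t Dt _; rewrite patchE mem_set.
Qed.

Lemma bounded_integrable D (h : T -> R) (M : R) : measurable D -> P D = 1 ->
  measurable_fun setT h -> (forall t, D t -> `|h t| <= M)%R ->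
  P.-integrable setT (EFin \o h).
Proof.
move=> mD PD mh hM; apply/integrableP; split; first exact/measurable_EFinP.
rewrite -(prob1_integral mD PD); last by apply: measurableT_comp => //; exact/measurable_EFinP.
apply: (@le_lt_trans _ _ (\int[P]_(t in D) M%:E)).
  apply: ge0_le_integral => //.
  by apply: measurable_funTS; apply: measurableT_comp => //; exact/measurable_EFinP.
by rewrite integral_cst//= PD mule1 ltry.
Qed.

Lemma prob1_le_integral D f g : measurable D -> P D = 1 ->
  P.-integrable setT f -> P.-integrable setT g ->
  (forall t, D t -> f t <= g t) -> \int[P]_t f t <= \int[P]_t g t.
Proof.
move=> mD PD fi gi fg; have mf := measurable_int _ fi; have mg := measurable_int _ gi.
rewrite -!(prob1_integral mD PD)//.
apply: le_integral => //.
- by apply: integrableS fi.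
- by apply: integrableS gi.
- by move=> t /set_mem; exact: fg.
Qed.

End ProbabilityTools.

Section Transfer.
Local Open Scope ereal_scope.
Context d (T : measurableType d) d' (T' : measurableType d') (R : realType).
Variables (P : probability T R) (nu : probability T' R) (X : T -> T').
Hypotheses (mX : measurable_fun setT X) (PX : same_measure (pushforward P X) nu).

Lemma integral_transfer (h : T' -> \bar R) : measurable_fun setT h ->
  \int[P]_t h (X t) = \int[nu]_y h y.
Proof.
move=> mh; rewrite integralE [RHS]integralE.
have eq_ge0 g : measurable_fun setT g -> (forall y, 0 <= g y) ->
    \int[P]_t g (X t) = \int[nu]_y g y.
  move=> mg g0; rewrite -(@eq_measure_integral _ _ _ _ _ (pushforward P X)).
    by rewrite ge0_integral_pushforward.
  by move=> A mA _; first [exact: PX|exact/esym/PX].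
rewrite -(eq_ge0 (h^\+))//; last exact: measurable_funepos.
rewrite -(eq_ge0 (h^\-))//; last exact: measurable_funeneg.
by congr (_ - _); apply: eq_integral => t _; rewrite ?funeposE ?funenegE.
Qed.

Lemma integrable_transfer (h : T' -> \bar R) : measurable_fun setT h ->
  nu.-integrable setT h <-> P.-integrable setT (h \o X).
Proof.
move=> mh; have mhX : measurable_fun setT (h \o X) by exact: measurableT_comp.
have E := @integral_transfer (abse \o h) (measurableT_comp (@abse_measurable _ _) mh).
by split=> /integrableP[_ hi]; apply/integrableP; split=> //; rewrite /= ?E// -E.
Qed.

End Transfer.

(** * Conjugates, quantiles and the distributional transform *)

Section Conjugate.
Variable R : realType.
Implicit Types (f : R -> R) (z w : R).
Local Open Scope ereal_scope.

Lemma conjugate_ge f z w : (z * w - f z)%:E <= conjugate f w.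
Proof. by apply: ereal_sup_ubound; exists z. Qed.

Lemma conjugate_ge0 f w : (- f 0%R)%:E <= conjugate f w.
Proof. by have := conjugate_ge f 0 w; rewrite mul0r add0r. Qed.

(** A supremum of affine functions is lower semicontinuous. *)
Lemma measurable_conjugate f : measurable_fun setT (conjugate f).
Proof.
apply: lower_semicontinuous_measurable => w a.
move=> /ereal_sup_gt[_ [z _ <-]]; rewrite lte_fin => azw.
exists [set w' | a < z * w' - f z]%R; last first.
  by move=> w' /= ?; apply: lt_le_trans (conjugate_ge f z w'); rewrite lte_fin.
have cz : {for w, continuous (fun w' => z * w' - f z)%R}.
  by apply: continuousB; [apply: continuousM => //; exact: cst_continuous|exact: cst_continuous].
exact: (@cvgr_gt _ _ _ _ _ _ cz _ azw).
Qed.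

End Conjugate.

Lemma le_prob d (T : measurableType d) (R : realType) (P : probability T R)
  (A B : set T) : measurable A -> measurable B -> A `<=` B -> (P A <= P B)%E.
Proof. by move=> mA mB; apply: le_measure; exact/mem_set. Qed.

Section Quantile.
Variables (R : realType) (mu : probability R R) (lo hi : R).
Hypotheses (lohi : lo <= hi) (muI : mu `[lo, hi]%classic = 1%E).

Definition rcdf w : R := fine (mu `]-oo, w]%classic).

Lemma rcdfE w : (rcdf w)%:E = mu `]-oo, w]%classic.
Proof. by rewrite fineK// fin_num_measure. Qed.

Lemma rcdf_nd : {homo rcdf : x y / x <= y}.
Proof.
move=> x y xy; rewrite -lee_fin !rcdfE; apply: le_prob => //.
by move=> t /=; rewrite !in_itv/= => /le_trans; apply.
Qed.

Lemma rcdf_ge0 w : 0 <= rcdf w. Proof. by rewrite -lee_fin rcdfE. Qed.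

Lemma rcdf_le1 w : rcdf w <= 1.
Proof. by rewrite -lee_fin rcdfE probability_le1. Qed.

Lemma rcdf_hi w : hi <= w -> rcdf w = 1.
Proof.
move=> hw; apply/eqP; rewrite eq_le rcdf_le1 -lee_fin rcdfE -muI.
apply: le_prob => //.
by move=> x /=; rewrite !in_itv/= => /andP[_ /le_trans]; apply.
Qed.

Lemma rcdf_lo w : w < lo -> rcdf w = 0.
Proof.
move=> wl; apply/eqP; rewrite eq_le rcdf_ge0 andbT -lee_fin rcdfE.
apply: (@le_trans _ _ (mu (~` `[lo, hi]%classic))); last first.
  by rewrite probability_setC// muI subee.
apply: le_prob => //; first exact: measurableC.
by move=> x /=; rewrite !in_itv/= => xw; rewrite leNgt (le_lt_trans xw wl).
Qed.

Lemma rcdf_right_continuous : right_continuous rcdf.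
Proof.
pose X : {mfun R >-> R} := mfun_Sub (mem_set (@measurable_id _ R setT)).
move=> a; apply: fine_cvg; rewrite fineK ?fin_num_measure//.
by have := @cdf_right_continuous _ _ _ mu X a; rewrite /cdf/distribution/pushforward.
Qed.

Lemma rcdf_lt_right w p : rcdf w < p -> exists2 r, w < r & rcdf r < p.
Proof.
move=> wp; have near_p : \forall r \near w^'+, rcdf r < p.
  by apply: cvgr_lt wp; exact: rcdf_right_continuous.
by have [r [rp wr]] := @filter_ex _ (w^'+) _ _ (filterI near_p (nbhs_right_gt w)); exists r.
Qed.

(** The condition [lo <= w] bounds the set from below at the level 0 as well. *)
Definition quantile (p : R) : R := inf [set w | lo <= w /\ p <= rcdf w].

Lemma quantile_has_inf p : p <= 1 -> has_inf [set w | lo <= w /\ p <= rcdf w].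
Proof.
by move=> p1; split; [exists hi; rewrite /= rcdf_hi|exists lo => w []].
Qed.

Lemma quantile_ge p : p <= 1 -> lo <= quantile p.
Proof.
by move=> /quantile_has_inf[h0 _]; apply: lb_le_inf => // w [].
Qed.

(** The Galois connection between the quantile and the distribution function, which
    rests on right continuity. *)
Lemma quantile_le p w : p <= 1 -> lo <= w -> (quantile p <= w) = (p <= rcdf w).
Proof.
move=> p1 lw; apply/idP/idP => [qw|pw]; last first.
  by apply: (ge_inf (quantile_has_inf p1).2); split.
rewrite leNgt; apply/negP => wp.
have [r wr rp] := rcdf_lt_right wp.
have [w' [_ pw'] w'r] := inf_lt (quantile_has_inf p1).1 (le_lt_trans qw wr).
by have := le_lt_trans pw' (le_lt_trans (rcdf_nd (ltW w'r)) rp); rewrite ltxx.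
Qed.

End Quantile.

Section Rcdf.
Variables (R : realType) (nu : probability R R).

Definition lcdf z : R := fine (nu `]-oo, z[%classic).

Lemma lcdfE z : (lcdf z)%:E = nu `]-oo, z[%classic.
Proof. by rewrite fineK// fin_num_measure. Qed.

Lemma lcdf_le_rcdf z : lcdf z <= rcdf nu z.
Proof.
rewrite -lee_fin lcdfE rcdfE; apply: le_prob => // t /=.
by rewrite !in_itv/=; exact: ltW.
Qed.

Lemma rcdf_le_lcdf y z : y < z -> rcdf nu y <= lcdf z.
Proof.
move=> yz; rewrite -lee_fin lcdfE rcdfE; apply: le_prob => // t /=.
by rewrite !in_itv/= => /le_lt_trans; apply.
Qed.

Lemma lcdf_nd : {homo lcdf : x y / x <= y}.
Proof.
move=> x y; rewrite le_eqVlt => /predU1P[->//|xy].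
exact: le_trans (lcdf_le_rcdf _) (rcdf_le_lcdf xy).
Qed.

Lemma jumpE z : (rcdf nu z - lcdf z)%:E = nu [set z].
Proof.
apply/eqP; rewrite EFinB sube_eq ?fin_num_adde_defl//; apply/eqP.
have zE : `]-oo, z]%classic = `]-oo, z[%classic `|` [set z].
  by rewrite setUitv1.
rewrite addeC rcdfE lcdfE zE; apply: measureU => //.
by apply/seteqP; split=> // t [/=]; rewrite in_itv/= => tz tE; rewrite tE ltxx in tz.
Qed.

Lemma lcdf_le_of_rcdf_lt p s : (forall z, z < s -> rcdf nu z <= p) -> lcdf s <= p.
Proof.
move=> sp; rewrite leNgt; apply/negP => ps.
have sE : `]-oo, s[%classic = \bigcup_n `]-oo, (s - n.+1%:R^-1)]%classic :> set R.
  apply/seteqP; split=> [t /=|t [n _] /=]; rewrite !in_itv/=; last first.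
    by move=> /le_lt_trans; apply; rewrite gtrBl invr_gt0.
  move=> ts; exists (Num.truncn (s - t)^-1) => //=; rewrite in_itv/=.
  rewrite lerBrDl -lerBrDr -[leRHS]invrK lef_pV2 ?posrE ?invr_gt0 ?subr_gt0//.
  exact/ltW/truncnS_gt.
have : (nu \o (fun n => `]-oo, (s - n.+1%:R^-1)]%classic)) n @[n --> \oo] --> nu `]-oo, s[%classic.
  rewrite sE; apply: nondecreasing_cvg_mu => //.
    by rewrite -sE.
  move=> n m nm; apply/subsetPset => t /=; rewrite !in_itv/= => /le_trans; apply.
  by rewrite lerD2l lerN2 lef_pV2 ?posrE// ler_nat.
rewrite -lcdfE => /fine_cvgP[_ /(@cvgr_gt _ _ _ _) /(_ _ ps)] H.
have [n /=] := filter_ex H.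
by rewrite ltNge sp// gtrBl invr_gt0.
Qed.

Lemma rcdf_cvgy p : p < 1 -> exists z, p < rcdf nu z.
Proof.
pose X : {mfun R >-> R} := mfun_Sub (mem_set (@measurable_id _ R setT)).
move=> p1; have : cdf (X : {RV nu >-> R}) r @[r --> +oo%R] --> 1%E by exact: cvg_cdfy1.
move=> /fine_cvgP[_ /(@cvgr_gt _ _ _ _) /(_ _ p1)] H.
by have [z pz] := filter_ex H; exists z.
Qed.

Lemma rcdf_cvgNy p : 0 < p -> exists z, rcdf nu z < p.
Proof.
pose X : {mfun R >-> R} := mfun_Sub (mem_set (@measurable_id _ R setT)).
move=> p1; have : cdf (X : {RV nu >-> R}) r @[r --> -oo%R] --> 0%E by exact: cvg_cdfNy0.
move=> /fine_cvgP[_ /(@cvgr_lt _ _ _ _) /(_ _ p1)] H.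
by have [z pz] := filter_ex H; exists z.
Qed.

End Rcdf.

Section Unif.
Variable R : realType.

Let itvR_id (x : measurableTypeR R) : R := x.

Let measurable_itvR_id :
  @measurable_fun _ default_measure_display (measurableTypeR R) R setT itvR_id.
Proof. by move=> _ A mA; rewrite setTI. Qed.

(** The uniform law of [0, 1]; the identity map along which it is pushed only
    changes the display of the Borel sigma-algebra. *)
Definition unif : probability R R :=
  distribution (uniform_prob (@ltr01 R)) (mfun_Sub (mem_set measurable_itvR_id)
    : @MeasurableFun.type _ default_measure_display (measurableTypeR R) R).

(** The uniform law lives on the whole line; clipping makes bounds that hold
    almost surely hold everywhere. *)
Definition clip (u : R) : R := Num.max 0 (Num.min 1 u).

Lemma clip01 u : 0 <= clip u <= 1.
Proof. by rewrite /clip le_max lexx ge_max ler01 ge_min lexx. Qed.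

Lemma clip_id u : 0 <= u <= 1 -> clip u = u.
Proof. by move=> /andP[u0 u1]; rewrite /clip min_r// max_r. Qed.

Lemma measurable_clip : measurable_fun setT clip.
Proof.
apply: continuous_measurable_fun => u; apply: continuous_max; first exact: cst_continuous.
by apply: continuous_min; [exact: cst_continuous|].
Qed.

Lemma unif_clip_lt (c j : R) : 0 < j -> 0 <= c <= j ->
  unif [set u | clip u * j < c] = (c / j)%:E.
Proof.
move=> j0 /andP[c0 cj].
have -> : unif [set u | clip u * j < c] = lebesgue_measure `[0, (c / j)[%classic.
  rewrite /unif/= /distribution /pushforward /uniform_prob integral_uniform_pdf.
  have -> : [set u | clip u * j < c] `&` `[0, 1] = `[0, (c / j)[%classic.
    apply/seteqP; split=> u /=; rewrite !in_itv/=.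
      by move=> [uc u01]; rewrite clip_id// in uc; rewrite (andP u01).1 ltr_pdivlMr.
    move=> /andP[u0 uc].
    have u01 : 0 <= u <= 1 by rewrite u0 (le_trans (ltW uc))// ler_pdivrMr// mul1r.
    by split=> //; rewrite clip_id// -ltr_pdivlMr.
  rewrite (eq_integral (cst 1%E)); last first.
    move=> u /set_mem/=; rewrite in_itv/= /uniform_pdf => /andP[u0 uc].
    rewrite u0 (le_trans (ltW uc)) ?ler_pdivrMr ?mul1r//=.
    by rewrite subr0 invr1.
  by rewrite integral_cst//= mul1e.
by rewrite lebesgue_measure_itv/= lte_fin; case: ltgtP (divr_ge0 c0 (ltW j0)) => // [_|<-] _;
  rewrite ?sube0 ?EFinN ?oppr0 ?sube0.
Qed.

End Unif.

Section Transform.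
Context d (T : measurableType d) (R : realType) (tau : probability T R).
Variables (Z : T -> R) (nu : probability R R).
Hypotheses (mZ : measurable_fun setT Z) (Znu : same_measure (pushforward tau Z) nu).
Local Notation F := (rcdf nu).
Local Notation Fl := (lcdf nu).

(** The distributional transform F(z-) + u (F(z) - F(z-)) at z = Z, where u is
    uniform: it spreads each atom of the law of Z over the jump of F, so that the
    result is uniform for any law. *)
Definition dtransform (x : T * R) : R := Fl (Z x.1) + clip x.2 * (F (Z x.1) - Fl (Z x.1)).

Lemma dtransform_le x : dtransform x <= F (Z x.1).
Proof.
rewrite /dtransform -lerBrDl ler_piMl ?subr_ge0 ?lcdf_le_rcdf//.
by have /andP[] := clip01 x.2.
Qed.

Lemma dtransform_ge x : Fl (Z x.1) <= dtransform x.
Proof.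
rewrite /dtransform lerDl mulr_ge0 ?subr_ge0 ?lcdf_le_rcdf//.
by have /andP[] := clip01 x.2.
Qed.

Lemma measurable_dtransform : measurable_fun setT dtransform.
Proof.
have mFl : measurable_fun setT Fl by apply: nondecreasing_measurable => //; exact: lcdf_nd.
have mF : measurable_fun setT F by apply: nondecreasing_measurable => //; exact: rcdf_nd.
have mZ1 : measurable_fun setT (fun x : T * R => Z x.1) by exact: measurableT_comp.
apply: measurable_funD; first exact: (measurableT_comp mFl).
apply: measurable_funM.
  by apply: measurableT_comp => //; exact: measurable_clip.
by apply: measurable_funB; [exact: (measurableT_comp mF)|exact: (measurableT_comp mFl)].
Qed.

Lemma rcdf_threshold p : 0 < p < 1 -> exists s, p <= F s /\ forall z, z < s -> F z < p.
Proof.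
move=> /andP[p0 p1]; pose A := [set z | p <= F z].
have hA : has_inf A.
  split; first by have [z pz] := rcdf_cvgy nu p1; exists z; exact: ltW.
  have [z zp] := rcdf_cvgNy nu p0; exists z => y py.
  by rewrite leNgt; apply/negP => /ltW/(rcdf_nd nu); rewrite leNgt (lt_le_trans zp py).
exists (inf A); split; last first.
  move=> z zA; rewrite ltNge; apply/negP => pz.
  by have := ge_inf hA.2 pz; rewrite leNgt zA.
rewrite leNgt; apply/negP => Fp.
have [r wr rp] := rcdf_lt_right Fp.
have [w' pw' w'r] := inf_lt hA.1 wr.
by have := le_lt_trans pw' (le_lt_trans (rcdf_nd nu (ltW w'r)) rp); rewrite ltxx.
Qed.

(** At level p, with s the p-quantile of the law of Z, the event consists of
    [Z < s] together with the part of the atom [Z = s] on which u is below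
    (p - F(s-)) / (F(s) - F(s-)). *)
Lemma dtransform_lt p : 0 < p < 1 ->
  (tau \x unif R)%E [set x | dtransform x < p] = p%:E.
Proof.
move=> p01; have [s [ps sp]] := rcdf_threshold p01.
have Fls : Fl s <= p by apply: lcdf_le_of_rcdf_lt => z zs; exact/ltW/sp.
pose A := [set u : R | clip u * (F s - Fl s) < p - Fl s].
have mA : measurable A.
  rewrite -[A]setTI; have := @measurable_fun_ltr _ _ _ setT
    (fun u => clip u * (F s - Fl s)) (cst (p - Fl s)).
  move=> /(_ _ _ measurableT [set true]); apply=> //.
  by apply: measurable_funM => //; exact: measurable_clip.
have mZl : measurable (Z @^-1` `]-oo, s[%classic) by rewrite -[X in measurable X]setTI; exact: mZ.
have mZs : measurable (Z @^-1` [set s]) by rewrite -[X in measurable X]setTI; exact: mZ.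
have -> : [set x | dtransform x < p] =
    (Z @^-1` `]-oo, s[%classic) `*` setT `|` (Z @^-1` [set s]) `*` A.
  apply/seteqP; split=> [[t u]/= Vp|[t u] [[/= + _]|[/= Zs]]].
  - have [Zs|Zs|Zs] := ltgtP (Z t) s; first by left; split=> //=; rewrite in_itv.
      have := dtransform_ge (t, u) => /= /le_lt_trans/(_ Vp).
      by rewrite ltNge (le_trans ps (rcdf_le_lcdf nu Zs)).
    by right; split=> //=; rewrite /A/= ltrBrDl; move: Vp; rewrite /dtransform/= Zs.
  - by rewrite in_itv/= => /sp; exact: (le_lt_trans (dtransform_le (t, u))).
  - by rewrite /A/= /dtransform/= ltrBrDl Zs.
rewrite measureU; [|exact: measurableX|exact: measurableX|]; last first.
  apply/seteqP; split=> // -[t u] [[/= + _] [/= Zs _]].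
  by rewrite in_itv/= Zs ltxx.
have tauZl : tau (Z @^-1` `]-oo, s[%classic) = (Fl s)%:E by rewrite lcdfE -Znu.
have tauZs : tau (Z @^-1` [set s]) = (F s - Fl s)%:E by rewrite jumpE -Znu.
transitivity ((Fl s)%:E + (F s - Fl s)%:E * unif R A)%E.
  congr (_ + _)%E.
    rewrite -tauZl; apply: (etrans (product_measure1E _ _ _ _)) => //.
    by rewrite [X in (_ * X)%E]probability_setT mule1.
  by rewrite -tauZs; exact: product_measure1E.
have := lcdf_le_rcdf nu s; rewrite le_eqVlt => /predU1P[Fs|Fs].
  rewrite Fs subrr mul0e adde0; congr EFin; apply/eqP.
  by rewrite eq_le ps andbT -Fs.
rewrite unif_clip_lt ?subr_gt0// ?subr_ge0 ?Fls ?lerB//.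
by rewrite -EFinM -EFinD mulrC divfK ?subrKC// subr_eq0 gt_eqF.
Qed.

(** From the strict inequality by letting the level decrease to p. *)
Lemma dtransform_le_uniform p : 0 <= p <= 1 ->
  (tau \x unif R)%E [set x | dtransform x <= p] = p%:E.
Proof.
have mV := measurable_dtransform.
have mle q : measurable [set x | dtransform x <= q].
  have -> : [set x | dtransform x <= q] = dtransform @^-1` `]-oo, q]%classic.
    by apply/seteqP; split=> x /=; rewrite in_itv.
  by rewrite -[X in measurable X]setTI; exact: mV.
have mlt q : measurable [set x | dtransform x < q].
  have -> : [set x | dtransform x < q] = dtransform @^-1` `]-oo, q[%classic.
    by apply/seteqP; split=> x /=; rewrite in_itv.
  by rewrite -[X in measurable X]setTI; exact: mV.
move=> /andP[p0]; rewrite le_eqVlt => /predU1P[->|p1].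
  rewrite -(probability_setT (tau \x unif R)%E); congr (_ _).
  apply/seteqP; split=> // x _ /=; apply: (le_trans (dtransform_le _)).
  exact: rcdf_le1.
apply/eqP; rewrite eq_le; apply/andP; split; last first.
  have [->//|pneq0] := eqVneq p 0.
  have {}p0 : 0 < p by rewrite lt_neqAle eq_sym pneq0.
  rewrite -(@dtransform_lt p) ?p0//; apply: le_prob => // x /=; exact: ltW.
apply/lee_addgt0Pr => e e0.
have [pe1|pe1] := ltP (p + e) 1; last first.
  by rewrite -EFinD; apply: (le_trans (probability_le1 _ _)) => //; rewrite lee_fin.
rewrite -EFinD -dtransform_lt ?pe1 ?andbT ?ltr_wpDl//.
by apply: le_prob => // x /= /le_lt_trans; apply; rewrite ltrDl.
Qed.

End Transform.

Lemma same_measure_cdf (R : realType) (m1 m2 : probability R R) :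
  (forall w, m1 `]-oo, w]%classic = m2 `]-oo, w]%classic) -> same_measure m1 m2.
Proof.
move=> m12 A mA.
apply: (@measure_unique _ _ R (@RGenOInfty.G R) (fun n => `](- n%:R), +oo[%classic)) => //.
- exact: RGenOInfty.measurableE.
- move=> _ _ [x ->] [y ->]; exists (Num.max x y); apply/seteqP; split=> t /=.
    by rewrite !in_itv/= !andbT gt_max => -[-> ->].
  by rewrite !in_itv/= !andbT gt_max => /andP.
- by move=> n; exists (- n%:R).
- apply/seteqP; split=> // t _; exists (Num.truncn (- t)).+1 => //=; rewrite in_itv/= andbT.
  by rewrite ltrNl truncnS_gt.
- move=> _ [x ->]; rewrite -setCitvl; apply: (etrans (probability_setC _ _)) => //.
  apply/esym/(etrans (probability_setC _ _)) => //; congr (_ - _)%E.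
  exact/esym/m12.
- by move=> n; rewrite (le_lt_trans (probability_le1 _ _)) ?ltry.
Qed.

(** * Convex antiderivatives of monotone functions *)

Section Primitive.
Variable R : realType.
Local Notation leb := (@lebesgue_measure R).

(** The signed indicator of the oriented interval from [a] to [b], for which
    additivity holds without case distinctions. *)
Definition sgn_itv (a b s : R) : R := (s < b)%R%:R - (s < a)%R%:R.

Lemma sgn_itvE a b s : a <= b -> sgn_itv a b s = (@numfun.indic R R `[a, b[%classic s).
Proof.
move=> ab; rewrite /sgn_itv indicE mem_setE in_itv/=.
have [sb|bs] := ltP s b; have [sa|as_] := ltP s a; rewrite ?subrr ?subr0//.
by have := lt_le_trans sa (le_trans ab bs); rewrite ltxx.
Qed.

Lemma sgn_itvN a b s : sgn_itv a b s = - sgn_itv b a s.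
Proof. by rewrite /sgn_itv opprB. Qed.

Lemma integrable_sgn_itv a b : leb.-integrable setT (EFin \o sgn_itv a b).
Proof.
wlog ab : a b / a <= b.
  move=> wl; have [|/ltW ba] := leP a b; first exact: wl.
  have -> : EFin \o sgn_itv a b = (fun s => - (EFin \o sgn_itv b a) s)%E.
    by apply/funext => s /=; rewrite sgn_itvN EFinN.
  by apply: integrableN; exact: wl.
have -> : EFin \o sgn_itv a b = EFin \o (@numfun.indic R R `[a, b[%classic).
  by apply/funext => s /=; rewrite sgn_itvE.
exact: integrable_indic_itv.
Qed.

Lemma Rintegral_sgn_itv a b : \int[leb]_s sgn_itv a b s = b - a.
Proof.
wlog ab : a b / a <= b.
  move=> wl; have [|/ltW ba] := leP a b; first exact: wl.
  under eq_Rintegral do rewrite sgn_itvN -mulN1r.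
  by rewrite RintegralZl ?wl ?mulN1r ?opprB//; exact: integrable_sgn_itv.
under eq_Rintegral do rewrite sgn_itvE//.
transitivity (fine (lebesgue_measure `[a, b[%classic : \bar R)).
  by rewrite /Rintegral integral_indic// setIT.
rewrite lebesgue_measure_itv/= lte_fin.
by case: ltgtP ab => //= -> _; rewrite subrr.
Qed.

Variables (g : R -> R) (M : R).
Hypotheses (g_nd : {homo g : x y / x <= y}) (gM : forall s, `|g s| <= M).

Definition primitive z : R := \int[leb]_s (g s * sgn_itv 0 z s).

Lemma integrable_g_sgn_itv a b :
  leb.-integrable setT (EFin \o (fun s => g s * sgn_itv a b s)).
Proof.
have i1 : leb.-integrable setT (fun s => M%:E * (EFin \o sgn_itv a b) s)%E.
  by apply: integrableZl => //; exact: integrable_sgn_itv.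
apply: le_integrable i1 => //.
  apply/measurable_EFinP; apply: measurable_funM.
    exact: nondecreasing_measurable.
  by have /integrableP[/measurable_EFinP] := integrable_sgn_itv a b.
move=> s _; rewrite /= lee_fin !normrM; apply: ler_pM => //.
exact: le_trans (gM s) (ler_norm _).
Qed.

Lemma primitiveB y z : primitive z - primitive y = \int[leb]_s (g s * sgn_itv y z s).
Proof.
rewrite /primitive -RintegralB//; try exact: integrable_g_sgn_itv.
by apply: eq_Rintegral => s _; rewrite -mulrBr /sgn_itv; congr (_ * _); ring.
Qed.

(** The increment of the primitive from z to y exceeds w (y - z) by the oriented integral
    of g - w from z to y, and g - w has the sign of y - z between the two points. *)
Lemma primitive_subgradient w z y : (forall s, s < z -> g s <= w) ->
  (forall s, z <= s -> w <= g s) -> primitive z + w * (y - z) <= primitive y.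
Proof.
move=> gl gr; rewrite -lerBrDl primitiveB -Rintegral_sgn_itv.
rewrite -RintegralZl//; last exact: integrable_sgn_itv.
apply: le_Rintegral => //.
- have := @integrableZl _ _ _ leb setT measurableT w _ (integrable_sgn_itv z y).
  exact.
- exact: integrable_g_sgn_itv.
- move=> s _; rewrite -subr_ge0 -mulrBl /sgn_itv.
  have [sz|zs] := ltP s z; have [sy|ys] := ltP s y; rewrite ?subrr ?mulr0//.
    by rewrite sub0r mulrN1 opprB subr_ge0 gl.
  by rewrite subr0 mulr1 subr_ge0 gr.
Qed.

Lemma primitive_subgradient_self z y : primitive z + g z * (y - z) <= primitive y.
Proof. by apply: primitive_subgradient => s /=; [move/ltW|]; exact: g_nd. Qed.

Lemma primitive0 : primitive 0 = 0.
Proof.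
rewrite /primitive (@eq_Rintegral _ _ _ _ _ (cst 0)).
  by rewrite Rintegral_cst//= mul0r.
by move=> s _; rewrite /sgn_itv subrr mulr0.
Qed.

Lemma primitive_lipschitz y z : `|primitive z - primitive y| <= M * `|z - y|.
Proof.
have bound a b : primitive b - primitive a <= M * `|b - a|.
  have := primitive_subgradient_self b a; rewrite -(opprB b a) mulrN.
  rewrite lerBlDr -lerBlDl => /le_trans; apply.
  rewrite (le_trans (ler_norm _))// normrM ler_wpM2r//.
by rewrite ler_norml lerNl opprB bound andbT distrC bound.
Qed.

Lemma primitive_norm_le z : `|primitive z| <= M * `|z|.
Proof. by have := primitive_lipschitz 0 z; rewrite primitive0 !subr0. Qed.

(** A function with an affine minorant touching it at each point is convex. *)
Lemma subgradient_Ccvx (f g' : R -> R) : continuous f ->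
  (forall z y, f z + g' z * (y - z) <= f y) -> Ccvx f.
Proof.
move=> cf fg; split=> // t x y _ _.
change (f (t%:num * x + (1 - t%:num) * y) <= t%:num * f x + (1 - t%:num) * f y).
have t0 : 0 <= t%:num by exact: ge0.
have t1 : t%:num <= 1 by exact: le1.
move: (t%:num) t0 t1 (x : R) (y : R) => {}t t0 t1 {}x {}y; set z := t * x + _.
have := ler_wpM2l t0 (fg z x).
have := ler_wpM2l (_ : 0 <= 1 - t) (fg z y); rewrite subr_ge0 => /(_ t1) H1 H2.
apply: le_trans (lerD H2 H1); rewrite le_eqVlt; apply/orP; left; apply/eqP.
have -> : x - z = (1 - t) * (x - y) by rewrite /z; ring.
have -> : y - z = - t * (x - y) by rewrite /z; ring.
by ring.
Qed.

End Primitive.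

(** * Optimal transport in dimension one *)

Section Comonotone.
Context d (T : measurableType d) (R : realType) (tau : probability T R).
Variables (Z : T -> R) (nu mu : probability R R) (lo hi : R).
Hypotheses (mZ : measurable_fun setT Z) (Znu : same_measure (pushforward tau Z) nu).
Hypotheses (lohi : lo <= hi) (muI : mu `[lo, hi]%classic = 1%E).
Local Notation q := (quantile mu lo).

Lemma quantile_nd p p' : p' <= 1 -> p <= p' -> q p <= q p'.
Proof.
move=> p'1 pp'; rewrite (quantile_le lohi muI) ?(le_trans pp')//.
  by rewrite -(quantile_le lohi muI)// (quantile_ge lohi muI).
exact: (quantile_ge lohi muI).
Qed.

Lemma quantile_le_hi p : p <= 1 -> q p <= hi.
Proof. by move=> p1; rewrite (quantile_le lohi muI)// (rcdf_hi muI). Qed.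

(** For u uniform and independent of Z, the variable of law [mu] that is coupled
    monotonically to Z. *)
Definition comonotone (x : T * R) : R := q (dtransform Z nu x).

(** Its derivative sends z to the value coupled with Z = z, which is what optimality
    of the potential requires; at an atom of the law of Z this derivative jumps. *)
Definition comonotone_potential : R -> R := primitive (fun s => q (rcdf nu s)).

Lemma dtransform_le1 x : dtransform Z nu x <= 1.
Proof. exact: le_trans (dtransform_le _ _ _) (rcdf_le1 _ _). Qed.

Lemma comonotone_itv x : lo <= comonotone x <= hi.
Proof.
by rewrite (quantile_ge lohi muI) ?quantile_le_hi//; exact: dtransform_le1.
Qed.

Lemma measurable_comonotone : measurable_fun setT comonotone.
Proof.
have -> : comonotone = (fun p => q (Num.min p 1)) \o dtransform Z nu.
  by apply/funext => x /=; rewrite min_l// dtransform_le1.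
apply: measurableT_comp; last exact: measurable_dtransform.
apply: nondecreasing_measurable => // p p' pp'.
by apply: quantile_nd; [rewrite ge_min lexx orbT|rewrite le_min !ge_min pp' lexx orbT].
Qed.

Lemma comonotone_law :
  same_measure (pushforward (tau \x unif R)%E comonotone) mu.
Proof.
pose X : {mfun (T * R)%type >-> R} := mfun_Sub (mem_set measurable_comonotone).
apply: (@same_measure_cdf R (distribution (tau \x unif R)%E X)) => w.
rewrite /distribution/= /pushforward -rcdfE.
have [lw|wl] := leP lo w; last first.
  rewrite (rcdf_lo muI)//; apply: (etrans _ (measure0 (tau \x unif R)%E)); congr (_ _).
  apply/seteqP; split=> // x /=; rewrite in_itv/= => xw.
  by have /andP[+ _] := comonotone_itv x; rewrite leNgt (le_lt_trans xw).
rewrite -(dtransform_le_uniform mZ Znu); last by rewrite rcdf_ge0 rcdf_le1.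
congr (_ _); apply/seteqP; split=> x /=; rewrite in_itv/=.
  by rewrite /comonotone (quantile_le lohi muI)//; exact: dtransform_le1.
by rewrite /comonotone (quantile_le lohi muI)//; exact: dtransform_le1.
Qed.

Let g_nd : {homo (fun s => q (rcdf nu s)) : x y / x <= y}.
Proof. by move=> s t st; apply: quantile_nd; [exact: rcdf_le1|exact: rcdf_nd]. Qed.

Let gM s : `|q (rcdf nu s)| <= Num.max `|lo| `|hi|.
Proof.
have /= l := quantile_ge lohi muI (rcdf_le1 nu s).
have h := quantile_le_hi (rcdf_le1 nu s).
rewrite ler_norml; apply/andP; split.
  by rewrite (le_trans _ l)// lerNl le_max -normrN ler_norm.
by rewrite (le_trans h)// le_max ler_norm orbT.
Qed.

Lemma comonotone_potential_Ccvx : Ccvx comonotone_potential.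
Proof.
apply: (@subgradient_Ccvx _ _ (fun s => q (rcdf nu s))).
  apply: (@lipschitz_continuous _ R^o _ (Num.max `|lo| `|hi|)).
    by rewrite le_max normr_ge0.
  move=> y z; rewrite -lerBlDl (le_trans (ler_norm _))//.
  exact: (primitive_lipschitz g_nd gM).
by move=> z y; exact: (primitive_subgradient_self g_nd gM).
Qed.

Lemma comonotone_potential_le z : `|comonotone_potential z| <= Num.max `|lo| `|hi| * `|z|.
Proof. exact: (primitive_norm_le g_nd gM). Qed.

(** The transform at Z = z lies between F(z-) and F(z), so the coupled value lies
    between the values of q o F on the two sides of z: it is a subgradient of the
    potential at z, and Young's inequality is an equality. *)
Lemma conjugate_comonotone x :
  conjugate comonotone_potential (comonotone x) =
  (Z x.1 * comonotone x - comonotone_potential (Z x.1))%:E.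
Proof.
apply/eqP; rewrite eq_le conjugate_ge andbT.
apply: ge_ereal_sup => _ [z _ <-]; rewrite lee_fin.
have := @primitive_subgradient _ _ _ g_nd gM (comonotone x) (Z x.1) z.
rewrite -/comonotone_potential => H.
suff : comonotone_potential (Z x.1) + comonotone x * (z - Z x.1) <= comonotone_potential z by lra.
apply: H => s sz; apply: quantile_nd.
- exact: dtransform_le1.
- exact: le_trans (rcdf_le_lcdf nu sz) (dtransform_ge _ _ _).
- exact: rcdf_le1.
- exact: le_trans (dtransform_le _ _ _) (rcdf_nd _ sz).
Qed.

End Comonotone.

Section MoreIntegrable.
Local Open Scope ereal_scope.
Context d (T : measurableType d) (R : realType) (P : probability T R).

Lemma prob1_integrable_le D (h k : T -> R) : measurable D -> P D = 1 ->
  measurable_fun setT h -> P.-integrable setT (EFin \o k) ->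
  (forall t, D t -> `|h t| <= `|k t|)%R -> P.-integrable setT (EFin \o h).
Proof.
move=> mD PD mh ki hk; have /integrableP[mk koo] := ki.
have mh' : measurable_fun setT (EFin \o h) by exact/measurable_EFinP.
apply/integrableP; split=> //; apply: le_lt_trans koo.
rewrite -!(prob1_integral mD PD); try by apply: measurableT_comp.
apply: ge0_le_integral => //.
- by apply: measurable_funTS; exact: measurableT_comp.
- by apply: measurable_funTS; exact: measurableT_comp.
Qed.

(** Conjugates are bounded below by [- f 0], so that a finite integral is all that
    is needed for integrability. *)
Lemma lbounded_integrable (h : T -> \bar R) (c : R) : measurable_fun setT h ->
  (forall t, c%:E <= h t) -> \int[P]_t h t < +oo -> P.-integrable setT h.
Proof.
move=> mh ch hoo; apply/integrableP; split=> //.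
have negoo : \int[P]_t h^\- t < +oo.
  apply: (@le_lt_trans _ _ (\int[P]_t (`|c|%R)%:E)).
    apply: ge0_le_integral => //; first exact: measurable_funeneg.
    move=> t _; rewrite funenegE ge_max lee_fin normr_ge0 andbT leeNl.
    by apply: le_trans (ch t); rewrite -EFinN lee_fin lerNl -normrN ler_norm.
  by rewrite integral_cst//= probability_setT mule1 ltry.
have posoo : \int[P]_t h^\+ t < +oo.
  rewrite ltey; apply/eqP => pE; move: hoo; rewrite integralE pE.
  by rewrite addye ?ltxx// -ltNye lteNr.
change (\int[P]_x (abse \o h) x < +oo); rewrite fune_abse.
rewrite ge0_integralD//; [exact: lte_add_pinfty|exact: measurable_funepos|exact: measurable_funeneg].
Qed.

Lemma lbounded_integral_gtNy (h : T -> \bar R) (c : R) : measurable_fun setT h ->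
  (forall t, c%:E <= h t) -> -oo < \int[P]_t h t.
Proof.
move=> mh ch; have [hoo|] := ltP (\int[P]_t h t) +oo; last first.
  by rewrite leye_eq => /eqP ->.
have hi := lbounded_integrable mh ch hoo.
by have := integrable_fin_num measurableT hi; rewrite fin_numE ltNye => /andP[].
Qed.

End MoreIntegrable.

Section Transport.
Local Open Scope ereal_scope.
Context (R : realType) (mu nu : probability R R) (lo hi : R).
Hypothesis muI : mu `[lo, hi]%classic = 1.
Hypothesis nu1 : nu.-integrable setT (EFin \o id).
Local Notation Om := (`[lo, hi]%classic : set R).

Let mOm : measurable (Om `*` [set: R]).
Proof. exact: measurableX. Qed.

Lemma itv_norm_le w : Om w -> (`|w| <= Num.max `|lo| `|hi|)%R.
Proof.
rewrite /= in_itv/= => /andP[lw wh]; rewrite ler_norml; apply/andP; split.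
  by rewrite (le_trans _ lw)// lerNl le_max -normrN ler_norm.
by rewrite (le_trans wh)// le_max ler_norm orbT.
Qed.

Lemma integral_conjugate_gtNy (f : R -> R) : -oo < \int[mu]_w conjugate f w.
Proof.
apply: (@lbounded_integral_gtNy _ _ _ _ _ (- f 0)%R); first exact: measurable_conjugate.
by move=> t; exact: conjugate_ge0.
Qed.

Lemma conjugate_integrable (f : R -> R) :
  \int[mu]_w conjugate f w < +oo -> mu.-integrable setT (conjugate f).
Proof.
apply: (@lbounded_integrable _ _ _ _ _ (- f 0)%R); first exact: measurable_conjugate.
by move=> t; exact: conjugate_ge0.
Qed.

(** Weak duality: integrate Young's inequality against a coupling.  When the
    integral of the conjugate is infinite the left-hand side is -oo. *)
Lemma OT_ge (f : R -> R) : nu.-integrable setT (EFin \o f) ->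
  - (\int[mu]_w conjugate f w) - \int[nu]_z (f z)%:E <= OT Om mu nu.
Proof.
move=> fi; apply: le_ereal_inf_tmp => _ [g [gOm g1 g2] <-].
have fin : \int[nu]_z (f z)%:E \is a fin_num := integrable_fin_num measurableT fi.
have [coo|] := ltP (\int[mu]_w conjugate f w) +oo; last first.
  by rewrite leye_eq => /eqP ->; rewrite /= addNye leNye.
have ci := conjugate_integrable coo.
have mc := @measurable_conjugate R f.
have cgi : g.-integrable setT (conjugate f \o fst).
  exact/(integrable_transfer measurable_fst g1 mc).
have mf := measurable_int _ fi.
have fgi : g.-integrable setT ((EFin \o f) \o snd).
  exact/(integrable_transfer measurable_snd g2 mf).
have zgi : g.-integrable setT (EFin \o (fun wz : R * R => wz.2)).
  by apply/(integrable_transfer measurable_snd g2 _) => //; exact/measurable_EFinP.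
have zwgi : g.-integrable setT (fun wz : R * R => (- (wz.2 * wz.1))%:E).
  apply: (@prob1_integrable_le _ _ _ _ _ (fun wz : R * R => - (wz.2 * wz.1))%R
     (fun wz => Num.max `|lo| `|hi| * wz.2)%R mOm gOm).
  - by apply: measurableT_comp => //; apply: measurable_funM.
  - have := integrableZl measurableT (Num.max `|lo| `|hi|)%R zgi.
    by apply: eq_integrable.
  - move=> [w z] [/= Ow _]; rewrite normrN !normrM mulrC ler_wpM2r//.
    by rewrite (le_trans (itv_norm_le Ow))// ler_norm.
rewrite (prob1_integral mOm gOm); last exact: (measurable_int _ zwgi).
rewrite -(integral_transfer measurable_fst g1 mc) -(integral_transfer measurable_snd g2 mf).
rewrite -oppeD; last first.
  by rewrite fin_num_adde_defl// (integrable_fin_num measurableT fgi).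
rewrite -integralD// -integralN; last first.
  by apply: integrable_add_def => //; exact: integrableD.
apply: le_integral => //; first by apply: integrableN; exact: integrableD.
move=> [w z] _ /=; rewrite EFinN leeN2.
by have := conjugate_ge f z w; rewrite EFinB leeBlDr//.
Qed.

Lemma OT_le d (S : measurableType d) (P : probability S R) (X Y : S -> R) :
  measurable_fun setT X -> measurable_fun setT Y ->
  same_measure (pushforward P X) mu -> same_measure (pushforward P Y) nu ->
  OT Om mu nu <= \int[P]_s (- (Y s * X s))%:E.
Proof.
move=> mX mY PX PY.
have mXY : measurable_fun setT (fun s => (X s, Y s)) by exact: measurable_fun_pair.
pose XY : {mfun S >-> (R * R)%type} := mfun_Sub (mem_set mXY).
pose g : probability (R * R)%type R := distribution P XY.
have gOm : g (Om `*` setT) = 1.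
  rewrite /g/= /distribution /pushforward -muI -PX//= /pushforward; congr (_ _).
  by apply/seteqP; split=> s //= -[].
have mc : measurable_fun setT (fun wz : R * R => (- (wz.2 * wz.1))%:E).
  apply/measurable_EFinP; apply: measurableT_comp => //.
  exact: measurable_funM.
apply: ereal_inf_le; exists (\int[g]_(wz in Om `*` setT) (- (wz.2 * wz.1))%:E).
  exists g => //; split=> // A mA; rewrite -?PX -?PY//.
rewrite (prob1_integral mOm gOm)//.
by rewrite -(@integral_transfer _ _ _ _ _ P g _ mXY).
Qed.

(** A coupling and a potential for which Young's inequality is an equality
    certify each other: the coupling is optimal, and all the integrals are finite. *)
Lemma OT_contact d (S : measurableType d) (P : probability S R) (X Y : S -> R) (phi : R -> R) :
  measurable_fun setT X -> measurable_fun setT Y ->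
  same_measure (pushforward P X) mu -> same_measure (pushforward P Y) nu ->
  measurable_fun setT phi -> (forall z, `|phi z| <= Num.max `|lo| `|hi| * `|z|)%R ->
  (forall s, Om (X s)) ->
  (forall s, conjugate phi (X s) = (Y s * X s - phi (Y s))%:E) ->
  [/\ P.-integrable setT (EFin \o (fun s => Y s * X s)%R),
      nu.-integrable setT (EFin \o phi), mu.-integrable setT (conjugate phi),
      OT Om mu nu = (- \int[P]_s (Y s * X s))%:E &
      \int[mu]_w conjugate phi w = (\int[P]_s (Y s * X s) - \int[nu]_z phi z)%:E].
Proof.
move=> mX mY PX PY mphi phiM XOm con.
pose M : R := (Num.max `|lo| `|hi|)%R.
have Yi : P.-integrable setT (EFin \o Y).
  have mE : measurable_fun setT (EFin \o (id : R -> R)) by exact/measurable_EFinP.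
  by have := (integrable_transfer mY PY mE).1 nu1.
have YM : P.-integrable setT (EFin \o (fun s => M * Y s)%R).
  by have := integrableZl measurableT M Yi; apply: eq_integrable.
have XYi : P.-integrable setT (EFin \o (fun s => Y s * X s)%R).
  apply: (@prob1_integrable_le _ _ _ _ _ _ _ measurableT (probability_setT P) _ YM).
    exact: measurable_funM.
  move=> s _; rewrite !normrM mulrC ler_wpM2r//.
  by rewrite (le_trans (itv_norm_le (XOm s)))// ler_norm.
have nuM : nu.-integrable setT (EFin \o (fun z => M * z)%R).
  by have := integrableZl measurableT M nu1; apply: eq_integrable.
have phii : nu.-integrable setT (EFin \o phi).
  apply: (@prob1_integrable_le _ _ _ _ _ _ _ measurableT (probability_setT nu) mphi nuM).
  move=> z _; rewrite (le_trans (phiM z))// normrM ler_wpM2r//.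
  by rewrite ler_norm.
have phiYi : P.-integrable setT (EFin \o (phi \o Y)).
  by have := (integrable_transfer mY PY (measurable_int _ phii)).1 phii.
have E : \int[mu]_w conjugate phi w = (\int[P]_s (Y s * X s) - \int[nu]_z phi z)%:E.
  rewrite -(integral_transfer mX PX (@measurable_conjugate _ phi)).
  under eq_integral do rewrite con.
  rewrite (integralB_EFin measurableT XYi phiYi).
  rewrite EFinB /Rintegral !fineK ?(integrable_fin_num measurableT)//; congr (_ - _).
  by rewrite -(integral_transfer mY PY)//; exact: measurable_int phii.
have ci : mu.-integrable setT (conjugate phi).
  by apply: conjugate_integrable; rewrite E ltry.
split=> //; apply/eqP; rewrite eq_le; apply/andP; split.
  apply: (le_trans (OT_le mX mY PX PY)).
  under eq_integral do rewrite EFinN.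
  rewrite integralN; last by apply: integrable_add_def.
  by rewrite EFinN /Rintegral fineK// (integrable_fin_num measurableT).
apply: (le_trans _ (OT_ge phii)); rewrite E.
rewrite -[X in - _ - X]fineK ?(integrable_fin_num measurableT)//.
by rewrite -EFinN -EFinB lee_fin -/(Rintegral _ _ _); lra.
Qed.

End Transport.

(** * Extreme points modulo the lineality space *)

Section Vertices.
Variables (R : realType) (n : nat) (I : finType) (a : I -> 'cV[R]_n) (beta : I -> R).
Local Notation A := (fun i => dotp (a i)).
Local Notation P := (polyhedron A beta).
Hypothesis P0 : P !=set0.

Let sA i : scalar (A i). Proof. exact: scalar_dotp. Qed.

Lemma lineality_polyhedron y : lineality P y <-> forall i, dotp (a i) y = 0.
Proof.
split=> [[y1 y2] i|ay]; last first.
  by split=> x t Px t0 i; rewrite dotpDr dotpZr ?(linfN _ (sA i)) ay ?oppr0 mulr0 addr0.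
have [x Px] := P0.
have le0 e : recc P e -> dotp (a i) e <= 0.
  move=> re; rewrite leNgt; apply/negP => ae.
  have t0 : 0 <= (beta i - dotp (a i) x + 1) / dotp (a i) e.
    by rewrite divr_ge0 ?(ltW ae)// addr_ge0// subr_ge0.
  have := re x _ Px t0 i; rewrite dotpDr dotpZr divfK ?gt_eqF//.
  by rewrite addrCA addrA subrK gerDl ler10.
apply/eqP; rewrite eq_le le0//= -oppr_le0.
by have := le0 _ y2; rewrite (linfN _ (sA i)).
Qed.

Local Notation O := (orthogonal_compl (lineality P)).

Lemma basic_orthogonal_eq x y : basic_point A beta x ->
  O x -> O y -> tight A beta x = tight A beta y -> x = y.
Proof.
move=> bx Ox Oy txy; apply/eqP; rewrite -subr_eq0; apply/eqP/dotp_eq0.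
have lxy : lineality P (x - y).
  by apply/lineality_polyhedron; exact: (basic_point_same_tight sA bx txy).
by rewrite dotpBl Ox// Oy// subrr.
Qed.

Lemma basic_orthogonal_extr x : basic_point A beta x -> O x -> extr (P `&` O) x.
Proof.
move=> [Px bx] Ox; split=> // y z t [Py Oy] [Pz Oz] /andP[t0 t1] xE.
suff yz : y = z by move: xE; rewrite -yz -scalerDl subrKC scale1r.
apply/eqP; rewrite -subr_eq0; apply/eqP/dotp_eq0.
have lyz : lineality P (y - z).
  apply/lineality_polyhedron; apply: bx => i; rewrite inE => /eqP tE.
  rewrite xE dotpDr !dotpZr in tE.
  have ty := ler_wpM2l (ltW t0) (Py i).
  have t1' : 0 < 1 - t by rewrite subr_gt0.
  have tz := ler_wpM2l (ltW t1') (Pz i).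
  have ey : t * dotp (a i) y = t * beta i by apply/eqP; rewrite eq_le ty/=; move: ty tz; lra.
  have ez : (1 - t) * dotp (a i) z = (1 - t) * beta i by apply/eqP; rewrite eq_le tz/=; lra.
  rewrite dotpBr (mulfI _ ey) ?gt_eqF// (mulfI _ ez) ?gt_eqF// subrr.
  by [].
by rewrite dotpBl Oy// Oz// subrr.
Qed.

Lemma basic_orthogonal_above c M y : (forall z, P z -> dotp c z <= M) -> P y ->
  exists z, [/\ basic_point A beta z, O z & dotp c y <= dotp c z].
Proof.
move=> cM Py; have [z0 [Pz0 bz0] cyz0] := basic_point_above sA (@scalar_dotp _ _ c) cM Py.
have [y0 [y0a y0p]] := orthogonal_decomp (fun j : 'I_#|I| => a (enum_val j)) z0.
have ay0 i : dotp (a i) y0 = 0 by rewrite -[i]enum_rankK.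
have az i : dotp (a i) (z0 - y0) = dotp (a i) z0 by rewrite dotpBr ay0 subr0.
have Pz : P (z0 - y0) by move=> i; rewrite az; exact: Pz0.
exists (z0 - y0); split.
- split=> // e te; apply: bz0 => i it; apply: te; move: it; rewrite !inE.
  by rewrite az.
- move=> e /lineality_polyhedron le; apply: y0p => j; exact: le.
- rewrite dotpBr [X in _ - X](_ : _ = 0) ?subr0//.
  exact: (scalar_bounded_lineality sA (@scalar_dotp _ _ c) cM Py).
Qed.

(** A basic point stays basic when its component in the lineality space is
    removed, and what remains depends only on its set of tight constraints; hence a
    finite family indexed by sets of constraints. *)
Lemma vertices : exists N (v : 'I_N -> 'cV[R]_n), [/\ (0 < N)%N,
  forall k, extr (P `&` O) (v k) &
  forall c M y, (forall z, P z -> dotp c z <= M) -> P y ->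
    exists k, dotp c y <= dotp c (v k)].
Proof.
have [x Px] := P0.
have [|z0 [bz0 Oz0 _]] := @basic_orthogonal_above 0 0 x _ Px.
  by move=> z _; rewrite (linf0 (@scalar_dotpl _ _ z)).
pose r J := xget z0 [set z | [/\ basic_point A beta z, O z & tight A beta z = J]].
have rP J : basic_point A beta (r J) /\ O (r J).
  by rewrite /r; case: xgetP => [z _ [] //|_].
exists #|{set I}|, (fun k => r (enum_val k)); split=> [|k|c M y cM Py].
- by apply/card_gt0P; exists (tight A beta z0).
- by have [? ?] := rP (enum_val k); exact: basic_orthogonal_extr.
have [z [bz Oz cyz]] := basic_orthogonal_above cM Py.
exists (enum_rank (tight A beta z)); rewrite enum_rankK.
suff -> : r (tight A beta z) = z by [].
have [br Or] := rP (tight A beta z).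
apply: basic_orthogonal_eq => //; rewrite /r.
by case: xgetP => [z' _ []//|/(_ z)]; case.
Qed.

End Vertices.

(** * The second-stage dual polyhedron and first-stage duality *)

Section Problem.
Variables (R : realType) (d k1 n_in n_eq m_in m_eq k2 : nat).
Variable D : dro_data R d k1 n_in n_eq m_in m_eq k2.

Definition S2_normal (i : 'I_m_in + 'I_k2) : 'cV[R]_(m_in + m_eq) :=
  match i with
  | inl i => delta_mx (lshift _ i) 0
  | inr j => col_mx (col j (A_in D)) (col j (A_eq D))
  end.

Definition S2_bound (i : 'I_m_in + 'I_k2) : R :=
  match i with inl _ => 0 | inr j => c2 D j 0 end.

Lemma dotp_delta n (i : 'I_n) (u : 'cV[R]_n) : dotp (delta_mx i 0) u = u i 0.
Proof.
rewrite /dotp (bigD1 i)//= mxE !eqxx mul1r big1 ?addr0// => j /negPf ji.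
by rewrite mxE ji mul0r.
Qed.

Lemma S2_polyhedron : S2 D = polyhedron (fun i => dotp (S2_normal i)) S2_bound.
Proof.
have dotE l j : dotp (S2_normal (inr j)) l =
    ((A_in D)^T *m usubmx l + (A_eq D)^T *m dsubmx l) j 0.
  rewrite /dotp big_split_ord !mxE/=; congr (_ + _).
    by apply: eq_bigr => i _; rewrite col_mxEu !mxE.
  by apply: eq_bigr => i _; rewrite col_mxEd !mxE.
apply/seteqP; split=> l.
  move=> [l1 l2] [i|j].
    by rewrite dotp_delta; have := l1 i; rewrite !mxE.
  by rewrite dotE; exact: l2.
move=> lP; split=> i.
  by have := lP (inl i); rewrite dotp_delta !mxE.
by rewrite -dotE; exact: (lP (inr i)).
Qed.

Lemma dotp_mulmx n m (M : 'M[R]_(n, m)) (x : 'cV[R]_m) (u : 'cV[R]_n) :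
  dotp (M *m x) u = dotp (M^T *m u) x.
Proof.
transitivity (\sum_i \sum_j M i j * x j 0 * u i 0).
  by apply: eq_bigr => i _; rewrite mxE mulr_suml.
rewrite exchange_big; apply: eq_bigr => j _; rewrite mxE mulr_suml.
by apply: eq_bigr => i _; rewrite !mxE; ring.
Qed.

(** Farkas' lemma for the homogenized system in (x, t), where t scales the
    right-hand sides: the hypothesis yields [m * t <= dotp c x] on its solutions.  For
    t > 0 this is the bound at x / t.  For t = 0 the vector x is a recession direction
    of S1, along which a negative value of c would contradict the bound. *)
Lemma S1_duality (c : 'cV[R]_k1) (m : R) : S1 D !=set0 ->
  (forall x, S1 D x -> m <= dotp c x) ->
  exists xi_in xi_eq, [/\ vle xi_in 0,
    vle ((L_in D)^T *m xi_in + (L_eq D)^T *m xi_eq) c &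
    m <= dotp (q_in D) xi_in + dotp (q_eq D) xi_eq].
Proof.
move=> [x0 [x00 x0in x0eq]] cm.
pose W := ('cV[R]_k1 * R^o)%type.
pose fi i (p : W) : R := (L_in D *m p.1) i 0 - p.2 * q_in D i 0.
pose fe i (p : W) : R := (L_eq D *m p.1) i 0 - p.2 * q_eq D i 0.
pose a (i : ('I_k1 + unit) + ('I_n_in + ('I_n_eq + 'I_n_eq))) (p : W) : R :=
  match i with
  | inl (inl j) => - p.1 j 0
  | inl (inr _) => - (p.2 : R)
  | inr (inl i) => fi i p
  | inr (inr (inl i)) => fe i p
  | inr (inr (inr i)) => - fe i p
  end.
have sfi i : scalar (fi i).
  move=> k u v; rewrite /fi/= mulmxDr -scalemxAr mxE [X in X + _ - _]mxE.
  by rewrite -[k *: u.2]/(k * u.2); ring.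
have sfe i : scalar (fe i).
  move=> k u v; rewrite /fe/= mulmxDr -scalemxAr mxE [X in X + _ - _]mxE.
  by rewrite -[k *: u.2]/(k * u.2); ring.
have [[[j|j]|[i|[i|i]]] k u v|k u v|[x t] H|l [l0 lE]] :=
    @farkas R W _ a (fun p => m * p.2 - dotp c p.1).
- by rewrite /a/= !mxE; ring.
- by rewrite /a/= -[k *: u.2]/(k * u.2); ring.
- exact: sfi.
- exact: sfe.
- by rewrite /a sfe; ring.
- by rewrite /= dotpDr dotpZr -[k *: u.2]/(k * u.2); ring.
- have t0 : 0 <= t by have := H (inl (inr tt)); rewrite /a/= oppr_le0.
  have x_ge0 j : 0 <= x j 0 by have := H (inl (inl j)); rewrite /a/= oppr_le0.
  have xin i : (L_in D *m x) i 0 <= t * q_in D i 0.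
    by have := H (inr (inl i)); rewrite /a/fi/= subr_le0.
  have xeq i : (L_eq D *m x) i 0 = t * q_eq D i 0.
    apply/eqP; rewrite eq_le; have := H (inr (inr (inl i))).
    have := H (inr (inr (inr i))); rewrite /a/fe/= oppr_le0 subr_ge0 subr_le0.
    by move=> -> ->.
  rewrite /= subr_le0; have [tgt0|t_le0] := ltP 0 t.
    have : m <= dotp c (t^-1 *: x).
      apply: cm; split=> [j|i|].
      + by rewrite !mxE mulr_ge0// invr_ge0.
      + by rewrite -scalemxAr mxE ler_pdivrMl.
      + by apply/matrixP => i j; rewrite ord1 -scalemxAr mxE xeq mulKf// gt_eqF.
    by rewrite dotpZr -ler_pdivrMl ?invr_gt0// invrK mulrC.
  have tE : t = 0 by apply/eqP; rewrite eq_le t0 t_le0.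
  rewrite tE mulr0 leNgt; apply/negP => cx.
  have s0 : 0 <= (`|dotp c x0| + `|m| + 1) / - dotp c x.
    by rewrite divr_ge0 ?addr_ge0// oppr_ge0 ltW.
  have : m <= dotp c (x0 + ((`|dotp c x0| + `|m| + 1) / - dotp c x) *: x).
    apply: cm; split=> [j|i|].
    + by have := x00 j; rewrite !mxE => ?; rewrite addr_ge0// mulr_ge0.
    + rewrite mulmxDr -scalemxAr mxE [X in _ + X]mxE -[leRHS]addr0 lerD ?x0in//.
      by rewrite mulr_ge0_le0//; have := xin i; rewrite tE mul0r.
    + rewrite mulmxDr -scalemxAr x0eq; apply/matrixP => i j.
      by rewrite ord1 mxE [X in _ + X]mxE xeq tE mul0r mulr0 addr0.
  rewrite dotpDr dotpZr invrN mulrN mulNr divfK ?lt_eqF//.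
  have := ler_norm (dotp c x0); have := lerNnormlW (lexx `|m|).
  by move: (`|_|) (`|_|) => u v; lra.
(* an equality contributes two inequalities, whose multipliers are subtracted *)
exists (\col_i - l (inr (inl i))), (\col_i (l (inr (inr (inr i))) - l (inr (inr (inl i))))).
have lE' p : m * p.2 - dotp c p.1 = - (\sum_j l (inl (inl j)) * p.1 j 0)
    - l (inl (inr tt)) * p.2 + \sum_i l (inr (inl i)) * fi i p
    + \sum_i (l (inr (inr (inl i))) - l (inr (inr (inr i)))) * fe i p.
  rewrite lE !big_sumType/= (big_pred1 tt)//.
  rewrite -!addrA; congr (_ + _).
    by rewrite -sumrN; apply: eq_bigr => j _; rewrite mulrN.
  rewrite mulrN; congr (_ + (_ + _)); rewrite -big_split/=.
  by apply: eq_bigr => i _; ring.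
split.
- by move=> i; rewrite !mxE oppr_le0.
- move=> j; have := lE' (delta_mx j 0, 0); rewrite /= mulr0 sub0r mulr0 subr0.
  have delta_sum (f : 'I_k1 -> R) : \sum_i f i * (delta_mx j 0 : 'cV[R]_k1) i 0 = f j.
    rewrite (bigD1 j)//= mxE !eqxx mulr1 big1 ?addr0// => i /negPf ij.
    by rewrite mxE ij mulr0.
  rewrite dotpC dotp_delta (delta_sum (fun j => l (inl (inl j)))) => cE.
  have -> : c j 0 = l (inl (inl j)) + (((L_in D)^T *m (\col_i - l (inr (inl i)))) j 0
     + ((L_eq D)^T *m (\col_i (l (inr (inr (inr i))) - l (inr (inr (inl i)))))) j 0).
    apply: oppr_inj; rewrite cE !opprD -!addrA; congr (_ + (_ + _)).
      rewrite mxE -sumrN; apply: eq_bigr => i _.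
      by rewrite /fi/= mul0r subr0 !mxE delta_sum; ring.
    rewrite mxE -sumrN; apply: eq_bigr => i _.
    by rewrite /fe/= mul0r subr0 !mxE delta_sum; ring.
  by rewrite [leLHS]mxE lerDr.
- have := lE' (0, 1); rewrite /= !mulr1 (linf0 (@scalar_dotp _ _ c)) subr0.
  rewrite [X in - X]big1 ?oppr0 ?sub0r => [->|j _]; last by rewrite mxE mulr0.
  rewrite -addrA -[leRHS]add0r; apply: lerD; first by rewrite oppr_le0.
  apply: lerD; rewrite le_eqVlt; apply/orP; left; apply/eqP; apply: eq_bigr => i _.
    by rewrite /fi/= mulmx0 !mxE; ring.
  by rewrite /fe/= mulmx0 !mxE; ring.
Qed.

End Problem.

Section FiniteMax.
Variables (R : realType) (N : nat).
Implicit Types F G : 'I_N.+1 -> R.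

(** The value at [ord0] serves as the neutral element, since the reals have no
    bottom. *)
Definition fmax F : R := \big[Num.max/F ord0]_k F k.

Lemma fmax_ge F k : F k <= fmax F.
Proof. exact: le_bigmax. Qed.

Lemma fmax_le F c : (forall k, F k <= c) -> fmax F <= c.
Proof. by move=> Fc; apply: bigmax_le. Qed.

Lemma fmax_attained F : exists k, fmax F = F k.
Proof.
have [k _ kmax] := @arg_maxP _ _ _ ord0 xpredT F isT.
by exists k; apply/eqP; rewrite eq_le fmax_ge andbT; apply: fmax_le => j; exact: kmax.
Qed.

Lemma measurable_fmax d (T : measurableType d) (F : 'I_N.+1 -> T -> R) :
  (forall k, measurable_fun setT (F k)) -> measurable_fun setT (fun t => fmax (F ^~ t)).
Proof.
move=> mF; rewrite /fmax; elim: (index_enum _) => [|k s IH].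
  by under eq_fun do rewrite big_nil; exact: mF.
by under eq_fun do rewrite big_cons; exact: measurable_maxr.
Qed.

End FiniteMax.

Section Problem.
Variables (R : realType) (d k1 n_in n_eq m_in m_eq k2 : nat).
Variable D : dro_data R d k1 n_in n_eq m_in m_eq k2.
Hypothesis mu_prob : forall i, prob_on (Omega_ D i) (mu D i).
Hypothesis S2_neq0 : S2 D !=set0.
Hypothesis C2_bounded :
  (ereal_sup [set C2 D x w | x in S1 D & w in Omega D] < +oo)%E.
Implicit Types (x : 'cV[R]_k1) (w : 'cV[R]_d) (l : 'cV[R]_(m_in + m_eq)).

Definition payoff x w l : R := dotp (Q D *m x + P D *m w + b D) l.

Lemma C2_lty x w : S1 D x -> Omega D w -> (C2 D x w < +oo)%E.
Proof.
move=> Sx Ow; apply: le_lt_trans C2_bounded; apply: ereal_sup_ubound.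
by exists x => //; exists w.
Qed.

Lemma C2_ge x w l : S2 D l -> ((payoff x w l)%:E <= C2 D x w)%E.
Proof. by move=> Sl; apply: ereal_sup_ubound; exists l. Qed.

Lemma C2_fin x w : S1 D x -> Omega D w -> C2 D x w \is a fin_num.
Proof.
move=> Sx Ow; rewrite fin_numE -ltey C2_lty// andbT -ltNye.
by have [l Sl] := S2_neq0; apply: lt_le_trans (C2_ge x w Sl); rewrite ltNyr.
Qed.

(** Boundedness of the second-stage cost makes each of its linear functionals
    bounded on S2, hence dominated by its values at the extreme points. *)
Lemma C2_vertices : exists N (v : 'I_N.+1 -> 'cV[R]_(m_in + m_eq)),
  (forall k, S2 D (v k) /\ V_extr D (v k)) /\
  forall x w, S1 D x -> Omega D w ->
    C2 D x w = (fmax (fun k => payoff x w (v k)))%:E.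
Proof.
have := S2_neq0; rewrite S2_polyhedron => /vertices[N0 [v []]].
case: N0 v => [//|N] v _ vextr vmax.
exists N, v; split=> [k|x w Sx Ow].
  by rewrite /V_extr S2_polyhedron; split=> //; have [[]] := vextr k.
have vS k : S2 D (v k) by rewrite S2_polyhedron; have [[]] := vextr k.
apply/eqP; rewrite eq_le; apply/andP; split; last first.
  by have [k ->] := fmax_attained (fun k => payoff x w (v k)); exact: C2_ge.
apply: ge_ereal_sup => _ [l Sl <-]; rewrite /C2_obj lee_fin.
have [||k lk] := vmax (Q D *m x + P D *m w + b D) (fine (C2 D x w)) l _ _.
- move=> z; rewrite -S2_polyhedron => Sz.
  by rewrite -lee_fin fineK ?C2_fin//; exact: C2_ge.
- by rewrite -S2_polyhedron.
apply: (le_trans lk); exact: (fmax_ge (fun k => payoff x w (v k))).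
Qed.

Lemma dotpP_w w l : dotp (P D *m w) l = \sum_i w i 0 * dotp (col i (P D)) l.
Proof.
rewrite dotp_mulmx /dotp; apply: eq_bigr => i _; rewrite mxE mulrC; congr (_ * _).
by apply: eq_bigr => j _; rewrite !mxE.
Qed.

Lemma payoffE x w l : payoff x w l =
  dotp (Q D *m x + b D) l + \sum_i w i 0 * dotp (col i (P D)) l.
Proof. by rewrite /payoff addrAC dotpDl dotpP_w. Qed.

(** Feasibility bounds <Q x + b, l> by - sum_i f_i(<p_i, l>), and Young's inequality
    bounds each term w_i <p_i, l> - f_i(<p_i, l>). *)
Lemma C2_le_conjugate x f w : primal_feasible D (x, f) ->
  (C2 D x w <= \sum_(i < d) conjugate (f i) (w i 0%R))%E.
Proof.
move=> [_ _ /= fl _ _]; apply: ge_ereal_sup => _ [l Sl <-].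
rewrite /C2_obj -/(payoff x w l) payoffE.
apply: (@le_trans _ _ (\sum_(i < d) (dotp (col i (P D)) l * w i 0 - f i (dotp (col i (P D)) l))%:E)%E).
  rewrite sumEFin lee_fin sumrB.
  have := fl l Sl; rewrite /primal_constr.
  have -> : \sum_i w i 0 * dotp (col i (P D)) l = \sum_i dotp (col i (P D)) l * w i 0.
    by apply: eq_bigr => i _; rewrite mulrC.
  lra.
by apply: lee_sum => i _; exact: conjugate_ge.
Qed.

Lemma primal_feasible_S1 x f : primal_feasible D (x, f) -> S1 D x.
Proof. by move=> []. Qed.

Lemma measurable_Omega : measurable (Omega D : set (borelV R d)).
Proof.
apply: closed_measurableV.
have -> : Omega D = \bigcap_i [set w | Omega_ D i (w i 0)].
  by apply/seteqP; split=> w Ow i; [move=> _|]; apply: Ow.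
apply: closed_bigI => i _.
apply: (@closed_preimage_continuous _ _ (fun w : 'cV[R]_d => w i 0) (Omega_ D i)).
  exact: coord_continuous.
exact: itv_closed.
Qed.

Lemma measurable_S2 : measurable (S2 D : set (borelV R (m_in + m_eq))).
Proof.
rewrite S2_polyhedron.
have -> : polyhedron (fun i => dotp (S2_normal D i)) (S2_bound D) =
    \bigcap_i [set l | dotp (S2_normal D i) l <= S2_bound D i].
  by apply/seteqP; split=> w Ow i; [move=> _|]; apply: Ow.
apply: fin_bigcap_measurable => // i _.
have -> : [set l | dotp (S2_normal D i) l <= S2_bound D i] =
    dotp (S2_normal D i) @^-1` `]-oo, S2_bound D i]%classic.
  by apply/seteqP; split=> l /=; rewrite in_itv.
rewrite -[X in measurable X]setTI.
by apply: (@measurable_dotp R _ (S2_normal D i)).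
Qed.

Lemma integral_conjugate_Omega (f : R -> R) i :
  (\int[mu D i]_(w in Omega_ D i) conjugate f w = \int[mu D i]_w conjugate f w)%E.
Proof.
apply: prob1_integral; [exact: measurable_itv|exact: mu_prob|].
exact: measurable_conjugate.
Qed.

Section WorstCase.
Variables (g : probability (borelV R d) R).
Hypothesis gG : Gamma D g.

Lemma Gamma_Omega : g (Omega D) = 1%E. Proof. by case: gG. Qed.

Lemma integral_conjugate_coord (f : R -> R) i :
  (\int[g]_w conjugate f (coord i (w : 'cV[R]_d)) = \int[mu D i]_w conjugate f w)%E.
Proof.
apply: integral_transfer; [exact: measurable_coord|exact: gG.2|].
exact: measurable_conjugate.
Qed.

Lemma integrable_conjugate_coord (f : R -> R) i :
  (\int[mu D i]_w conjugate f w < +oo)%E ->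
  g.-integrable setT (fun w : borelV R d => conjugate f (coord i (w : 'cV[R]_d))).
Proof.
move=> coo; have ci := conjugate_integrable coo.
have := (integrable_transfer (@measurable_coord R d i) (gG.2 i) (@measurable_conjugate R f)).1 ci.
exact.
Qed.

End WorstCase.
End Problem.

Lemma ge0_prob1_integral_eq0 d (T : measurableType d) (R : realType)
  (P : probability T R) (D : set T) (h : T -> \bar R) : measurable D -> P D = 1%E ->
  P.-integrable setT h -> (forall t, D t -> (0 <= h t)%E) ->
  (\int[P]_t h t = 0)%E <-> {ae P, forall t, h t = 0%E}.
Proof.
move=> mD PD hi h0; have mh := measurable_int _ hi; split=> [Ph0|ae0].
  have : (\int[P]_t `|h t| = 0)%E.
    rewrite -Ph0; apply: ae_eq_integral => //; first exact: measurableT_comp.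
    by apply: filterS (prob1_ae mD PD) => t Dt _ /=; rewrite gee0_abs// h0.
  move/(ae_eq_integral_abs P measurableT mh) => h_ae.
  by apply: filterS h_ae => t /(_ I).
rewrite (ae_eq_integral (cst 0%E)) ?integral0//.
by apply: filterS ae0 => t /= -> .
Qed.

Lemma ae_imp2 d (T : measurableType d) (R : realType) (P : probability T R)
    (A B C : T -> Prop) : {ae P, forall t, A t} -> {ae P, forall t, B t} ->
  (forall t, A t -> B t -> C t) -> {ae P, forall t, C t}.
Proof. by move=> PA PB ABC; apply: (filterS2 _ _ PA PB). Qed.

Lemma sube_fin_eq0 (R : realDomainType) (x y : \bar R) : y \is a fin_num ->
  (x - y = 0 <-> x = y)%E.
Proof.
case: y => [r| |]// _; case: x => [s| |]//=; split=> // -[].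
- by move/eqP; rewrite subr_eq0 => /eqP ->.
- by move=> ->; rewrite -EFinB subrr.
Qed.

(** * The primal bounds the robust cost *)

(** The values of the second-stage cost enter through its representation as a
    maximum over the family [v]; this provides its measurability and
    boundedness on Omega. *)
Section WeakDuality.
Variables (R : realType) (d k1 n_in n_eq m_in m_eq k2 : nat).
Variable D : dro_data R d k1 n_in n_eq m_in m_eq k2.
Hypothesis mu_prob : forall i, prob_on (Omega_ D i) (mu D i).
Variables (N : nat) (v : 'I_N.+1 -> 'cV[R]_(m_in + m_eq)).
Hypothesis C2v : forall x w, S1 D x -> Omega D w ->
  C2 D x w = (fmax (fun k => payoff D x w (v k)))%:E.
Implicit Types (x : 'cV[R]_k1) (w : 'cV[R]_d) (f : 'I_d -> R -> R).

Definition C2max x w : R := fmax (fun k => payoff D x w (v k)).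

Lemma measurable_payoff x l :
  measurable_fun setT (fun w : borelV R d => payoff D x (w : 'cV[R]_d) l).
Proof.
have -> : (fun w : borelV R d => payoff D x (w : 'cV[R]_d) l) =
    (fun w => dotp (Q D *m x + b D) l + \sum_i coord i (w : 'cV[R]_d) * dotp (col i (P D)) l).
  by apply/funext => w; rewrite payoffE.
apply: measurable_funD => //; apply: measurable_sum => i.
by apply: measurable_funM => //; exact: measurable_coord.
Qed.

Lemma payoff_bounded x l w : Omega D w -> `|payoff D x w l| <=
  `|dotp (Q D *m x + b D) l| + \sum_i Num.max `|lo D i| `|hi D i| * `|dotp (col i (P D)) l|.
Proof.
move=> Ow; rewrite payoffE (le_trans (ler_normD _ _))// lerD2l.
rewrite (le_trans (ler_norm_sum _ _ _))// ler_sum// => i _.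
by rewrite normrM ler_wpM2r// itv_norm_le//; exact: Ow.
Qed.

Lemma fmax_norm_le (F : 'I_N.+1 -> R) (B : R) : (forall k, `|F k| <= B) -> `|fmax F| <= B.
Proof. by move=> FB; have [k ->] := fmax_attained F. Qed.

Lemma measurable_C2max x :
  measurable_fun setT (fun w : borelV R d => C2max x (w : 'cV[R]_d)).
Proof. by apply: measurable_fmax => k; exact: measurable_payoff. Qed.

Lemma C2max_bounded x : exists B, forall w, Omega D w -> `|C2max x w| <= B.
Proof.
pose B k := `|dotp (Q D *m x + b D) (v k)| +
  \sum_i Num.max `|lo D i| `|hi D i| * `|dotp (col i (P D)) (v k)|.
exists (fmax B) => w Ow; apply: fmax_norm_le => k.
by apply: le_trans (payoff_bounded x (v k) Ow) _; exact: (fmax_ge B).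
Qed.

Section Coupling.
Variables (g : probability (borelV R d) R).
Hypothesis gG : Gamma D g.
Let gO : g (Omega D) = 1%E := Gamma_Omega gG.
Let mO := measurable_Omega D.

Lemma integrable_C2max x :
  g.-integrable setT (EFin \o (fun w : borelV R d => C2max x (w : 'cV[R]_d))).
Proof.
have [B BP] := C2max_bounded x.
exact: (bounded_integrable mO gO (measurable_C2max x) BP).
Qed.

Lemma worst_case_objE x : S1 D x ->
  worst_case_obj D x g = (\int[g]_w (C2max x (w : 'cV[R]_d))%:E)%E.
Proof.
move=> Sx; rewrite /worst_case_obj -(prob1_integral mO gO); last first.
  by apply/measurable_EFinP; exact: measurable_C2max.
by apply: eq_integral => w /set_mem Ow; rewrite C2v.
Qed.

Lemma worst_case_obj_fin x : S1 D x -> worst_case_obj D x g \is a fin_num.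
Proof.
by move=> Sx; rewrite worst_case_objE// (integrable_fin_num measurableT (integrable_C2max x)).
Qed.

Variables (x : 'cV[R]_k1) (f : 'I_d -> R -> R).
Hypothesis xf : primal_feasible D (x, f).
Let Sx : S1 D x := primal_feasible_S1 xf.
Local Open Scope ereal_scope.
Hypothesis foo : forall i, \int[mu D i]_w conjugate (f i) w < +oo.

Let h (w : borelV R d) := \sum_(i < d) conjugate (f i) (coord i (w : 'cV[R]_d)).

Let integrable_h : g.-integrable setT h.
Proof.
by apply: integrable_sum => // i _; exact: (integrable_conjugate_coord gG).
Qed.

Let int_h : \int[g]_w h w = \sum_(i < d) \int[mu D i]_w conjugate (f i) w.
Proof.
rewrite /h integral_sum//; last by move=> i; exact: (integrable_conjugate_coord gG).
by apply: eq_bigr => i _; exact: (integral_conjugate_coord gG).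
Qed.

Lemma worst_case_le_conjugate_fin :
  worst_case_obj D x g <= \sum_(i < d) \int[mu D i]_w conjugate (f i) w.
Proof.
rewrite worst_case_objE// -int_h; apply: (prob1_le_integral mO gO) => //.
  exact: integrable_C2max.
by move=> w Ow; have := C2_le_conjugate w xf; rewrite C2v.
Qed.

(** The difference of the two integrands is nonnegative, so its integral vanishes
    exactly when it vanishes almost surely. *)
Lemma worst_case_eq_conjugate :
  worst_case_obj D x g = \sum_(i < d) \int[mu D i]_w conjugate (f i) w <->
  {ae g, forall w, Omega D w -> \sum_(i < d) conjugate (f i) (w i 0%R) = C2 D x w}.
Proof.
have iC := integrable_C2max x.
have ik : g.-integrable setT (fun w => h w - (C2max x (w : 'cV[R]_d))%:E) by exact: integrableB.
have := ge0_prob1_integral_eq0 mO gO ik _.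
have k0 w : Omega D w -> 0 <= h w - (C2max x w)%:E.
  by move=> Ow; rewrite sube_ge0//; have := C2_le_conjugate w xf; rewrite C2v.
move=> /(_ k0); rewrite integralB// int_h -worst_case_objE// => H.
have fw := worst_case_obj_fin Sx.
split=> [E|ae].
  have /H : \sum_(i < d) \int[mu D i]_w conjugate (f i) w - worst_case_obj D x g = 0.
    by rewrite E subee// -E.
  by move=> k_ae; apply: (ae_imp2 k_ae k_ae) => w /sube_fin_eq0 hw _ Ow; rewrite C2v// -hw.
suff /H /sube_fin_eq0 -> : {ae g, forall w, h w - (C2max x (w : 'cV[R]_d))%:E = 0}.
  by [].
  exact: fw.
apply: (ae_imp2 ae (prob1_ae mO gO)) => w hw Ow.
have -> : h w = C2 D x w by exact: hw.
by rewrite C2v// subee.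
Qed.

End Coupling.

Local Open Scope ereal_scope.

Lemma primal_objE x f : primal_obj D (x, f) =
  (dotp (c1 D) x)%:E + \sum_(i < d) \int[mu D i]_w conjugate (f i) w.
Proof.
rewrite /primal_obj; congr (_ + _); apply: eq_bigr => i _.
exact: integral_conjugate_Omega.
Qed.

Lemma sum_gtNy_ltyP (F : 'I_d -> \bar R) : (forall i, -oo < F i) ->
  \sum_i F i < +oo -> forall i, F i < +oo.
Proof.
move=> F0 Foo i; rewrite ltey; apply/eqP => Fi; move: Foo.
rewrite (bigD1 i)//= Fi addye ?ltxx// -ltNye.
apply: (big_ind (fun y => -oo < y)) => // -[r| |] -[s| |] //= _ _.
by rewrite -EFinD ltNyr.
Qed.

Lemma dro_le_primal x f : primal_feasible D (x, f) ->
  dro_obj D x <= primal_obj D (x, f).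
Proof.
move=> xf; rewrite primal_objE leeD2l//; apply: ge_ereal_sup => _ [g gG <-].
have [foo|] := ltP (\sum_(i < d) \int[mu D i]_w conjugate (f i) w) +oo.
  apply: worst_case_le_conjugate_fin => //; apply: sum_gtNy_ltyP foo => i.
  exact: integral_conjugate_gtNy.
by rewrite leye_eq => /eqP ->; rewrite leey.
Qed.

End WeakDuality.

(** * Gluing the monotone couplings *)

Section RSum.
Context d (T : measurableType d) (R : realType) (P : probability T R).

Lemma integrable_sumR (I : Type) (s : seq I) (f : I -> T -> R) :
  (forall i, P.-integrable setT (EFin \o f i)) ->
  P.-integrable setT (EFin \o (fun t => \sum_(i <- s) f i t)).
Proof.
move=> fi; have -> : EFin \o (fun t => \sum_(i <- s) f i t) =
    (fun t => \sum_(i <- s) (EFin \o f i) t)%E.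
  by apply/funext => t /=; rewrite sumEFin.
exact: integrable_sum.
Qed.

Lemma Rintegral_sum (I : Type) (s : seq I) (f : I -> T -> R) :
  (forall i, P.-integrable setT (EFin \o f i)) ->
  \int[P]_t (\sum_(i <- s) f i t) = \sum_(i <- s) \int[P]_t f i t.
Proof.
move=> fi; elim: s => [|i s IH].
  by under eq_Rintegral do rewrite big_nil; rewrite big_nil Rintegral_cst//= mul0r.
rewrite big_cons -IH -RintegralD//; last exact: integrable_sumR.
by under eq_Rintegral do rewrite big_cons.
Qed.

Lemma integrableZR (k : R) (f : T -> R) : P.-integrable setT (EFin \o f) ->
  P.-integrable setT (EFin \o (fun t => k * f t)).
Proof. by move=> fi; have := integrableZl measurableT k fi; apply: eq_integrable. Qed.

Lemma integrableDR (f g : T -> R) : P.-integrable setT (EFin \o f) ->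
  P.-integrable setT (EFin \o g) -> P.-integrable setT (EFin \o (fun t => f t + g t)).
Proof. by move=> fi gi; have := integrableD measurableT fi gi; apply: eq_integrable. Qed.

Lemma EFin_Rintegral (f : T -> R) : P.-integrable setT (EFin \o f) ->
  (\int[P]_t (f t)%:E)%E = (\int[P]_t f t)%:E.
Proof. by move=> fi; rewrite /Rintegral fineK// (integrable_fin_num measurableT). Qed.

End RSum.

Section Glue.
Variables (R : realType) (d k1 n_in n_eq m_in m_eq k2 : nat).
Variable D : dro_data R d k1 n_in n_eq m_in m_eq k2.
Hypothesis lo_le_hi : forall i, lo D i <= hi D i.
Hypothesis mu_prob : forall i, prob_on (Omega_ D i) (mu D i).
Variables (N : nat) (v : 'I_N.+1 -> 'cV[R]_(m_in + m_eq)).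
Hypothesis C2v : forall x w, S1 D x -> Omega D w ->
  C2 D x w = (fmax (fun k => payoff D x w (v k)))%:E.
Local Notation Vl := (borelV R (m_in + m_eq)).
Variable tau : probability Vl R.
Hypothesis tau1 : prob1_on (S2 D : set Vl) tau.

Let mS2 := measurable_S2 D.
Let tauS2 : tau (S2 D) = 1%E. Proof. by case: tau1. Qed.

Lemma norm_continuousV n : continuous (fun l : 'cV[R]_n => `|l|).
Proof. by move=> l; exact: norm_continuous. Qed.

Lemma integrable_norm : tau.-integrable setT (EFin \o (fun l : Vl => `|l : 'cV[R]_(m_in + m_eq)|)).
Proof.
have mn : measurable_fun setT (EFin \o (fun l : Vl => `|l : 'cV[R]_(m_in + m_eq)|)).
  by apply/measurable_EFinP; apply: continuous_measurableV; exact: norm_continuousV.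
apply/integrableP; split=> //; case: tau1 => _.
rewrite (prob1_integral mS2 tauS2)//.
under [in X in _ -> X]eq_integral do rewrite /= normr_id.
by [].
Qed.

Lemma integrable_coord j : tau.-integrable setT (EFin \o (fun l : Vl => coord j (l : 'cV[R]_(m_in + m_eq)))).
Proof.
apply: (prob1_integrable_le measurableT (probability_setT tau) _ integrable_norm).
  exact: measurable_coord.
by move=> l _; rewrite normr_id; exact: mx_entry_norm_le.
Qed.

Lemma integrable_dotp p : tau.-integrable setT (EFin \o (fun l : Vl => dotp p (l : 'cV[R]_(m_in + m_eq)))).
Proof.
apply: integrable_sumR => j; apply: integrableZR; exact: integrable_coord.
Qed.

Definition mean : 'cV[R]_(m_in + m_eq) := \col_j \int[tau]_l coord j (l : 'cV[R]_(m_in + m_eq)).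

Lemma dotp_mean p : \int[tau]_l dotp p (l : 'cV[R]_(m_in + m_eq)) = dotp p mean.
Proof.
rewrite /dotp Rintegral_sum; last by move=> j; apply: integrableZR; exact: integrable_coord.
by apply: eq_bigr => j _; rewrite RintegralZl ?mxE//; exact: integrable_coord.
Qed.

Lemma QT_meanE : QT_mean D tau = (Q D)^T *m mean.
Proof.
apply/matrixP => j j'; rewrite ord1 mxE.
have dE (l : 'cV[R]_(m_in + m_eq)) : ((Q D)^T *m l) j 0 = dotp (col j (Q D)) l.
  by rewrite mxE; apply: eq_bigr => i _; rewrite !mxE.
rewrite dE -dotp_mean /Rintegral; congr fine.
rewrite -(prob1_integral mS2 tauS2).
  by apply: eq_integral => l _; rewrite dE.
exact: (measurable_int _ (integrable_dotp _)).
Qed.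

(** The common source of randomness: the second-stage solution and one uniform
    variable. *)
Definition base : probability (Vl * R)%type R := (tau \x unif R)%E.

Lemma base_fst : same_measure (pushforward base (fst : Vl * R -> Vl)) tau.
Proof.
move=> A mA; rewrite /pushforward/= /base.
have -> : fst @^-1` A = A `*` [set: R] by apply/seteqP; split=> -[l u] //= [].
by apply: (etrans (product_measure1E _ _ _ _)) => //; rewrite [X in (_ * X)%E]probability_setT mule1.
Qed.

Let Z i (l : Vl) : R := dotp (col i (P D)) (l : 'cV[R]_(m_in + m_eq)).
Let mZ i : measurable_fun setT (Z i). Proof. exact: measurable_dotp. Qed.
Let Znu i : same_measure (pushforward tau (Z i)) (push D tau i). Proof. by []. Qed.

Definition glued_coord i (x : Vl * R) : R := comonotone (Z i) (push D tau i) (mu D i) (lo D i) x.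

Lemma measurable_glued_coord i : measurable_fun setT (glued_coord i).
Proof.
exact: (@measurable_comonotone _ _ _ _ (push D tau i) _ _ _ (mZ i) (lo_le_hi i) (mu_prob i)).
Qed.

Lemma glued_coord_law i : same_measure (pushforward base (glued_coord i)) (mu D i).
Proof. exact: (comonotone_law (mZ i) (@Znu i) (lo_le_hi i) (mu_prob i)). Qed.

Lemma glued_coord_Omega i x : Omega_ D i (glued_coord i x).
Proof.
rewrite /Omega_/= in_itv/=.
exact: (comonotone_itv (Z i) (push D tau i) (lo_le_hi i) (mu_prob i)).
Qed.

Definition glue (x : Vl * R) : joint_type R d m_in m_eq := (\col_i glued_coord i x, x.1).

Lemma measurable_glue : measurable_fun setT glue.
Proof.
apply: measurable_fun_pair => //; apply: measurable_to_borelV => i.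
by under eq_fun do rewrite /coord mxE; exact: measurable_glued_coord.
Qed.

(** Each coordinate of w is coupled monotonically to the projection of l; the joint
    law of the coordinates given l is immaterial. *)
Definition glued : probability (joint_type R d m_in m_eq) R :=
  distribution base (mfun_Sub (mem_set measurable_glue)).

Lemma glued_base : same_measure (pushforward base glue) glued. Proof. by []. Qed.

Lemma glued_Omega_S2 : glued (@Omega_S2 _ _ _ _ _ _ _ _ D) = 1%E.
Proof.
rewrite -tauS2 -base_fst// /glued/= /distribution /pushforward/=; congr (_ _).
apply/seteqP; split=> x /=; first by case.
by move=> Sx; split=> // i; rewrite /= mxE; exact: glued_coord_Omega.
Qed.

Lemma glued_joint : joint_couplings D tau glued.
Proof.
split=> [|i A mA|A mA]; first exact: glued_Omega_S2.
  rewrite -glued_coord_law// /glued/= /distribution /pushforward/=; congr (_ _).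
  by apply/seteqP; split=> x /=; rewrite /coord mxE.
by rewrite -base_fst.
Qed.

Lemma glued_Gamma : Gamma D (marginal_Omega glued).
Proof.
split=> [|i A mA].
  rewrite /prob_on/= -(probability_setT base) /marginal_Omega/= /distribution /pushforward/=; congr (_ _).
  by apply/seteqP; split=> // x _ i /=; rewrite mxE; exact: glued_coord_Omega.
by have [_ + _] := glued_joint; move=> /(_ i A mA).
Qed.

Lemma push_integrable i : (push D tau i).-integrable setT (EFin \o id).
Proof.
have mE : measurable_fun setT (EFin \o (id : R -> R)) by exact/measurable_EFinP.
apply/(integrable_transfer (mZ i) (@Znu i) mE).
exact: integrable_dotp.
Qed.

(** The expectation of z w under the monotone coupling, that is, minus the optimal
    transport cost. *)
Definition transport_value i : R := \int[base]_x (Z i x.1 * glued_coord i x).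

Lemma base_Z_law i : same_measure (pushforward base (fun x => Z i x.1)) (push D tau i).
Proof.
move=> A mA; rewrite -Znu// /pushforward -[RHS]base_fst//.
by rewrite -[X in measurable X]setTI; exact: mZ.
Qed.

Let contact i := OT_contact (mu_prob i) (push_integrable i)
  (measurable_glued_coord i) (measurableT_comp (mZ i) measurable_fst) (@glued_coord_law i)
  (@base_Z_law i)
  (continuous_measurable_fun
     (comonotone_potential_Ccvx (push D tau i) (lo_le_hi i) (mu_prob i)).1)
  (comonotone_potential_le (push D tau i) (lo_le_hi i) (mu_prob i))
  (@glued_coord_Omega i)
  (conjugate_comonotone (Z i) (push D tau i) (lo_le_hi i) (mu_prob i)).

Lemma OT_push i : OT (Omega_ D i) (mu D i) (push D tau i) = (- transport_value i)%:E.
Proof. by have [] := contact i. Qed.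

Lemma integrable_ZW i : base.-integrable setT (EFin \o (fun x => Z i x.1 * glued_coord i x)).
Proof. by have [] := contact i. Qed.

Definition potential i : R -> R :=
  comonotone_potential (push D tau i) (mu D i) (lo D i).

Lemma potential_integral i : [/\ (push D tau i).-integrable setT (EFin \o potential i),
  (mu D i).-integrable setT (conjugate (potential i)) &
  (\int[mu D i]_w conjugate (potential i) w = (transport_value i - \int[push D tau i]_z potential i z)%:E)%E].
Proof. by have [? ? ? ? ?] := contact i. Qed.

Lemma dual_objE xi_in xi_eq : dual_obj D (tau, xi_in, xi_eq) =
  (dotp (b D) mean + \sum_i transport_value i + dotp (q_in D) xi_in + dotp (q_eq D) xi_eq)%:E.
Proof.
rewrite /dual_obj (prob1_integral mS2 tauS2); last exact: (measurable_int _ (integrable_dotp _)).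
rewrite (EFin_Rintegral (integrable_dotp _)) dotp_mean.
under eq_bigr do rewrite OT_push.
by rewrite sumEFin sumrN -EFinN opprK -!EFinD.
Qed.

Let pay x (y : Vl * R) := payoff D x (\col_i glued_coord i y) (y.1 : 'cV[R]_(m_in + m_eq)).

Lemma payE x : pay x = (fun y => dotp (Q D *m x + b D) (y.1 : 'cV[R]_(m_in + m_eq)) +
  \sum_i (Z i y.1 * glued_coord i y)).
Proof.
apply/funext => y; rewrite /pay payoffE; congr (_ + _).
by apply: eq_bigr => i _; rewrite mxE mulrC.
Qed.

Let integrable_dotp_base x : base.-integrable setT (EFin \o (fun y : Vl * R => dotp (Q D *m x + b D) (y.1 : 'cV[R]_(m_in + m_eq)))).
Proof.
have := (integrable_transfer measurable_fst base_fst (measurable_int _ (integrable_dotp (Q D *m x + b D)))).1.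
by apply; exact: integrable_dotp.
Qed.

Lemma integrable_pay x : base.-integrable setT (EFin \o pay x).
Proof.
rewrite payE; apply: integrableDR; first exact: integrable_dotp_base.
by apply: integrable_sumR => i; exact: integrable_ZW.
Qed.

Lemma integral_pay x : \int[base]_y pay x y = dotp (Q D *m x + b D) mean + \sum_i transport_value i.
Proof.
rewrite payE RintegralD//; last by apply: integrable_sumR => i; exact: integrable_ZW.
rewrite [X in _ + X]Rintegral_sum; last by move=> i; exact: (integrable_ZW i).
congr (_ + _); rewrite -dotp_mean /Rintegral; congr fine.
exact: (integral_transfer measurable_fst base_fst (measurable_int _ (integrable_dotp (Q D *m x + b D)))).
Qed.

Let gpay x (y : joint_type R d m_in m_eq) := payoff D x (y.1 : 'cV[R]_d) (y.2 : 'cV[R]_(m_in + m_eq)).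

Let mgpay x : measurable_fun setT (gpay x).
Proof.
have -> : gpay x = (fun y => dotp (Q D *m x + b D) (y.2 : 'cV[R]_(m_in + m_eq)) +
   \sum_i coord i (y.1 : 'cV[R]_d) * dotp (col i (P D)) (y.2 : 'cV[R]_(m_in + m_eq))).
  by apply/funext => y; rewrite /gpay payoffE.
apply: measurable_funD; first exact: (measurableT_comp (measurable_dotp _) measurable_snd).
apply: measurable_sum => i; apply: measurable_funM.
  exact: (measurableT_comp (measurable_coord i) measurable_fst).
exact: (measurableT_comp (measurable_dotp _) measurable_snd).
Qed.

Let igpay x : glued.-integrable setT (EFin \o gpay x).
Proof.
have mE : measurable_fun setT (EFin \o gpay x) by exact/measurable_EFinP.
apply/(integrable_transfer measurable_glue glued_base mE); exact: integrable_pay.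
Qed.

Let int_gpay x : (\int[glued]_y (gpay x y)%:E)%E = (dotp (Q D *m x + b D) mean + \sum_i transport_value i)%:E.
Proof.
have mE : measurable_fun setT (EFin \o gpay x) by exact/measurable_EFinP.
rewrite -(integral_transfer measurable_glue glued_base mE) -integral_pay.
by rewrite -EFin_Rintegral//; exact: integrable_pay.
Qed.

Let fst_law : same_measure (pushforward glued (fst : joint_type R d m_in m_eq -> borelV R d)) (marginal_Omega glued).
Proof. by []. Qed.

Let gC2 x (y : joint_type R d m_in m_eq) := C2max D v x (y.1 : 'cV[R]_d).

Let igC2 x : glued.-integrable setT (EFin \o gC2 x).
Proof.
have iC := integrable_C2max v glued_Gamma x.
exact: ((integrable_transfer measurable_fst fst_law (measurable_int _ iC)).1 iC).
Qed.

Let int_gC2 x : S1 D x -> (\int[glued]_y (gC2 x y)%:E)%E = worst_case_obj D x (marginal_Omega glued).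
Proof.
move=> Sx; rewrite (worst_case_objE C2v glued_Gamma Sx).
have iC := integrable_C2max v glued_Gamma x.
exact: (integral_transfer measurable_fst fst_law (measurable_int _ iC)).
Qed.

Let mOS : measurable (@Omega_S2 _ _ _ _ _ _ _ _ D).
Proof. by apply: measurableX; [exact: measurable_Omega|exact: measurable_S2]. Qed.

Let pay_le_C2 x y : S1 D x -> @Omega_S2 _ _ _ _ _ _ _ _ D y -> gpay x y <= gC2 x y.
Proof. by move=> Sx [Oy Sy]; rewrite -lee_fin -C2v//; exact: C2_ge. Qed.

(** The left-hand side is the expectation of the payoff at (w, l) under the glued law,
    and the payoff is at most the second-stage cost at w. *)
Lemma glued_le_worst_case x : S1 D x ->
  ((dotp (Q D *m x + b D) mean + \sum_i transport_value i)%:E <= worst_case_obj D x (marginal_Omega glued))%E.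
Proof.
move=> Sx; rewrite -int_gpay -int_gC2//.
apply: (prob1_le_integral mOS glued_Omega_S2 (igpay x) (igC2 x)) => y Oy.
by rewrite lee_fin pay_le_C2.
Qed.

(** In case of equality the payoff equals the second-stage cost almost surely, that
    is, l is a maximizer. *)
Lemma glued_eq_worst_case x : S1 D x ->
  (dotp (Q D *m x + b D) mean + \sum_i transport_value i)%:E = worst_case_obj D x (marginal_Omega glued) ->
  {ae glued, forall wl, @Omega_S2 _ _ _ _ _ _ _ _ D wl ->
    maximizer (S2 D) (C2_obj D x wl.1) wl.2}.
Proof.
move=> Sx; rewrite -int_gpay -int_gC2// => E.
have ik : glued.-integrable setT (fun y => (gC2 x y)%:E - (gpay x y)%:E)%E by exact: (integrableB measurableT (igC2 x) (igpay x)).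
have k0 y : @Omega_S2 _ _ _ _ _ _ _ _ D y -> (0 <= (gC2 x y)%:E - (gpay x y)%:E)%E.
  by move=> Oy; rewrite -EFinB lee_fin subr_ge0 pay_le_C2.
have k_int : (\int[glued]_y ((gC2 x y)%:E - (gpay x y)%:E) = 0)%E.
  by rewrite (integralB measurableT (igC2 x) (igpay x)) -E subee// int_gpay.
have k_ae := (ge0_prob1_integral_eq0 mOS glued_Omega_S2 ik k0).1 k_int.
apply: (ae_imp2 k_ae k_ae) => y ky _ [Oy Sy]; split=> //.
have {}ky : ((gC2 x y)%:E = (gpay x y)%:E)%E.
  exact: ((@sube_fin_eq0 _ (gC2 x y)%:E (gpay x y)%:E isT).1 ky).
by rewrite -/(C2 D x y.1) C2v//; exact/esym/ky.
Qed.

End Glue.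

(** * Reduction to finitely many unknowns *)

Section FmaxMore.
Variables (R : realType) (N : nat).
Implicit Types F G : 'I_N.+1 -> R.

Lemma fmax_shift_le F G e : (forall k, F k <= G k + e) -> fmax F <= fmax G + e.
Proof. by move=> FG; apply: fmax_le => k; rewrite (le_trans (FG k))// lerD2r fmax_ge. Qed.

Lemma fmax_convex F G H t : 0 <= t <= 1 ->
  (forall k, H k = t * F k + (1 - t) * G k) -> fmax H <= t * fmax F + (1 - t) * fmax G.
Proof.
move=> /andP[t0 t1] HE; apply: fmax_le => k; rewrite HE.
by rewrite lerD// ler_wpM2l// ?subr_ge0// fmax_ge.
Qed.

End FmaxMore.

Section ConstantIntegral.
Context d (T : measurableType d) (R : realType) (P : probability T R).

Lemma integrable_cst_prob (c : R) : P.-integrable setT (EFin \o (cst c : T -> R)).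
Proof.
by apply: (bounded_integrable (M := `|c|) measurableT (probability_setT P)) => //.
Qed.

Lemma Rintegral_cst_prob (c : R) : \int[P]_t (cst c t) = c.
Proof. by rewrite Rintegral_cst//= probability_setT mulr1. Qed.

(** The function [f] is only known to be bounded below; that its integral is not +oo
    follows from the comparison with [g]. *)
Lemma prob1_integral_le_bounded_below (D : set T) (f g : T -> \bar R) (c : R) :
  measurable D -> P D = 1%E -> measurable_fun setT f -> (forall t, (c%:E <= f t)%E) ->
  P.-integrable setT g -> (forall t, D t -> (f t <= g t)%E) ->
  (\int[P]_t f t <= \int[P]_t g t)%E.
Proof.
move=> mD PD mf cf gi fg.
have mg := measurable_int _ gi.
have foo : (\int[P]_t f t < +oo)%E.
  apply: (@le_lt_trans _ _ (\int[P]_t g^\+ t)%E).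
    2: exact: integral_funepos_lt_pinfty gi.
  apply: (@le_trans _ _ (\int[P]_t f^\+ t)%E).
    by rewrite integralE -[leRHS]sube0 leeB// integral_ge0.
  rewrite -!(prob1_integral mD PD); [|exact: measurable_funepos|exact: measurable_funepos].
  apply: ge0_le_integral => //.
  - by apply: measurable_funTS; exact: measurable_funepos.
  - by apply: measurable_funTS; exact: measurable_funepos.
  - by move=> t Dt; rewrite !funeposE ge_max !le_max lexx orbT fg.
exact: (prob1_le_integral mD PD (lbounded_integrable mf cf foo) gi fg).
Qed.

End ConstantIntegral.

(** The transform of a bounded function on a compact interval is finite and Lipschitz on the
    whole line, with constant the largest modulus of the interval. *)
Section ConvexExtension.
Variables (R : realType) (lo hi : R) (g : R -> R) (B : R).
Hypotheses (lohi : lo <= hi) (gB : forall w, lo <= w <= hi -> `|g w| <= B).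

Definition legendre (z : R) : R := sup [set w * z - g w | w in `[lo, hi]%classic].

Let M := Num.max `|lo| `|hi|.

Lemma legendre_has_sup z : has_sup [set w * z - g w | w in `[lo, hi]%classic].
Proof.
split; first by exists (lo * z - g lo), lo => //=; rewrite in_itv/= lexx lohi.
exists (M * `|z| + B) => _ [w Ow <-]; apply: (le_trans (ler_norm _)).
rewrite (le_trans (ler_normB _ _))// lerD//; last by apply: gB; move: Ow; rewrite /= in_itv.
by rewrite normrM ler_wpM2r// itv_norm_le.
Qed.

Lemma legendre_ge w z : lo <= w <= hi -> w * z - g w <= legendre z.
Proof.
by move=> Ow; apply: ub_le_sup; [exact: (legendre_has_sup z).2|exists w; rewrite //= in_itv].
Qed.

Lemma legendre_le z c : (forall w, lo <= w <= hi -> w * z - g w <= c) -> legendre z <= c.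
Proof.
move=> H; apply: ge_sup; first exact: (legendre_has_sup z).1.
by move=> _ [w Ow <-]; apply: H; move: Ow; rewrite /= in_itv.
Qed.

Lemma legendre_near z e : 0 < e -> exists2 w, lo <= w <= hi & legendre z - e < w * z - g w.
Proof.
move=> e0; have [_ [w Ow <-] we] := sup_adherent e0 (legendre_has_sup z).
by exists w => //; move: Ow; rewrite /= in_itv.
Qed.

Lemma legendre_lipschitz y z : legendre z <= legendre y + M * `|z - y|.
Proof.
apply: legendre_le => w Ow.
have := legendre_ge y Ow; have : w * (z - y) <= M * `|z - y|.
  have Ow' : `[lo, hi]%classic w by rewrite /= in_itv.
  by rewrite (le_trans (ler_norm _))// normrM ler_wpM2r// itv_norm_le.
by rewrite mulrBr; lra.
Qed.

Lemma legendre_Ccvx : Ccvx legendre.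
Proof.
split.
  apply: (@lipschitz_continuous _ R^o _ M); first by rewrite /M le_max normr_ge0.
  exact: legendre_lipschitz.
move=> t x y _ _.
change (legendre (t%:num * x + (1 - t%:num) * y) <= t%:num * legendre x + (1 - t%:num) * legendre y).
have t0 : 0 <= t%:num by exact: ge0.
have t1 : t%:num <= 1 by exact: le1.
move: (t%:num) t0 t1 (x : R) (y : R) => {}t t0 t1 {}x {}y.
apply: legendre_le => w Ow.
have := ler_wpM2l t0 (legendre_ge x Ow).
have := ler_wpM2l (_ : 0 <= 1 - t) (legendre_ge y Ow); rewrite subr_ge0 => /(_ t1) H1 H2.
apply: le_trans (lerD H2 H1); rewrite le_eqVlt; apply/orP; left; apply/eqP; ring.
Qed.

Lemma conjugate_legendre_sub (c : R) w : lo <= w <= hi ->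
  (conjugate (fun z => legendre z - c)%R w <= (g w + c)%:E)%E.
Proof.
move=> Ow; apply: ge_ereal_sup => _ [z _ <-]; rewrite lee_fin.
by have := legendre_ge z Ow; rewrite mulrC; lra.
Qed.

End ConvexExtension.

Lemma Ccvx_subr (R : realType) (f : R -> R) (c : R) : Ccvx f -> Ccvx (fun z => f z - c).
Proof.
move=> [cf f_cvx]; split.
  by move=> z; apply: cvgB; [exact: cf|exact: cvg_cst].
move=> t x y Dx Dy; have := f_cvx t x y Dx Dy.
set z := conv _ _ _.
change (f z <= t%:num * f x + (1 - t%:num) * f y ->
  f z - c <= t%:num * (f x - c) + (1 - t%:num) * (f y - c)).
move: (f z) (f x) (f y) (t%:num) => a e h s; lra.
Qed.

Section FiniteProblem.
Variables (R : realType) (d k1 n_in n_eq m_in m_eq k2 : nat).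
Variable D : dro_data R d k1 n_in n_eq m_in m_eq k2.
Hypothesis lo_le_hi : forall i, lo D i <= hi D i.
Hypothesis mu_prob : forall i, prob_on (Omega_ D i) (mu D i).
Variables (N : nat) (v : 'I_N.+1 -> 'cV[R]_(m_in + m_eq)).
Hypothesis C2v : forall x w, S1 D x -> Omega D w ->
  C2 D x w = (fmax (fun k => payoff D x w (v k)))%:E.
Implicit Types (x : 'cV[R]_k1) (psi : 'I_d -> 'I_N.+1 -> R).

Definition slope i k : R := dotp (col i (P D)) (v k).

Definition piecewise i (p : 'I_N.+1 -> R) (w : R) : R := fmax (fun k => slope i k * w - p k).

Definition mean_piecewise i p : R := \int[mu D i]_w piecewise i p w.

Definition vertex_value x psi k : R := dotp (Q D *m x + b D) (v k) + \sum_i psi i k.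

(** The primal objective as a function of the numbers psi_(i, k), which stand for
    the values of f_i at <p_i, v_k>.  The last term is the worst violation of the
    constraints at the v_k; it can be added to the objective instead, since lowering an f_i
    by a constant restores feasibility and raises its conjugate by that constant. *)
Definition reduced_obj x psi : R :=
  dotp (c1 D) x + \sum_i mean_piecewise i (psi i) + fmax (vertex_value x psi).

(** Bounds the linear parts of all the pieces of [piecewise] on the interval. *)
Definition slope_bound i : R := fmax (fun k => Num.max `|lo D i| `|hi D i| * `|slope i k|).

Lemma slope_le i k w : Omega_ D i w -> `|slope i k * w| <= slope_bound i.
Proof.
move=> Ow; apply: (@le_trans _ _ (Num.max `|lo D i| `|hi D i| * `|slope i k|)).
  by rewrite normrM mulrC ler_wpM2r// itv_norm_le.
exact: (fmax_ge (fun k => Num.max `|lo D i| `|hi D i| * `|slope i k|)).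
Qed.

Lemma measurable_piecewise i p : measurable_fun setT (piecewise i p).
Proof.
by apply: measurable_fmax => k; apply: measurable_funB.
Qed.

Lemma piecewise_bounded i p : exists B, forall w, Omega_ D i w -> `|piecewise i p w| <= B.
Proof.
exists (slope_bound i + fmax (fun k => `|p k|)) => w Ow; apply: fmax_norm_le => k.
rewrite (le_trans (ler_normB _ _))// lerD ?slope_le//.
exact: (fmax_ge (fun k => `|p k|)).
Qed.

Lemma integrable_piecewise i p : (mu D i).-integrable setT (EFin \o piecewise i p).
Proof.
have [B BP] := piecewise_bounded i p.
exact: (bounded_integrable (measurable_itv _) (mu_prob i) (measurable_piecewise i p) BP).
Qed.

Lemma mean_piecewise_le i p q e : (forall w, Omega_ D i w -> piecewise i p w <= piecewise i q w + e) ->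
  mean_piecewise i p <= mean_piecewise i q + e.
Proof.
move=> pq; have ie := integrable_cst_prob (mu D i) e.
have -> : mean_piecewise i q + e = \int[mu D i]_w (piecewise i q w + e).
  rewrite RintegralD//; last exact: integrable_piecewise.
  by rewrite Rintegral_cst_prob.
have ip := integrable_piecewise i p.
have iqe : (mu D i).-integrable setT (EFin \o (fun w => piecewise i q w + e)).
  by apply: integrableDR => //; exact: integrable_piecewise.
rewrite -lee_fin /mean_piecewise -(EFin_Rintegral ip) -(EFin_Rintegral iqe).
apply: (prob1_le_integral (measurable_itv _) (mu_prob i) ip iqe) => w Ow.
by rewrite lee_fin pq.
Qed.

(** The Legendre transform of the piecewise linear function, lowered by an equal
    share of the worst violation so that the constraints hold. *)
Definition extension (x : 'cV[R]_k1) psi (i : 'I_d) (z : R) : R :=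
  legendre (lo D i) (hi D i) (piecewise i (psi i)) z - fmax (vertex_value x psi) / d%:R.

Lemma payoff_le_piecewise x psi (w : 'cV[R]_d) k : 
  payoff D x w (v k) <= fmax (vertex_value x psi) + \sum_i piecewise i (psi i) (w i 0).
Proof.
rewrite payoffE.
apply: (@le_trans _ _ (vertex_value x psi k + \sum_i (slope i k * w i 0 - psi i k))).
  rewrite /vertex_value sumrB -addrA subrKC lerD2l le_eqVlt; apply/orP; left; apply/eqP.
  by apply: eq_bigr => i _; rewrite mulrC.
apply: lerD; first exact: fmax_ge.
by apply: ler_sum => i _; exact: (fmax_ge (fun k => slope i k * w i 0 - psi i k)).
Qed.

(** At l, choose for each i a point w_i at which the supremum defining the transform
    at <p_i, l> is nearly attained.  The constraint then reduces to a bound on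
    <Q x + P w + b, l>, which is at most C_2(x, w), hence at most its value at some v_k,
    where it holds by the definition of the worst violation. *)
Lemma extension_feasible x psi : (0 < d)%N -> S1 D x -> primal_feasible D (x, extension x psi).
Proof.
move=> d0 Sx; have [x0 xin xeq] := Sx.
have bnd i := piecewise_bounded i (psi i).
have d0R : (d%:R : R) != 0 by rewrite pnatr_eq0 -lt0n.
split=> //= [l Sl|i]; last first.
  apply: Ccvx_subr; have [B BP] := bnd i; apply: (legendre_Ccvx (lo_le_hi i) (B := B)).
  by move=> w Ow; apply: BP; rewrite /Omega_/= in_itv.
rewrite /primal_constr sumrB.
rewrite (_ : \sum_(i < d) fmax (vertex_value x psi) / d%:R = fmax (vertex_value x psi)); last first.
  by rewrite sumr_const card_ord -[_ *+ d]mulr_natr divfK.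
rewrite addrA subr_le0; apply/ler_addgt0Pr => e e0.
have ed : 0 < e / d%:R by rewrite divr_gt0// ltr0n.
have near i : {w | lo D i <= w <= hi D i /\
    legendre (lo D i) (hi D i) (piecewise i (psi i)) (dotp (col i (P D)) l) - e / d%:R <
    w * dotp (col i (P D)) l - piecewise i (psi i) w}.
  apply: cid; have [B BP] := bnd i.
  have [|w Ow wz] := @legendre_near _ _ _ (piecewise i (psi i)) B (lo_le_hi i) _ (dotp (col i (P D)) l) _ ed.
    by move=> w Ow; apply: BP; rewrite /Omega_/= in_itv.
  by exists w.
pose w : 'cV[R]_d := \col_i sval (near i).
have Ow : Omega D w by move=> i; rewrite mxE /Omega_/= in_itv; exact: (svalP (near i)).1.
have : payoff D x w l <= fmax (vertex_value x psi) + \sum_i piecewise i (psi i) (w i 0).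
  rewrite -lee_fin (le_trans (C2_ge x w Sl))// C2v// lee_fin.
  by apply: fmax_le => k; exact: payoff_le_piecewise.
have : \sum_i legendre (lo D i) (hi D i) (piecewise i (psi i)) (dotp (col i (P D)) l) - e <=
    \sum_i (w i 0 * dotp (col i (P D)) l - piecewise i (psi i) (w i 0)).
  have {1}-> : e = \sum_(i < d) e / d%:R.
    by rewrite sumr_const card_ord -[_ *+ d]mulr_natr divfK.
  rewrite -sumrB; apply: ler_sum => i _; rewrite mxE; exact/ltW/(svalP (near i)).2.
by rewrite payoffE sumrB; lra.
Qed.

(** On the interval, the conjugate of the transform is at most the original
    piecewise linear function. *)
Lemma extension_obj x psi : (0 < d)%N ->
  (primal_obj D (x, extension x psi) <= (reduced_obj x psi)%:E)%E.
Proof.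
move=> d0; rewrite (primal_objE mu_prob) /reduced_obj -addrA EFinD leeD2l//.
pose m := fmax (vertex_value x psi) / d%:R.
have -> : (\sum_i mean_piecewise i (psi i) + fmax (vertex_value x psi))%:E =
    (\sum_(i < d) (mean_piecewise i (psi i) + m)%:E)%E.
  rewrite sumEFin big_split/=; congr (_ + _)%:E.
  by rewrite sumr_const card_ord -[_ *+ d]mulr_natr divfK// pnatr_eq0 -lt0n.
apply: lee_sum => i _.
have iq : (mu D i).-integrable setT (EFin \o (fun w => piecewise i (psi i) w + m)).
  apply: integrableDR; first exact: integrable_piecewise.
  exact: integrable_cst_prob.
have le w : Omega_ D i w ->
    (conjugate (extension x psi i) w <= (piecewise i (psi i) w + m)%:E)%E.
  have [B BP] := piecewise_bounded i (psi i).
  have BP' w' : lo D i <= w' <= hi D i -> `|piecewise i (psi i) w'| <= B.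
    by move=> Ow'; apply: BP; rewrite /Omega_/= in_itv.
  rewrite /Omega_/= in_itv/=.
  exact: (conjugate_legendre_sub (lo_le_hi i) BP').
rewrite -(Rintegral_cst_prob (mu D i) m) -RintegralD//; last 2 first.
- exact: integrable_piecewise.
- exact: integrable_cst_prob.
rewrite -EFin_Rintegral//.
apply: (prob1_integral_le_bounded_below (c := - extension x psi i 0)
  (measurable_itv _) (mu_prob i)) => //; first exact: measurable_conjugate.
exact: conjugate_ge0.
Qed.

End FiniteProblem.

(** * From lower bounds to dual points *)

Section Discrete.
Context d (T : measurableType d) (R : realType) (N : nat).
Variables (v : 'I_N -> T) (t : 'I_N -> R).
Hypotheses (t0 : forall k, 0 <= t k) (t1 : \sum_k t k = 1).
Local Open Scope ereal_scope.

(** Extended by the null measure beyond N, because finite sums of measures are taken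
    over sequences. *)
Definition atom (n : nat) : {measure set T -> \bar R} :=
  match insub n with
  | Some k => mscale (NngNum (t0 k)) (dirac (v k))
  | None => mzero
  end.

Lemma atomE (k : 'I_N) : atom k = mscale (NngNum (t0 k)) (dirac (v k)).
Proof. by rewrite /atom valK. Qed.

(** The normalization is an argument so that the structure of a probability can
    be attached to the applied constant. *)
Definition discrete (_ : (\sum_k t k = 1)%R) : set T -> \bar R := msum atom N.

HB.instance Definition _ := Measure.on (discrete t1).

Lemma discreteE A : measurable A -> discrete t1 A = (\sum_k (t k)%:E * \d_(v k) A)%E.
Proof.
by move=> mA; rewrite /discrete /msum/=; apply: eq_bigr => k _; rewrite atomE.
Qed.

Lemma discrete_setT : discrete t1 setT = 1.
Proof.
rewrite discreteE// -t1 -sumEFin; apply: eq_bigr => k _.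
by rewrite diracT mule1.
Qed.

HB.instance Definition _ := Measure_isProbability.Build _ _ _ (discrete t1) discrete_setT.

Lemma ge0_integral_discrete (h : T -> \bar R) : measurable_fun setT h ->
  (forall x, 0 <= h x) -> \int[discrete t1]_x h x = (\sum_k (t k)%:E * h (v k))%E.
Proof.
move=> mh h0; rewrite /discrete ge0_integral_measure_sum//.
apply: eq_bigr => k _; rewrite atomE ge0_integral_mscale//; congr (_ * _).
by rewrite integral_dirac// diracT mul1e.
Qed.

Lemma integral_discrete (f : T -> R) : measurable_fun setT f ->
  \int[discrete t1]_x (f x)%:E = (\sum_k t k * f (v k))%:E.
Proof.
move=> /measurable_EFinP mf; rewrite integralE.
rewrite ge0_integral_discrete//; last exact: measurable_funepos.
rewrite ge0_integral_discrete//; last exact: measurable_funeneg.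
under eq_bigr do rewrite funeposE -[0]/(0%:E) -EFin_max -EFinM.
under [X in _ - X]eq_bigr do rewrite funenegE -[0]/(0%:E) -EFinN -EFin_max -EFinM.
rewrite !sumEFin -EFinB -sumrB; congr EFin; apply: eq_bigr => k _.
rewrite -mulrBr; congr (_ * _)%R.
case/orP: (le_total 0%R (f (v k))) => fk.
  by rewrite max_l// max_r ?subr0// oppr_le0.
by rewrite max_r// max_l ?sub0r ?opprK// oppr_ge0.
Qed.

End Discrete.

Section DualPoint.
Variables (R : realType) (d k1 n_in n_eq m_in m_eq k2 : nat).
Variable D : dro_data R d k1 n_in n_eq m_in m_eq k2.
Hypothesis mu_prob : forall i, prob_on (Omega_ D i) (mu D i).
Variables (N : nat) (v : 'I_N.+1 -> 'cV[R]_(m_in + m_eq)).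
Hypothesis vS : forall k, S2 D (v k).
Implicit Types (x : 'cV[R]_k1) (psi : 'I_d -> 'I_N.+1 -> R).
Local Notation Vl := (borelV R (m_in + m_eq)).

Lemma mean_piecewise_convex i (p q r : 'I_N.+1 -> R) (s : R) : 0 <= s <= 1 ->
  (forall k, r k = s * p k + (1 - s) * q k) ->
  mean_piecewise D v i r <= s * mean_piecewise D v i p + (1 - s) * mean_piecewise D v i q.
Proof.
move=> s01 rE.
have ip := integrable_piecewise mu_prob v i p.
have iq := integrable_piecewise mu_prob v i q.
have ir := integrable_piecewise mu_prob v i r.
rewrite /mean_piecewise -!RintegralZl// -RintegralD//; try exact: integrableZR.
apply: le_Rintegral => //.
  by apply: integrableDR; exact: integrableZR.
move=> w _; apply: fmax_convex => // k.
by rewrite rE; ring.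
Qed.

Lemma S1_convex x y (s : R) : 0 <= s <= 1 -> S1 D x -> S1 D y ->
  S1 D (s *: x + (1 - s) *: y).
Proof.
move=> /andP[s0 s1] [x0 xin xeq] [y0 yin yeq].
have s1' : 0 <= 1 - s by rewrite subr_ge0.
split=> [j|i|].
- have := x0 j; have := y0 j; rewrite !mxE => ? ?.
  by rewrite addr_ge0// mulr_ge0.
- rewrite mulmxDr -!scalemxAr mxE [X in X + _]mxE [X in _ + X]mxE.
  have := ler_wpM2l s0 (xin i); have := ler_wpM2l s1' (yin i); lra.
- rewrite mulmxDr -!scalemxAr xeq yeq -scalerDl.
  by rewrite subrKC scale1r.
Qed.

Section Weights.
Variables (t : 'I_N.+1 -> R).
Hypotheses (t0 : forall k, 0 <= t k) (t1 : \sum_k t k = 1).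

Definition vertex_measure : probability Vl R := discrete (v : 'I_N.+1 -> Vl) t0 t1.

Lemma vertex_measure_prob1 : prob1_on (S2 D : set Vl) vertex_measure.
Proof.
have tS : vertex_measure (S2 D) = 1%E.
  apply: (etrans (discreteE _ t0 t1 (measurable_S2 D))).
  rewrite -[in RHS]t1 -sumEFin; apply: eq_bigr => k _.
  by rewrite diracE mem_set ?mule1//; exact: vS.
split=> //; have mn : measurable_fun setT (fun l : Vl => `|l : 'cV[R]_(m_in + m_eq)|).
  by apply: continuous_measurableV; exact: norm_continuousV.
rewrite (prob1_integral (measurable_S2 D) tS); last exact/measurable_EFinP.
by rewrite integral_discrete// ltry.
Qed.

Lemma dotp_mean_vertex c : dotp c (mean vertex_measure) = \sum_k t k * dotp c (v k).
Proof.
rewrite -(dotp_mean vertex_measure_prob1) /Rintegral integral_discrete//.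
exact: measurable_dotp.
Qed.

Lemma supp_vertex_measure : supp vertex_measure `<=` range v.
Proof.
move=> l sl; apply: contrapT => nl.
have cV : closed (range v).
  have /accessible_finite_set_closed fin_closed :
      accessible_space 'cV[R]_(m_in + m_eq).
    exact/hausdorff_accessible/norm_hausdorff.
  by apply: fin_closed; exact: finite_image.
have := sl _ (closed_openC cV) nl; suff -> : vertex_measure (~` range v) = 0%E by rewrite ltxx.
apply: (etrans (discreteE _ t0 t1 (measurableC (closed_measurableV cV)))).
rewrite big1// => k _; rewrite diracE memNset ?mule0//.
by apply; exists k.
Qed.

End Weights.
End DualPoint.

Section StrongDuality.
Variables (R : realType) (d k1 n_in n_eq m_in m_eq k2 : nat).
Variable D : dro_data R d k1 n_in n_eq m_in m_eq k2.
Hypothesis lo_le_hi : forall i, lo D i <= hi D i.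
Hypothesis mu_prob : forall i, prob_on (Omega_ D i) (mu D i).
Hypothesis S1_neq0 : S1 D !=set0.
Variables (N : nat) (v : 'I_N.+1 -> 'cV[R]_(m_in + m_eq)).
Hypothesis vS : forall k, S2 D (v k).
Implicit Types (x : 'cV[R]_k1) (psi : 'I_d -> 'I_N.+1 -> R).
Local Notation Vl := (borelV R (m_in + m_eq)).

(** The vectors (h_k(x, psi) - m)_k, with h_k the objective in which the maximum is
    replaced by its k-th term, form a convex set up to domination, and none of them has only
    negative coordinates. *)
Lemma lower_bound_weights m : (forall x psi, S1 D x -> m <= reduced_obj D v x psi) ->
  exists t : 'I_N.+1 -> R, [/\ forall k, 0 <= t k, \sum_k t k = 1 &
    forall x psi, S1 D x ->
      m <= dotp (c1 D) x + \sum_i mean_piecewise D v i (psi i) + \sum_k t k * vertex_value D v x psi k].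
Proof.
move=> mh; pose H x psi := dotp (c1 D) x + \sum_i mean_piecewise D v i (psi i).
pose C : set ('I_N.+1 -> R) := [set y | exists x psi, S1 D x /\
  forall k, H x psi + vertex_value D v x psi k - m <= y k].
have [|//||t [t0 t1 tC]] := @minimax R N.+1 C.
- move=> y z s [x [psi [Sx xy]]] [x' [psi' [Sx' xz]]] s01.
  exists (fun i => s * y i + (1 - s) * z i) => //.
  have [s0 s1] := andP s01; have s1' : 0 <= 1 - s by rewrite subr_ge0.
  pose psi'' i k := s * psi i k + (1 - s) * psi' i k.
  exists (s *: x + (1 - s) *: x'), psi''; split; first exact: S1_convex.
  move=> k; have := ler_wpM2l s0 (xy k); have := ler_wpM2l s1' (xz k).
  have HE : H (s *: x + (1 - s) *: x') psi'' <= s * H x psi + (1 - s) * H x' psi'.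
    rewrite /H dotpDr !dotpZr !mulrDr addrACA lerD2l !mulr_sumr -big_split/=.
    by apply: ler_sum => i _; exact: mean_piecewise_convex.
  have VE : vertex_value D v (s *: x + (1 - s) *: x') psi'' k = s * vertex_value D v x psi k + (1 - s) * vertex_value D v x' psi' k.
    rewrite /vertex_value /psi'' big_split/= -!mulr_sumr.
    rewrite (_ : Q D *m (s *: x + (1 - s) *: x') + b D =
      s *: (Q D *m x + b D) + (1 - s) *: (Q D *m x' + b D)); last first.
      by rewrite mulmxDr -!scalemxAr !scalerDr addrACA -scalerDl subrKC scale1r.
    by rewrite dotpDl !dotpZl; ring.
  by move: HE VE; lra.
- move=> y [x [psi [Sx xy]]]; have [k kmax] := fmax_attained (vertex_value D v x psi).
  exists k; apply: le_trans (xy k); rewrite subr_ge0 -kmax; exact: mh.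
exists t; split=> // x psi Sx.
have /tC : C (fun k => H x psi + vertex_value D v x psi k - m) by exists x, psi; split.
rewrite (eq_bigr (fun k => t k * (H x psi - m) + t k * vertex_value D v x psi k)); last first.
  by move=> k _; ring.
by rewrite big_split/= -mulr_suml t1 mul1r /H; lra.
Qed.

(** With psi the values of the transport potentials at the slopes, each piecewise
    linear function is at most the conjugate of the potential, so
    the weighted lower bound becomes one in terms of the transport values. *)
Lemma dual_of_lower_bound m : (forall x psi, S1 D x -> m <= reduced_obj D v x psi) ->
  exists tau xi_in xi_eq, [/\ dual_feasible D (tau, xi_in, xi_eq),
    (m%:E <= dual_obj D (tau, xi_in, xi_eq))%E & supp tau `<=` range v].
Proof.
move=> mh; have [t [t0 t1 tP]] := lower_bound_weights mh.
pose tau := vertex_measure v t0 t1.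
have tau1 : prob1_on (S2 D : set Vl) tau := vertex_measure_prob1 vS t0 t1.
have tP' x : S1 D x -> m <= dotp (c1 D) x + dotp (Q D *m x + b D) (mean tau) + \sum_i transport_value D tau i.
  move=> Sx; apply: (le_trans (tP x (fun i k => potential D tau i (slope D v i k)) Sx)).
  rewrite (dotp_mean_vertex vS) -!addrA lerD2l /vertex_value.
  rewrite [X in _ + X](eq_bigr (fun k => t k * dotp (Q D *m x + b D) (v k) +
     \sum_i t k * potential D tau i (slope D v i k))); last first.
    by move=> k _; rewrite mulrDr [X in _ + X = _]mulr_sumr.
  rewrite big_split/= addrCA lerD2l exchange_big/= -big_split/=.
  apply: ler_sum => i _.
  have [pi_ ci cE] := potential_integral lo_le_hi mu_prob tau1 i.
  have mpot : measurable_fun setT (potential D tau i).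
    apply: continuous_measurable_fun.
    exact: (comonotone_potential_Ccvx (push D tau i) (lo_le_hi i) (mu_prob i)).1.
  have pE : \int[push D tau i]_z potential D tau i z = \sum_k t k * potential D tau i (slope D v i k).
    have mZ : measurable_fun setT (dotp (col i (P D)) : Vl -> R) by exact: measurable_dotp.
    have Znu : same_measure (pushforward tau (dotp (col i (P D)) : Vl -> R)) (push D tau i) by [].
    rewrite /Rintegral -(integral_transfer mZ Znu (measurable_int _ pi_)).
    rewrite integral_discrete//.
    exact: measurableT_comp.
  rewrite -lerBrDr -pE -lee_fin -cE /mean_piecewise.
  have ip := integrable_piecewise mu_prob v i (fun k => potential D tau i (slope D v i k)).
  rewrite -(EFin_Rintegral ip).
  apply: (prob1_le_integral measurableT (probability_setT _) ip ci) => w _.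
  rewrite /= /piecewise; have [k ->] := fmax_attained (fun k => slope D v i k * w - potential D tau i (slope D v i k)).
  exact: conjugate_ge.
have [|xi_in [xi_eq [xi0 xiL xim]]] := @S1_duality _ _ _ _ _ _ _ _ D
    (c1 D + (Q D)^T *m mean tau) (m - dotp (b D) (mean tau) - \sum_i transport_value D tau i) S1_neq0.
  move=> x Sx; have := tP' x Sx; rewrite !dotpDl dotp_mulmx; lra.
exists tau, xi_in, xi_eq; split; last exact: supp_vertex_measure.
  by split=> //; rewrite QT_meanE.
by rewrite (dual_objE lo_le_hi mu_prob tau1) lee_fin; lra.
Qed.

End StrongDuality.

(** * Attainment in the reduced problem *)

Section Attainment.
Variables (R : realType) (d k1 n_in n_eq m_in m_eq k2 : nat).
Variable D : dro_data R d k1 n_in n_eq m_in m_eq k2.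
Hypothesis mu_prob : forall i, prob_on (Omega_ D i) (mu D i).
Hypothesis S1_neq0 : S1 D !=set0.
Variables (N : nat) (v : 'I_N.+1 -> 'cV[R]_(m_in + m_eq)).
Implicit Types (x : 'cV[R]_k1) (psi : 'I_d -> 'I_N.+1 -> R).

(** The values are shifted to have minimum zero, then cut at a height above which
    the corresponding piece no longer attains the maximum on the interval. *)
Definition truncation psi i k : R :=
  Num.min (psi i k + fmax (fun k => - psi i k)) (2 * slope_bound D v i).

Lemma slope_bound_ge0 i : 0 <= slope_bound D v i.
Proof.
apply: le_trans (fmax_ge _ ord0) => /=.
by rewrite mulr_ge0// le_max normr_ge0.
Qed.

Lemma truncation_itv psi i k : 0 <= truncation psi i k <= 2 * slope_bound D v i.
Proof.
rewrite ge_min lexx orbT andbT le_min mulr_ge0 ?slope_bound_ge0// andbT.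
by rewrite -lerBlDl sub0r; exact: (fmax_ge (fun k => - psi i k)).
Qed.

(** A piece cut at twice the bound on the slopes lies below the piece whose value is
    zero. *)
Lemma truncation_piecewise psi i w : Omega_ D i w ->
  piecewise D v i (truncation psi i) w <= piecewise D v i (psi i) w - fmax (fun k => - psi i k).
Proof.
move=> Ow; apply: fmax_le => k; have [ks ksE] := fmax_attained (fun k => - psi i k).
have Pk := fmax_ge (fun k => slope D v i k * w - psi i k) k.
have Pks := fmax_ge (fun k => slope D v i k * w - psi i k) ks.
have /ler_normlP[s1 s2] := slope_le v k Ow.
have /ler_normlP[s3 s4] := slope_le v ks Ow.
move: Pk Pks; rewrite -/(piecewise D v i (psi i) w) /truncation.
case: (leP (psi i k + fmax (fun k => - psi i k)) (2 * slope_bound D v i)) => _ ? ?; first by lra.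
by rewrite ksE; lra.
Qed.

(** The shift changes the integrals and the final maximum by opposite amounts; the cut
    leaves the integrals unchanged and can only lower the maximum. *)
Lemma reduced_obj_truncation x psi : reduced_obj D v x (truncation psi) <= reduced_obj D v x psi.
Proof.
pose s i := fmax (fun k => - psi i k).
have H1 : \sum_i mean_piecewise D v i (truncation psi i) <= \sum_i mean_piecewise D v i (psi i) - \sum_i s i.
  rewrite -sumrB; apply: ler_sum => i _; apply: mean_piecewise_le => // w Ow.
  exact: truncation_piecewise.
have H2 : fmax (vertex_value D v x (truncation psi)) <= fmax (vertex_value D v x psi) + \sum_i s i.
  apply: fmax_shift_le => k; rewrite /vertex_value -addrA lerD2l -big_split/=.
  by apply: ler_sum => i _; rewrite /truncation ge_min lexx.
by rewrite /reduced_obj; lra.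
Qed.

Lemma reduced_obj_lipschitz x psi psi' e : (forall i k, `|psi i k - psi' i k| <= e) ->
  reduced_obj D v x psi <= reduced_obj D v x psi' + 2 * d%:R * e.
Proof.
move=> pe; have sumE : \sum_(i < d) e = d%:R * e by rewrite sumr_const card_ord mulr_natl.
have H1 : \sum_i mean_piecewise D v i (psi i) <= \sum_i mean_piecewise D v i (psi' i) + d%:R * e.
  rewrite -sumE -big_split/=; apply: ler_sum => i _; apply: mean_piecewise_le => // w Ow.
  apply: fmax_shift_le => k; have /ler_normlP[] := pe i k; lra.
have H2 : fmax (vertex_value D v x psi) <= fmax (vertex_value D v x psi') + d%:R * e.
  apply: fmax_shift_le => k; rewrite /vertex_value -addrA lerD2l -sumE -big_split/=.
  by apply: ler_sum => i _; have /ler_normlP[] := pe i k; lra.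
by rewrite /reduced_obj; lra.
Qed.

(** For fixed psi this is a linear program in (x, s), where s is a lower
    bound for minus the last maximum. *)
Lemma first_stage_attained m psi : (forall x, S1 D x -> m <= reduced_obj D v x psi) ->
  exists2 x, S1 D x & forall y, S1 D y -> reduced_obj D v x psi <= reduced_obj D v y psi.
Proof.
move=> mh; pose W := ('cV[R]_k1 * R^o)%type.
pose a (i : (('I_k1 + 'I_n_in) + ('I_n_eq + 'I_n_eq)) + 'I_N.+1) (p : W) : R :=
  match i with
  | inl (inl (inl j)) => - p.1 j 0
  | inl (inl (inr i)) => (L_in D *m p.1) i 0
  | inl (inr (inl i)) => (L_eq D *m p.1) i 0
  | inl (inr (inr i)) => - (L_eq D *m p.1) i 0
  | inr k => dotp (Q D *m p.1) (v k) + p.2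
  end.
pose be (i : (('I_k1 + 'I_n_in) + ('I_n_eq + 'I_n_eq)) + 'I_N.+1) : R :=
  match i with
  | inl (inl (inl j)) => 0
  | inl (inl (inr i)) => q_in D i 0
  | inl (inr (inl i)) => q_eq D i 0
  | inl (inr (inr i)) => - q_eq D i 0
  | inr k => - (dotp (b D) (v k) + \sum_i psi i k)
  end.
have sa i : scalar (a i).
  case: i => [[[j|i]|[i|i]]|k] s p q; rewrite /a/=.
  - by rewrite !mxE; ring.
  - by rewrite mulmxDr -scalemxAr mxE [X in X + _]mxE.
  - by rewrite mulmxDr -scalemxAr mxE [X in X + _]mxE.
  - by rewrite mulmxDr -scalemxAr mxE [X in X + _]mxE; ring.
  - by rewrite mulmxDr -scalemxAr dotpDl dotpZl -[s *: p.2]/(s * p.2); ring.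
have polyP x s : polyhedron a be (x, s) <-> S1 D x /\ s <= - fmax (vertex_value D v x psi).
  have vE k : vertex_value D v x psi k = dotp (Q D *m x) (v k) + (dotp (b D) (v k) + \sum_i psi i k).
    by rewrite /vertex_value dotpDl addrA.
  split=> [H|[[x0 xin xeq] sx] [[[j|i]|[i|i]]|k]]; rewrite /a/be/=.
  - split; first split.
    + by move=> j; have := H (inl (inl (inl j))); rewrite /= oppr_le0 !mxE.
    + by move=> i; exact: (H (inl (inl (inr i)))).
    + apply/matrixP => i j; rewrite ord1; apply/eqP; rewrite eq_le.
      have := H (inl (inr (inl i))); have := H (inl (inr (inr i))).
      by rewrite /= lerN2 => -> ->.
    + rewrite lerNr; apply: fmax_le => k; have := H (inr k); rewrite vE /=; lra.
  - by have := x0 j; rewrite oppr_le0 !mxE.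
  - exact: xin.
  - by rewrite xeq.
  - by rewrite xeq.
  - have := fmax_ge (vertex_value D v x psi) k; rewrite vE; lra.
pose obj (p : W) : R := p.2 - dotp (c1 D) p.1.
have sobj : scalar obj.
  by move=> s p q; rewrite /obj/= dotpDr dotpZr -[s *: p.2]/(s * p.2); ring.
have bobj p : polyhedron a be p -> obj p <= \sum_i mean_piecewise D v i (psi i) - m.
  case: p => x s /polyP[Sx sx]; have := mh x Sx; rewrite /reduced_obj /obj/=; lra.
have [|[x s] /polyP[Sx sx] xmax] := linear_program_attained sa sobj bobj.
  have [x Sx] := S1_neq0; exists (x, - fmax (vertex_value D v x psi)); exact/polyP.
exists x => // y Sy; have /polyP/xmax : S1 D y /\ - fmax (vertex_value D v y psi) <= - fmax (vertex_value D v y psi) by [].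
by rewrite /obj/= /reduced_obj; lra.
Qed.

(** The minimum over x is a Lipschitz function of psi, and truncation confines psi to
    a compact box. *)
Lemma reduced_obj_attained m : (forall x psi, S1 D x -> m <= reduced_obj D v x psi) ->
  exists x psi, S1 D x /\ forall y phi, S1 D y -> reduced_obj D v x psi <= reduced_obj D v y phi.
Proof.
move=> mh; pose T := 'rV[R]_(d * N.+1).
pose psi_of (u : T) i k : R := u 0 (mxvec_index i k).
have xP (u : T) : {x | S1 D x /\ forall y, S1 D y -> reduced_obj D v x (psi_of u) <= reduced_obj D v y (psi_of u)}.
  by apply: cid; have [x Sx xmin] := first_stage_attained (fun x => mh x (psi_of u)); exists x.
pose F (u : T) := reduced_obj D v (sval (xP u)) (psi_of u).
have cF : continuous F.
  apply: (@lipschitz_continuous _ _ _ (2 * d%:R)); first by rewrite mulr_ge0.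
  move=> u u'; have [Sx _] := svalP (xP u); have [_ xmin'] := svalP (xP u').
  apply: (le_trans (xmin' _ Sx)); apply: reduced_obj_lipschitz => i k.
  by have := mx_entry_norm_le (u' - u) 0 (mxvec_index i k); rewrite !mxE.
pose c := \sum_i 2 * slope_bound D v i.
pose A : set T := [set u | forall j, `[0, c]%classic (u ord0 j)].
have cA : compact A by have := @rV_compact R (d * N.+1) (fun=> `[0, c]%classic); apply=> j; exact: segment_compact.
have c0 : 0 <= c by apply: sumr_ge0 => i _; rewrite mulr_ge0 ?slope_bound_ge0.
have A0 : A !=set0 by exists 0 => j; rewrite mxE /= in_itv/= lexx.
have [u _ uP] := compact_EVT_min A0 cA (continuous_subspaceT cF).
exists (sval (xP u)), (psi_of u); split=> [|y phi Sy]; first exact: (svalP (xP u)).1.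
apply: (le_trans _ (reduced_obj_truncation y phi)).
pose u' : T := mxvec (\matrix_(i, k) truncation phi i k).
have u'E i k : psi_of u' i k = truncation phi i k by rewrite /psi_of mxvecE mxE.
have uA : u' \in A.
  apply: mem_set => j; case/mxvec_indexP: j => i k; rewrite -/(psi_of u' i k) u'E /= in_itv/=.
  have /andP[-> /= /le_trans] := truncation_itv phi i k; apply.
  rewrite /c (bigD1 i)//= lerDl; apply: sumr_ge0 => j _; by rewrite mulr_ge0 ?slope_bound_ge0.
apply: (le_trans (uP _ uA)).
have -> : truncation phi = psi_of u' by apply/funext => i; apply/funext => k; rewrite u'E.
exact: (svalP (xP u')).2.
Qed.

End Attainment.

(** * Dual feasible points *)

(** The origin is a convex combination of z and of -1 or 1, so f(z) cannot be much
    smaller than the values of f at these points. *)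
Lemma convex_ge_linear (R : realType) (f : R -> R) (z : R) : Ccvx f ->
  - ((`|f 0| + `|f 1| + `|f (- 1)|) * (1 + `|z|)) <= f z.
Proof.
move=> [_ f_cvx]; set K := _ + _ + _.
have z1 : 0 < 1 + `|z| by rewrite ltr_pwDl.
have [s s1 sz] : exists2 s, `|f s| + `|f 0| <= K & z + `|z| * s = 0.
  have [z0|z0] := leP 0 z.
    by exists (- 1); [rewrite /K; have := normr_ge0 (f 1); lra|rewrite mulrN1 ger0_norm ?subrr].
  by exists 1; [rewrite /K; have := normr_ge0 (f (- 1)); lra|rewrite mulr1 ltr0_norm ?subrr].
have t01 : 0 <= (1 + `|z|)^-1 <= 1.
  by rewrite invr_ge0 (ltW z1)/= invf_le1// lerDl.
pose t : {i01 R} := Itv01 (andP t01).1 (andP t01).2.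
have := f_cvx t z s (in_setT _) (in_setT _).
change (f ((1 + `|z|)^-1 * z + (1 - (1 + `|z|)^-1) * s) <=
  (1 + `|z|)^-1 * f z + (1 - (1 + `|z|)^-1) * f s -> - (K * (1 + `|z|)) <= f z).
have -> : (1 + `|z|)^-1 * z + (1 - (1 + `|z|)^-1) * s = (1 + `|z|)^-1 * (z + `|z| * s).
  by field; rewrite gt_eqF.
rewrite sz mulr0 => H.
have : (1 + `|z|) * f 0 <= f z + `|z| * f s.
  have -> : f z + `|z| * f s = (1 + `|z|) * ((1 + `|z|)^-1 * f z + (1 - (1 + `|z|)^-1) * f s).
    by field; rewrite gt_eqF.
  by rewrite ler_wpM2l// ltW.
have H0 : (1 + `|z|) * - `|f 0| <= (1 + `|z|) * f 0.
  by rewrite ler_wpM2l ?(ltW z1)// lerNl -normrN ler_norm.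
have H1 : `|z| * f s <= (1 + `|z|) * `|f s|.
  by rewrite mulrDl mul1r -[leLHS]add0r lerD// ler_wpM2l// ler_norm.
have := ler_wpM2l (ltW z1) s1; move: H0 H1; rewrite mulrN mulrDr [K * _]mulrC; lra.
Qed.

Section DualSide.
Variables (R : realType) (d k1 n_in n_eq m_in m_eq k2 : nat).
Variable D : dro_data R d k1 n_in n_eq m_in m_eq k2.
Hypothesis lo_le_hi : forall i, lo D i <= hi D i.
Hypothesis mu_prob : forall i, prob_on (Omega_ D i) (mu D i).
Variables (N : nat) (v : 'I_N.+1 -> 'cV[R]_(m_in + m_eq)).
Hypothesis C2v : forall x w, S1 D x -> Omega D w ->
  C2 D x w = (fmax (fun k => payoff D x w (v k)))%:E.
Local Notation Vl := (borelV R (m_in + m_eq)).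

(** The Lagrangian of the first stage at (x, xi), with both slack terms
    made explicit. *)
Lemma slackness_identity (x : 'cV[R]_k1) (e : 'cV[R]_(m_in + m_eq)) xi_in xi_eq :
  L_eq D *m x = q_eq D ->
  dotp (c1 D) x + dotp (Q D *m x + b D) e =
  dotp (b D) e + dotp (q_in D) xi_in + dotp (q_eq D) xi_eq +
  dotp (c1 D + (Q D)^T *m e - (L_in D)^T *m xi_in - (L_eq D)^T *m xi_eq) x +
  dotp (L_in D *m x - q_in D) xi_in.
Proof.
move=> xeq; rewrite !dotpBl !dotpDl dotp_mulmx -!(dotp_mulmx _ x) xeq.
ring.
Qed.

Lemma dotp_ge0 n (u w : 'cV[R]_n) : vle 0 u -> vle 0 w -> 0 <= dotp u w.
Proof.
move=> u0 w0; apply: sumr_ge0 => i _.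
by have := u0 i; have := w0 i; rewrite !mxE => ? ?; rewrite mulr_ge0.
Qed.

Lemma dual_slack_ge0 (x : 'cV[R]_k1) e xi_in xi_eq : S1 D x ->
  vle ((L_in D)^T *m xi_in + (L_eq D)^T *m xi_eq) (c1 D + (Q D)^T *m e) ->
  0 <= dotp (c1 D + (Q D)^T *m e - (L_in D)^T *m xi_in - (L_eq D)^T *m xi_eq) x.
Proof.
move=> [x0 _ _] xiL; apply: dotp_ge0 => // j; have := xiL j.
by rewrite [in X in X -> _]mxE [in X in _ -> X]mxE -subr_ge0 opprD addrA !mxE.
Qed.

Lemma primal_slack_ge0 (x : 'cV[R]_k1) xi_in : S1 D x -> vle xi_in 0 ->
  0 <= dotp (L_in D *m x - q_in D) xi_in.
Proof.
move=> [_ xin _] xi0.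
have -> : dotp (L_in D *m x - q_in D) xi_in = dotp (q_in D - L_in D *m x) (- xi_in).
  by rewrite !dotpBl !(linfN _ (@scalar_dotp _ _ _)); ring.
apply: dotp_ge0 => i; rewrite !mxE.
  by have := xin i; rewrite mxE subr_ge0.
by have := xi0 i; rewrite !mxE oppr_ge0.
Qed.

Section Tau.
Variables (tau : probability Vl R) (xi_in : 'cV[R]_n_in) (xi_eq : 'cV[R]_n_eq).
Hypothesis tauF : dual_feasible D (tau, xi_in, xi_eq).

Let tau1 : prob1_on (S2 D : set Vl) tau. Proof. by case: tauF. Qed.

Lemma dual_feasibleE : vle ((L_in D)^T *m xi_in + (L_eq D)^T *m xi_eq)
  (c1 D + (Q D)^T *m mean tau).
Proof. by case: tauF => + _ _; rewrite QT_meanE. Qed.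

(** The two slack terms are nonnegative. *)
Lemma dual_le_glued x : S1 D x ->
  (dual_obj D (tau, xi_in, xi_eq) <=
   (dotp (c1 D) x + (dotp (Q D *m x + b D) (mean tau) + \sum_i transport_value D tau i))%:E)%E.
Proof.
move=> Sx; have [_ _ xeq] := Sx; rewrite (dual_objE lo_le_hi mu_prob tau1) lee_fin addrA.
rewrite (slackness_identity (mean tau) xi_in xi_eq xeq).
have := dual_slack_ge0 Sx dual_feasibleE.
have := primal_slack_ge0 Sx (let: And3 _ _ h := tauF in h).
lra.
Qed.

Lemma dro_obj_ge_glued x : S1 D x ->
  ((dotp (c1 D) x)%:E + worst_case_obj D x (marginal_Omega (glued lo_le_hi mu_prob tau)) <= dro_obj D x)%E.
Proof.
move=> Sx; rewrite /dro_obj leeD2l//; apply: ereal_sup_ubound.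
exists (marginal_Omega (glued lo_le_hi mu_prob tau)) => //.
exact: glued_Gamma.
Qed.

Lemma dual_le_dro_obj x : S1 D x ->
  (dual_obj D (tau, xi_in, xi_eq) <= dro_obj D x)%E.
Proof.
move=> Sx; apply: (le_trans (dual_le_glued Sx)); apply: (le_trans _ (dro_obj_ge_glued Sx)).
by rewrite EFinD leeD2l// (glued_le_worst_case lo_le_hi mu_prob C2v tau1).
Qed.

(** S2 is an intersection of half-spaces, each of which contains the mean. *)
Lemma mean_S2 : S2 D (mean tau).
Proof.
have mS2 := measurable_S2 D; have tS : tau (S2 D) = 1%E by case: tau1.
rewrite S2_polyhedron => i /=; rewrite -(dotp_mean tau1) -lee_fin.
rewrite -(EFin_Rintegral (integrable_dotp tau1 _)) -(Rintegral_cst_prob tau (S2_bound D i)).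
rewrite -EFin_Rintegral; last exact: integrable_cst_prob.
apply: (prob1_le_integral mS2 tS).
- exact: (integrable_dotp tau1 (S2_normal D i)).
- exact: integrable_cst_prob.
- by move=> l; rewrite S2_polyhedron => Sl; rewrite lee_fin; exact: Sl.
Qed.

Section FeasiblePotentials.
Variables (x : 'cV[R]_k1) (f : 'I_d -> R -> R).
Hypothesis xf : primal_feasible D (x, f).
Let cvx i : Ccvx (f i). Proof. by case: xf. Qed.
Let Z i (l : Vl) : R := dotp (col i (P D)) (l : 'cV[R]_(m_in + m_eq)).

Let mZ i : measurable_fun setT (Z i). Proof. exact: measurable_dotp. Qed.

Let mf i : measurable_fun setT (f i).
Proof. by apply: continuous_measurable_fun; case: (cvx i). Qed.

(** Convexity bounds each f_i from below by a linear growth; the constraint bounds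
    the sum of the f_i from above, hence each of them, by linear growth as well. *)
Lemma integrable_potential_comp i : tau.-integrable setT (EFin \o (f i \o Z i)).
Proof.
pose K j : R := `|f j 0| + `|f j 1| + `|f j (- 1)|.
pose k (l : Vl) : R := `|dotp (Q D *m x + b D) (l : 'cV[R]_(m_in + m_eq))| +
   \sum_j K j * (1 + `|Z j l|).
have abs_int (h : Vl -> R) : tau.-integrable setT (EFin \o h) ->
    tau.-integrable setT (EFin \o (fun l => `|h l|)).
  by move=> hi; have := integrable_abse hi; apply: eq_integrable.
have ki : tau.-integrable setT (EFin \o k).
  apply: integrableDR; first by apply: abs_int; exact: (integrable_dotp tau1).
  apply: integrable_sumR => j; apply: integrableZR; apply: integrableDR.
    exact: integrable_cst_prob.
  by apply: abs_int; exact: (integrable_dotp tau1).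
have tS : tau (S2 D) = 1%E by case: tau1.
apply: (prob1_integrable_le (measurable_S2 D) tS _ ki); first exact: measurableT_comp.
move=> l Sl; rewrite [leRHS]ger0_norm; last first.
  by rewrite addr_ge0// sumr_ge0// => j _; rewrite mulr_ge0// !addr_ge0.
have lb j : - (K j * (1 + `|Z j l|)) <= f j (Z j l) by exact: convex_ge_linear.
have KZ j : 0 <= K j * (1 + `|Z j l|) by rewrite mulr_ge0// !addr_ge0.
have Ki : K i * (1 + `|Z i l|) <= \sum_j K j * (1 + `|Z j l|).
  by rewrite (bigD1 i)//= lerDl sumr_ge0.
rewrite ler_norml; apply/andP; split.
  rewrite /k/=; have := lb i; have := normr_ge0 (dotp (Q D *m x + b D) (l : 'cV[R]_(m_in + m_eq))); lra.
have /= := let: And5 _ _ h _ _ := xf in h l Sl; rewrite /primal_constr/= (bigD1 i)//= -/(Z i l).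
have : - (\sum_(j | j != i) f j (Z j l)) <= \sum_j K j * (1 + `|Z j l|).
  rewrite -sumrN (bigD1 (P := xpredT) i)//=.
  rewrite (le_trans _ (_ : \sum_(j | j != i) K j * (1 + `|Z j l|) <= _)) ?lerDr//.
  by apply: ler_sum => j _; rewrite lerNl.
have := lerNnormlW (lexx `|dotp (Q D *m x + b D) (l : 'cV[R]_(m_in + m_eq))|).
rewrite /k /Z; lra.
Qed.

Lemma push_potential_integrable i : (push D tau i).-integrable setT (EFin \o f i).
Proof.
have mfi : measurable_fun setT (EFin \o f i) by exact/measurable_EFinP.
have Znu : same_measure (pushforward tau (Z i)) (push D tau i) by [].
by apply/(integrable_transfer (mZ i) Znu mfi); exact: integrable_potential_comp.
Qed.

Lemma push_potentialE i : (\int[push D tau i]_z (f i z)%:E)%E = (\int[tau]_l f i (Z i l))%:E.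
Proof.
have mfi : measurable_fun setT (EFin \o f i) by exact/measurable_EFinP.
have Znu : same_measure (pushforward tau (Z i)) (push D tau i) by [].
rewrite -(integral_transfer (mZ i) Znu mfi).
exact: (EFin_Rintegral (integrable_potential_comp i)).
Qed.

Let constr (l : Vl) : R := primal_constr D x f (l : 'cV[R]_(m_in + m_eq)).

Lemma integrable_constr : tau.-integrable setT (EFin \o constr).
Proof.
apply: integrableDR; first exact: (integrable_dotp tau1).
by apply: integrable_sumR => i; exact: integrable_potential_comp.
Qed.

Lemma integral_constr : \int[tau]_l constr l =
  dotp (Q D *m x + b D) (mean tau) + \sum_i \int[tau]_l f i (Z i l).
Proof.
rewrite /constr /primal_constr RintegralD//; [|exact: (integrable_dotp tau1)|]; last first.
  by apply: integrable_sumR => i; exact: integrable_potential_comp.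
rewrite (dotp_mean tau1); congr (_ + _); apply: Rintegral_sum => i.
exact: integrable_potential_comp.
Qed.

Lemma integral_constr_le0 : \int[tau]_l constr l <= 0.
Proof.
have tS : tau (S2 D) = 1%E by case: tau1.
rewrite -lee_fin -(EFin_Rintegral integrable_constr) -(Rintegral_cst_prob tau 0).
rewrite -EFin_Rintegral; last exact: integrable_cst_prob.
apply: (prob1_le_integral (measurable_S2 D) tS integrable_constr).
  exact: integrable_cst_prob.
by move=> l Sl; rewrite lee_fin; case: xf => _ _ /(_ l Sl).
Qed.

Lemma integral_constr_eq0 : \int[tau]_l constr l = 0 <->
  {ae tau, forall l, primal_constr D x f l = 0}.
Proof.
have tS : tau (S2 D) = 1%E by case: tau1.
have iN : tau.-integrable setT (fun l => (- constr l)%:E).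
  by have := integrableN integrable_constr; apply: eq_integrable.
have N0 l : S2 D l -> (0 <= (- constr l)%:E)%E.
  by move=> Sl; rewrite lee_fin oppr_ge0; case: xf => _ _ /(_ l Sl).
have H := ge0_prob1_integral_eq0 (measurable_S2 D) tS iN N0.
have E : (\int[tau]_l (- constr l)%:E)%E = (- \int[tau]_l constr l)%:E.
  under eq_integral do rewrite EFinN.
  rewrite integralN; last by apply: integrable_add_def => //; exact: integrable_constr.
  by rewrite (EFin_Rintegral integrable_constr).
rewrite E in H; split=> [c0|c_ae].
  have /H h_ae : (- \int[tau]_l constr l)%:E = 0%E by rewrite c0 oppr0.
  by apply: (ae_imp2 h_ae h_ae) => l [/eqP]; rewrite oppr_eq0 => /eqP.
have /H [/eqP] : {ae tau, forall l, (- constr l)%:E = 0%E}.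
  by apply: (ae_imp2 c_ae c_ae) => l cl _; rewrite /constr cl oppr0.
by rewrite oppr_eq0 => /eqP.
Qed.

End FeasiblePotentials.
End Tau.
End DualSide.

(** * Optimal values, attainment and optimality conditions *)

Section Dirac.
Variables (R : realType) (d k1 n_in n_eq m_in m_eq k2 : nat).
Variable D : dro_data R d k1 n_in n_eq m_in m_eq k2.
Local Notation Vl := (borelV R (m_in + m_eq)).
Variable l : 'cV[R]_(m_in + m_eq).
Hypothesis Sl : S2 D l.

Lemma diracV_prob1 : prob1_on (S2 D : set Vl) (diracV l).
Proof.
have lS : diracV l (S2 D : set Vl) = 1%E by rewrite /diracV/= diracE mem_set.
split=> //; have mn : measurable_fun setT (EFin \o (fun l : Vl => `|l : 'cV[R]_(m_in + m_eq)|)).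
  by apply/measurable_EFinP; apply: continuous_measurableV; exact: norm_continuousV.
rewrite (prob1_integral (measurable_S2 D) lS)// /diracV/= integral_dirac//.
by rewrite diracT mul1e ltry.
Qed.

Lemma mean_diracV : mean (diracV l) = l.
Proof.
apply/matrixP => j j'; rewrite ord1 mxE /Rintegral /diracV/= integral_dirac//.
  by rewrite diracT mul1e.
by apply/measurable_EFinP; exact: measurable_coord.
Qed.

Lemma diracV_feasible xi_in xi_eq : vle xi_in 0 ->
  vle ((L_in D)^T *m xi_in + (L_eq D)^T *m xi_eq) (c1 D + (Q D)^T *m l) ->
  dual_feasible D (diracV l, xi_in, xi_eq).
Proof.
move=> xi0 xiL; split=> //; last exact: diracV_prob1.
by rewrite (QT_meanE diracV_prob1) mean_diracV.
Qed.

End Dirac.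

Lemma eqNy_of_le (R : realDomainType) (x : \bar R) :
  (forall r : R, (x <= r%:E)%E) -> x = -oo%E.
Proof.
case: x => [r| |] // H; last by have := H 0; rewrite leye_eq.
by have := H (r - 1); rewrite lee_fin -subr_ge0 addrAC subrr add0r oppr_ge0 ler10.
Qed.

Section Values.
Variables (R : realType) (d k1 n_in n_eq m_in m_eq k2 : nat).
Variable D : dro_data R d k1 n_in n_eq m_in m_eq k2.
Hypothesis d_gt0 : (0 < d)%N.
Hypothesis lo_le_hi : forall i, lo D i <= hi D i.
Hypothesis mu_prob : forall i, prob_on (Omega_ D i) (mu D i).
Hypothesis S1_neq0 : S1 D !=set0.
Variables (N : nat) (v : 'I_N.+1 -> 'cV[R]_(m_in + m_eq)).
Hypothesis vS : forall k, S2 D (v k).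
Hypothesis C2v : forall x w, S1 D x -> Omega D w ->
  C2 D x w = (fmax (fun k => payoff D x w (v k)))%:E.
Local Open Scope ereal_scope.

Lemma dual_le_C_DRO w : dual_feasible D w -> dual_obj D w <= C_DRO D.
Proof.
case: w => [[tau xi_in] xi_eq] wF; apply: le_ereal_inf_tmp => _ [x Sx <-].
exact: (dual_le_dro_obj lo_le_hi mu_prob C2v wF Sx).
Qed.

Lemma C_DRO_le_dro_obj x : S1 D x -> C_DRO D <= dro_obj D x.
Proof. by move=> Sx; apply: ereal_inf_lbound; exists x. Qed.

Lemma C_DRO_le_primal u : primal_feasible D u -> C_DRO D <= primal_obj D u.
Proof.
case: u => x f xf; apply: (le_trans (C_DRO_le_dro_obj (primal_feasible_S1 xf))).
exact: (dro_le_primal mu_prob C2v xf).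
Qed.

Lemma C_DRO_le_min_primal : C_DRO D <= min_value (primal_feasible D) (primal_obj D).
Proof. by apply: le_ereal_inf_tmp => _ [u uF <-]; exact: C_DRO_le_primal. Qed.

Lemma max_dual_le_C_DRO : max_value (dual_feasible D) (dual_obj D) <= C_DRO D.
Proof. by apply: ge_ereal_sup => _ [w wF <-]; exact: dual_le_C_DRO. Qed.

(** Either the reduced objective is bounded below, and its minimizer yields both a
    primal and a dual point of the same value, or the primal points constructed from
    it have arbitrarily small values. *)
Lemma strong_duality_or_unbounded :
  (exists u w, [/\ primal_feasible D u, dual_feasible D w,
     primal_obj D u = C_DRO D, dual_obj D w = C_DRO D & supp w.1.1 `<=` range v]) \/
  (C_DRO D = -oo /\ min_value (primal_feasible D) (primal_obj D) = -oo).
Proof.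
have [[m mh]|unb] := pselect (exists m : R, forall x psi, S1 D x -> (m <= reduced_obj D v x psi)%R).
  left; have [x [psi [Sx xmin]]] := reduced_obj_attained mu_prob S1_neq0 mh.
  have [tau [xi_in [xi_eq [wF wge sw]]]] :=
    dual_of_lower_bound lo_le_hi mu_prob S1_neq0 vS (fun y phi Sy => xmin y phi Sy).
  have uF := extension_feasible lo_le_hi C2v psi d_gt0 Sx.
  have ule := extension_obj lo_le_hi mu_prob v x psi d_gt0.
  exists (x, extension D v x psi), (tau, xi_in, xi_eq); split=> //.
  - apply/eqP; rewrite eq_le C_DRO_le_primal// andbT.
    by apply: (le_trans ule); apply: (le_trans wge); exact: dual_le_C_DRO.
  - apply/eqP; rewrite eq_le dual_le_C_DRO//=.
    by apply: le_trans wge; apply: (le_trans _ ule); exact: C_DRO_le_primal.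
right; suff E : min_value (primal_feasible D) (primal_obj D) = -oo.
  by split=> //; apply/eqP; rewrite -leeNy_eq -E; exact: C_DRO_le_min_primal.
apply: eqNy_of_le => r; apply: contrapT => nr; apply: unb; exists r => x psi Sx.
rewrite leNgt; apply/negP => xr; apply: nr.
apply: (@le_trans _ _ (reduced_obj D v x psi)%:E); last by rewrite lee_fin ltW.
apply: (le_trans _ (extension_obj lo_le_hi mu_prob v x psi d_gt0)).
apply: ereal_inf_lbound; exists (x, extension D v x psi) => //.
exact: (extension_feasible lo_le_hi C2v psi d_gt0 Sx).
Qed.

End Values.

Section Optimality.
Variables (R : realType) (d k1 n_in n_eq m_in m_eq k2 : nat).
Variable D : dro_data R d k1 n_in n_eq m_in m_eq k2.
Hypothesis d_gt0 : (0 < d)%N.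
Hypothesis lo_le_hi : forall i, lo D i <= hi D i.
Hypothesis mu_prob : forall i, prob_on (Omega_ D i) (mu D i).
Hypothesis S1_neq0 : S1 D !=set0.
Variables (N : nat) (v : 'I_N.+1 -> 'cV[R]_(m_in + m_eq)).
Hypothesis vS : forall k, S2 D (v k).
Hypothesis C2v : forall x w, S1 D x -> Omega D w ->
  C2 D x w = (fmax (fun k => payoff D x w (v k)))%:E.
Local Open Scope ereal_scope.

Let sd := strong_duality_or_unbounded d_gt0 lo_le_hi mu_prob S1_neq0 vS C2v.

Lemma min_primalE : min_value (primal_feasible D) (primal_obj D) = C_DRO D.
Proof.
case: sd => [[u [w [uF wF uC wC _]]]|[-> ->//]].
apply/eqP; rewrite eq_le (C_DRO_le_min_primal mu_prob C2v) andbT -uC.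
by apply: ereal_inf_lbound; exists u.
Qed.

Lemma max_dualE : max_value (dual_feasible D) (dual_obj D) = C_DRO D.
Proof.
apply/eqP; rewrite eq_le (max_dual_le_C_DRO lo_le_hi mu_prob C2v)/=.
case: sd => [[u [w [uF wF uC wC _]]]|[-> _]]; last by rewrite leNye.
by rewrite -wC; apply: ereal_sup_ubound; exists w.
Qed.

Lemma dual_obj_fin w : dual_feasible D w -> dual_obj D w \is a fin_num.
Proof.
case: w => [[tau xi_in] xi_eq] wF.
have tau1 : prob1_on (S2 D : set (borelV R (m_in + m_eq))) tau by case: wF.
by rewrite (dual_objE lo_le_hi mu_prob tau1).
Qed.

Lemma C_DRO_lty : C_DRO D < +oo.
Proof.
case: sd => [[u [w [uF wF uC wC _]]]|[-> _]]; last by [].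
by rewrite -wC -(fineK (dual_obj_fin wF)) ltry.
Qed.

(** A dual feasible measure may be replaced by the Dirac mass at its mean, and any dual
    feasible point has a finite value. *)
Lemma C_DRO_gtNyP : -oo < C_DRO D <-> exists l xi_in xi_eq,
  [/\ S2 D l, vle xi_in 0 &
    vle ((L_in D)^T *m xi_in + (L_eq D)^T *m xi_eq)%R (c1 D + (Q D)^T *m l)%R].
Proof.
split=> [C_gt|[l [xi_in [xi_eq [Sl xi0 xiL]]]]].
  case: sd => [[u [[[tau xi_in] xi_eq] [uF wF uC wC _]]]|[CN _]]; last first.
    by rewrite CN ltxx in C_gt.
  exists (mean tau), xi_in, xi_eq; split; first exact: (mean_S2 wF).
    by case: wF.
  exact: (dual_feasibleE wF).
have wF := diracV_feasible Sl xi0 xiL.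
apply: (lt_le_trans _ (dual_le_C_DRO lo_le_hi mu_prob C2v wF)).
by rewrite -(fineK (dual_obj_fin wF)) ltNyr.
Qed.

Section Finite.
Hypothesis C_gt : -oo < C_DRO D.

Lemma C_DRO_fin : C_DRO D \is a fin_num.
Proof. by rewrite fin_numE -ltNye C_gt -ltey C_DRO_lty. Qed.

Lemma primal_attained : exists u, minimizer (primal_feasible D) (primal_obj D) u.
Proof.
case: sd => [[u [w [uF _ uC _ _]]]|[CN _]]; last by have := C_gt; rewrite CN ltxx.
by exists u; split=> //; rewrite min_primalE.
Qed.

Lemma dual_attained : exists tau xi_in xi_eq,
  maximizer (dual_feasible D) (dual_obj D) (tau, xi_in, xi_eq) /\ supp tau `<=` range v.
Proof.
case: sd => [[u [[[tau xi_in] xi_eq] [uF wF uC wC sw]]]|[CN _]]; last first.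
  by have := C_gt; rewrite CN ltxx.
by exists tau, xi_in, xi_eq; split=> //; split=> //; rewrite max_dualE.
Qed.

Lemma sum_conjugate_fin x f : minimizer (primal_feasible D) (primal_obj D) (x, f) ->
  [/\ dro_obj D x = C_DRO D,
    \sum_(i < d) \int[mu D i]_w conjugate (f i) w \is a fin_num &
    max_value (Gamma D) (worst_case_obj D x) = \sum_(i < d) \int[mu D i]_w conjugate (f i) w].
Proof.
move=> [xf]; rewrite min_primalE => pE; have Sx := primal_feasible_S1 xf.
have dE : dro_obj D x = C_DRO D.
  apply/eqP; rewrite eq_le C_DRO_le_dro_obj// andbT -pE.
  exact: (dro_le_primal mu_prob C2v xf).
have Cf := C_DRO_fin; move: pE; rewrite (primal_objE mu_prob) => pE.
have sE : \sum_(i < d) \int[mu D i]_w conjugate (f i) w = C_DRO D - (dotp (c1 D) x)%:E.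
  by rewrite -pE addeAC subee// add0e.
split=> //; first by rewrite sE fin_numB Cf.
by rewrite sE -dE /dro_obj addeAC subee// add0e.
Qed.

(** The primal value at a minimizer is the robust cost of x, so g is a worst case
    exactly when its expected cost equals the sum of the integrated conjugates. *)
Lemma primal_minimizer_worst_case x f : minimizer (primal_feasible D) (primal_obj D) (x, f) ->
  minimizer (S1 D) (dro_obj D) x /\
  forall g, Gamma D g ->
    (maximizer (Gamma D) (worst_case_obj D x) g <->
     {ae g, forall w, Omega D w ->
       \sum_(i < d) conjugate (f i) (w i 0%R) = C2 D x w}).
Proof.
move=> xfmin; have [dE sfin mE] := sum_conjugate_fin xfmin.
have [xf _] := xfmin; have Sx := primal_feasible_S1 xf.
split=> [//|g gG].
have foo i : \int[mu D i]_w conjugate (f i) w < +oo.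
  apply: (@sum_gtNy_ltyP _ _ (fun i => \int[mu D i]_w conjugate (f i) w)).
    by move=> j; exact: integral_conjugate_gtNy.
  by move: sfin; rewrite fin_numE -ltey => /andP[].
rewrite -(worst_case_eq_conjugate C2v gG xf foo) -mE.
by split=> [[]|].
Qed.

Lemma eps_primal_minimizer eps x f :
  eps_minimizer eps (primal_feasible D) (primal_obj D) (x, f) ->
  eps_minimizer eps (S1 D) (dro_obj D) x.
Proof.
move=> [xf pe]; split; first exact: (primal_feasible_S1 xf).
apply: (le_trans (dro_le_primal mu_prob C2v xf)).
by rewrite -/(C_DRO D) -min_primalE.
Qed.

(** The dual value is at most the robust value through the glued law; equality of the
    extremes makes every inequality in between an equality, for every optimal x. *)
Lemma dual_maximizer_coupling tau xi_in xi_eq :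
  maximizer (dual_feasible D) (dual_obj D) (tau, xi_in, xi_eq) ->
  exists pi, joint_couplings D tau pi /\
    forall x, minimizer (S1 D) (dro_obj D) x ->
      {ae pi, forall wl, Omega_S2 D wl ->
        maximizer (S2 D) (C2_obj D x wl.1) wl.2} /\
      maximizer (Gamma D) (worst_case_obj D x) (marginal_Omega pi).
Proof.
move=> [wF]; rewrite max_dualE => wC.
have tau1 : prob1_on (S2 D : set (borelV R (m_in + m_eq))) tau by case: wF.
exists (glued lo_le_hi mu_prob tau); split; first exact: (glued_joint lo_le_hi mu_prob tau1).
move=> x [Sx]; rewrite -/(C_DRO D) => xC.
pose wc := worst_case_obj D x (marginal_Omega (glued lo_le_hi mu_prob tau)).
have GG := glued_Gamma lo_le_hi mu_prob tau1.
have le1 := dual_le_glued lo_le_hi mu_prob wF Sx; rewrite wC EFinD in le1.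
have le2 := glued_le_worst_case lo_le_hi mu_prob C2v tau1 Sx.
have le3 : wc <= max_value (Gamma D) (worst_case_obj D x).
  by apply: ereal_sup_ubound; exists (marginal_Omega (glued lo_le_hi mu_prob tau)).
have mE : max_value (Gamma D) (worst_case_obj D x) = C_DRO D - (dotp (c1 D) x)%:E.
  by rewrite -xC /dro_obj addeAC subee// add0e.
have le4 : max_value (Gamma D) (worst_case_obj D x) <=
    (dotp (Q D *m x + b D) (mean tau) + \sum_i transport_value D tau i)%:E.
  by rewrite mE leeBlDl.
have E1 : (dotp (Q D *m x + b D) (mean tau) + \sum_i transport_value D tau i)%:E = wc.
  by apply/eqP; rewrite eq_le le2/= (le_trans le3 le4).
split; first exact: (glued_eq_worst_case C2v tau1 Sx E1).
by split=> //; apply/eqP; rewrite eq_le le3/= -/wc -E1.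
Qed.

(** Both points are optimal exactly when their values agree.  The difference of the
    values is the sum of the two slack terms of the first stage, of minus the integral of
    the constraint, and over i of the gaps in one-dimensional weak duality;
    all are nonnegative, so it vanishes exactly when each of them does. *)
Lemma complementary_slackness x f tau xi_in xi_eq :
  primal_feasible D (x, f) -> dual_feasible D (tau, xi_in, xi_eq) ->
  (minimizer (primal_feasible D) (primal_obj D) (x, f) /\
   maximizer (dual_feasible D) (dual_obj D) (tau, xi_in, xi_eq) <->
   [/\ dotp (L_in D *m x - q_in D)%R xi_in = 0%R,
       dotp (c1 D + QT_mean D tau - (L_in D)^T *m xi_in
             - (L_eq D)^T *m xi_eq)%R x = 0%R,
       {ae tau, forall l, primal_constr D x f l = 0%R} &
       forall i, - (\int[mu D i]_(w in Omega_ D i) conjugate (f i) w)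
                 - (\int[push D tau i]_z (f i z)%:E)
                 = OT (Omega_ D i) (mu D i) (push D tau i)]).
Proof.
move=> xf wF; have Sx := primal_feasible_S1 xf.
have tau1 : prob1_on (S2 D : set (borelV R (m_in + m_eq))) tau by case: wF.
have [_ _ xeq] := Sx.
have dslack := dual_slack_ge0 Sx (dual_feasibleE wF).
have pslack := primal_slack_ge0 Sx (let: And3 _ _ h := wF in h).
have ident := slackness_identity (mean tau) xi_in xi_eq xeq.
have cle0 := integral_constr_le0 wF xf.
have ceq0 := integral_constr_eq0 wF xf.
have cE := integral_constr wF xf.
rewrite (QT_meanE tau1).
pose F i := (\int[tau]_l f i (dotp (col i (P D)) (l : 'cV[R]_(m_in + m_eq))))%R.
have FE i : \int[push D tau i]_z (f i z)%:E = (F i)%:E := push_potentialE wF xf i.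
pose C i := \int[mu D i]_w conjugate (f i) w.
have CE i : \int[mu D i]_(w in Omega_ D i) conjugate (f i) w = C i.
  exact: integral_conjugate_Omega.
have OTE i := OT_push lo_le_hi mu_prob tau1 i.
have CgtNy i : -oo < C i by exact: integral_conjugate_gtNy.
have Cge i : (transport_value D tau i - F i)%:E <= C i.
  have := @OT_ge _ (mu D i) _ (lo D i) (hi D i) (push_integrable tau1 i) _ (push_potential_integrable wF xf i).
  rewrite FE -/(C i) OTE; case: (C i) (CgtNy i) => [r| |]//= _.
    by rewrite !lee_fin; lra.
  by rewrite leey.
have dual_real := dual_objE lo_le_hi mu_prob tau1 xi_in xi_eq.
have primal_real := primal_objE mu_prob x f.
have cE' : (\int[tau]_l primal_constr D x f (l : 'cV[R]_(m_in + m_eq)) =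
  dotp (Q D *m x + b D) (mean tau) + \sum_i F i)%R by exact: cE.
(* equal values pin both points to the common optimal value *)
have opt : minimizer (primal_feasible D) (primal_obj D) (x, f) /\
   maximizer (dual_feasible D) (dual_obj D) (tau, xi_in, xi_eq) <->
   primal_obj D (x, f) = dual_obj D (tau, xi_in, xi_eq).
  split=> [[[_ ->] [_ ->]]|E]; first by rewrite min_primalE max_dualE.
  have h1 := C_DRO_le_primal mu_prob C2v xf.
  have h2 := dual_le_C_DRO lo_le_hi mu_prob C2v wF.
  split; split=> //; rewrite ?min_primalE ?max_dualE; apply/eqP; rewrite eq_le.
    by rewrite h1 andbT E.
  by rewrite h2 andTb -E.
apply: (iff_trans opt); rewrite dual_real primal_real.
split=> [E|[a_ b_ /ceq0 c_ d_]].
  (* equality with the finite dual value excludes infinite integrals *)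
  have sfin : \sum_(i < d) C i < +oo.
    rewrite ltey; apply/eqP => sy; move: E; rewrite -/(\sum_(i < d) C i) sy addey//.
  have Cfin i : C i \is a fin_num.
    by rewrite fin_numE -ltNye CgtNy -ltey; exact: (sum_gtNy_ltyP CgtNy sfin).
  pose c i := fine (C i); have cC i : C i = (c i)%:E by rewrite fineK.
  have cge i : (transport_value D tau i - F i <= c i)%R by rewrite -lee_fin -cC.
  have sE : \sum_(i < d) C i = (\sum_i c i)%:E by rewrite -sumEFin; apply: eq_bigr.
  move: E; rewrite -/(\sum_(i < d) C i) sE -EFinD => -[E].
  have sge : (\sum_i (transport_value D tau i - F i) <= \sum_i c i)%R by apply: ler_sum.
  have sge' := sge; rewrite sumrB in sge'.
  split.
  - lra.
  - lra.
  - apply/ceq0; rewrite cE'; lra.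
  - have eqs : (\sum_i (c i - (transport_value D tau i - F i)) = 0)%R.
      by rewrite sumrB sumrB; lra.
    have /eqP := eqs; rewrite psumr_eq0; last by move=> i _; rewrite subr_ge0.
    move=> /allP eqi i; have := eqi i; rewrite mem_index_enum => /(_ isT).
    rewrite subr_eq0 => /eqP ci; rewrite CE FE OTE cC ci -EFinN -EFinB; congr EFin; lra.
have Cv i : C i = (transport_value D tau i - F i)%:E.
  have := d_ i; rewrite CE FE OTE; case: (C i) (CgtNy i) => [r| |]//= _.
  by move=> -[?]; congr EFin; lra.
rewrite -/(\sum_(i < d) C i) (eq_bigr _ (fun i _ => Cv i)) sumEFin -EFinD; congr EFin.
by rewrite sumrB; move: c_; rewrite cE'; lra.
Qed.

End Finite.
End Optimality.

Local Open Scope ereal_scope.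

Theorem theorem3p1 (R : realType) (d k1 n_in n_eq m_in m_eq k2 : nat)
    (D : dro_data R d k1 n_in n_eq m_in m_eq k2)
    (d_ge2 : (2 <= d)%N) (k1_gt0 : (0 < k1)%N)
    (k2s_gt0 : (0 < m_in + m_eq)%N) (k2_gt0 : (0 < k2)%N)
    (lo_le_hi : forall i, (lo D i <= hi D i)%R)
    (mu_prob : forall i, prob_on (Omega_ D i) (mu D i))
    (S1_neq0 : S1 D !=set0) (S2_neq0 : S2 D !=set0)
    (C2_bounded :
      ereal_sup [set C2 D x w | x in S1 D & w in Omega D] < +oo) :
  [/\ C_DRO D < +oo,
      min_value (primal_feasible D) (primal_obj D) = C_DRO D &
      max_value (dual_feasible D) (dual_obj D) = C_DRO D] /\
  (-oo < C_DRO D <->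
   exists l xi_in xi_eq,
     [/\ S2 D l, vle xi_in 0 &
         vle ((L_in D)^T *m xi_in + (L_eq D)^T *m xi_eq)%R
             (c1 D + (Q D)^T *m l)%R]) /\
  (forall l xi_in xi_eq,
     S2 D l -> vle xi_in 0 ->
     vle ((L_in D)^T *m xi_in + (L_eq D)^T *m xi_eq)%R
         (c1 D + (Q D)^T *m l)%R ->
     dual_feasible D (diracV l, xi_in, xi_eq)) /\
  (-oo < C_DRO D ->
    (exists v, minimizer (primal_feasible D) (primal_obj D) v) /\
    (forall x f, minimizer (primal_feasible D) (primal_obj D) (x, f) ->
      minimizer (S1 D) (dro_obj D) x /\
      forall g, Gamma D g ->
        (maximizer (Gamma D) (worst_case_obj D x) g <->
         {ae g, forall w, Omega D w ->
           \sum_(i < d) conjugate (f i) (w i 0%R) = C2 D x w})) /\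
    (forall (eps : R) x f, (0 < eps)%R ->
      eps_minimizer eps (primal_feasible D) (primal_obj D) (x, f) ->
      eps_minimizer eps (S1 D) (dro_obj D) x) /\
    (exists tau xi_in xi_eq,
      maximizer (dual_feasible D) (dual_obj D) (tau, xi_in, xi_eq) /\
      supp tau `<=` V_extr D) /\
    (forall tau xi_in xi_eq,
      maximizer (dual_feasible D) (dual_obj D) (tau, xi_in, xi_eq) ->
      exists pi, joint_couplings D tau pi /\
        forall x, minimizer (S1 D) (dro_obj D) x ->
          {ae pi, forall wl, Omega_S2 D wl ->
            maximizer (S2 D) (C2_obj D x wl.1) wl.2} /\
          maximizer (Gamma D) (worst_case_obj D x) (marginal_Omega pi)) /\
    (forall x f tau xi_in xi_eq,
      primal_feasible D (x, f) -> dual_feasible D (tau, xi_in, xi_eq) ->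
      (minimizer (primal_feasible D) (primal_obj D) (x, f) /\
       maximizer (dual_feasible D) (dual_obj D) (tau, xi_in, xi_eq) <->
       [/\ dotp (L_in D *m x - q_in D)%R xi_in = 0%R,
           dotp (c1 D + QT_mean D tau - (L_in D)^T *m xi_in
                 - (L_eq D)^T *m xi_eq)%R x = 0%R,
           {ae tau, forall l, primal_constr D x f l = 0%R} &
           forall i, - (\int[mu D i]_(w in Omega_ D i) conjugate (f i) w)
                     - (\int[push D tau i]_z (f i z)%:E)
                     = OT (Omega_ D i) (mu D i) (push D tau i)]))).
Proof.
have d_gt0 : (0 < d)%N by rewrite (leq_trans _ d_ge2).
have [N [v [vP C2v]]] := C2_vertices S2_neq0 C2_bounded.
have vS k : S2 D (v k) by have [] := vP k.
split.
  split; first exact: (C_DRO_lty d_gt0 lo_le_hi mu_prob S1_neq0 vS C2v).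
    exact: (min_primalE d_gt0 lo_le_hi mu_prob S1_neq0 vS C2v).
  exact: (max_dualE d_gt0 lo_le_hi mu_prob S1_neq0 vS C2v).
split; first exact: (C_DRO_gtNyP d_gt0 lo_le_hi mu_prob S1_neq0 vS C2v).
split; first by move=> l xi_in xi_eq Sl xi0 xiL; exact: diracV_feasible.
move=> C_gt; split.
  exact: (primal_attained d_gt0 lo_le_hi mu_prob S1_neq0 vS C2v C_gt).
split.
  move=> x f.
  exact: (primal_minimizer_worst_case d_gt0 lo_le_hi mu_prob S1_neq0 vS C2v C_gt).
split.
  move=> eps x f _.
  exact: (eps_primal_minimizer d_gt0 lo_le_hi mu_prob S1_neq0 vS C2v).
split.
  have [tau [xi_in [xi_eq [wmax sw]]]] :=
    dual_attained d_gt0 lo_le_hi mu_prob S1_neq0 vS C2v C_gt.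
  exists tau, xi_in, xi_eq; split=> //.
  by move=> l /sw [k _ <-]; have [] := vP k.
split.
  exact: (dual_maximizer_coupling d_gt0 lo_le_hi mu_prob S1_neq0 vS C2v).
exact: (complementary_slackness d_gt0 lo_le_hi mu_prob S1_neq0 vS C2v).
Qed.
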